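(* Let $\Lambda$ be a $\tau$-tilting finite algebra of rank $n$, let $\mathcal{W}$ be a wide subcategory of $\mathsf{mod}\,\Lambda$ and let $r$ be the rank of $\mathcal{W}$. Then any two $\tau$-exceptional sequences in $\tau\text{-}\mathrm{es}(\mathcal{W})$ (the set of $\tau$-exceptional sequences $\mathcal{X}$ with $\mathsf{J}(\mathcal{X})=\mathcal{W}$) are in the same orbit under the left and right mutations $\varphi_{r+1},\psi_{r+1},\ldots,\varphi_{n-1},\psi_{n-1}$. In particular, letting $\mathcal{W}=0$, any two complete $\tau$-exceptional sequences (i.e. $\tau$-exceptional sequences of length $n$) are in the same orbit under the action of left and right mutations.
   Context: **Basics.** $\Lambda$ is a basic finite-dimensional algebra over a field, $n$ is its rank (number of isomorphism classes of simple modules), $\mathsf{mod}\,\Lambda$ is the category of finite-dimensional left modules. Modules are basic and considered up to isomorphism; subcategories are full and closed under isomorphism. $\tau$ is the Auslander–Reiten translate. $M$ is $\tau$-rigid if $\mathrm{Hom}(M,\tau M)=0$. A support $\tau$-rigid object is a pair $(M,P)$, also written $M\oplus P[1]$, with $M$ $\tau$-rigid, $P$ projective and $\mathrm{Hom}(P,M)=0$. $\Lambda$ is $\tau$-tilting finite: there are only finitely many isomorphism classes of basic ($\tau$-rigid, equivalently support $\tau$-rigid) such objects. For a module $M$, $M^\perp=\{X\mid \mathrm{Hom}(M,X)=0\}$, ${}^\perp M=\{X\mid \mathrm{Hom}(X,M)=0\}$, and $\mathsf{Gen}\,M$ is the class of quotients of modules in $\mathsf{add}\,M$. $\mathcal{P}(\mathcal{T})$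 denotes the modules $Q\in\mathcal{T}$ with $\mathrm{Ext}^1(Q,\mathcal{T})=0$. A wide subcategory is one closed under kernels, cokernels and extensions. For a support $\tau$-rigid object, $\mathsf{J}(M,P)=M^\perp\cap{}^\perp(\tau M)\cap P^\perp$ is the $\tau$-perpendicular category, and $\mathsf{J}(M)=\mathsf{J}(M,0)$. As $\Lambda$ is $\tau$-tilting finite, wide subcategories are exactly the $\tau$-perpendicular categories, and each is equivalent to the module category of a $\tau$-tilting finite algebra; its rank is its number of simple objects up to isomorphism. All notions below are therefore also used relative to a wide subcategory $\mathcal{V}$ (indicated by a sub- or superscript $\mathcal{V}$): one works in $\mathcal{V}$ as a module category, with its own Auslander–Reiten translate $\tau_{\mathcal{V}}$, projectives, etc.; $\mathsf{Gen}_{\mathcal{V}}M=\mathsf{Gen}\,M\cap\mathcal{V}$, and $\mathsf{J}_{\mathcal{V}}(M)=M^\perp\cap{}^\perp(\tau_{\mathcal{V}}M)\cap\mathcal{V}$ for $M$ $\tau_{\mathcal V}$-rigid, which is again wide in $\mathsf{mod}\,\Lambda$. **$\tau$-exceptional sequences.** A sequence $(X_k,\dots,X_n)$ of indecomposable modules is $\tau$-exceptional if $X_n$ is $\tau$-rigid and, when $k<n$, $(X_k,\dots,X_{n-1})$ is a $\tau$-exceptional sequence in $\mathsf{J}(X_n)$ (with respect to $\tau_{\mathsf{J}(X_n)}$). Recursively $\mathsf{J}(X_k,\dots,X_n)=\mathsf{J}_{\mathsf{J}(X_{k+1},\dots,X_n)}(X_k)$. $\tau\text{-}\mathrm{es}(\mathcal{W})$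 is the set of $\tau$-exceptional sequences $\mathcal{X}$ with $\mathsf{J}(\mathcal{X})=\mathcal{W}$; if $\mathcal{W}$ has rank $r$ such sequences have the form $(X_{r+1},\dots,X_n)$. A $\tau$-exceptional pair is a $\tau$-exceptional sequence of length two. **The maps $\mathsf{E}$.** For $M$ $\tau$-rigid, $\mathsf{Gen}\,M$ is a torsion class; $f_M X$ is the quotient of $X$ by its largest submodule in $\mathsf{Gen}\,M$. There is a bijection $\mathsf{E}_M$ from indecomposable support $\tau$-rigid objects $X$ (not a summand of $M$) with $M\oplus X$ support $\tau$-rigid to indecomposable support $\tau$-rigid objects in $\mathsf{J}(M)$: if $X$ is a module not in $\mathsf{Gen}\,M$, then $\mathsf{E}_M(X)=f_M X$; otherwise ($X\in\mathsf{Gen}\,M$, or $X=P[1]$ with $P$ projective) $\mathsf{E}_M(X)=Q[1]$, where $Q$ is the unique indecomposable projective object of $\mathsf{J}(M)$ with $\mathsf{J}(M)\cap Q^\perp=\mathsf{J}(M\oplus X)$. Put $|N|=N$ and $|N[1]|=N$ for a module $N$. **Mutation of pairs.** Let $(B,C)$ be a $\tau$-exceptional pair. It is left regular if $C$ is projective or $C\notin\mathcal{P}({}^\perp\tau\,\mathsf{E}_C^{-1}(B))$, and left irregular otherwise. A $\tau$-exceptional pair $(X,Y)$ is right regular if $\mathsf{E}_Y^{-1}(X)\in\mathcal{P}({}^\perp\tau Y)$ or $Y\notin\mathsf{Gen}\,\mathsf{E}_Y^{-1}(X)$, and right irregular otherwise. Left mutation $\varphi$ is the following bijection on the set of $\tau$-exceptional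 pairs, satisfying $\mathsf{J}(\varphi(B,C))=\mathsf{J}(B,C)$. If $(B,C)$ is left regular, put $C_+=C[1]$ and $B_{C\uparrow}=B$ if $C$ is projective, and $C_+=C$ and $B_{C\uparrow}=\mathsf{E}_C^{-1}(B)$ otherwise; then $\varphi(B,C)=(|\mathsf{E}_{B_{C\uparrow}}(C_+)|,\,B_{C\uparrow})$. This gives a bijection from left regular to right regular pairs. For each wide subcategory $\mathcal{U}$ there is at most one left irregular pair $(B,C)$ with $\mathsf{J}(B,C)=\mathcal{U}$; if there is one, there is exactly one right irregular pair $(X,Y)$ with $\mathsf{J}(X,Y)=\mathcal{U}$, and $\varphi(B,C)=(X,Y)$. Right mutation is $\psi=\varphi^{-1}$. **Mutation of sequences.** For a $\tau$-exceptional sequence $(X_k,\dots,X_n)$ and $k\le i<n$, left $i$-mutation $\varphi_i$ (resp. right $i$-mutation $\psi_i$) replaces the pair $(X_i,X_{i+1})$ by $\varphi^{\mathcal{V}}(X_i,X_{i+1})$ (resp. $\psi^{\mathcal{V}}(X_i,X_{i+1})$), where $\mathcal{V}=\mathsf{J}(X_{i+2},\dots,X_n)$ ($\mathcal{V}=\mathsf{mod}\,\Lambda$ if $i=n-1$), and leaves the other entries unchanged. The result is again a $\tau$-exceptional sequence with the same $\mathsf{J}$, and $\psi_i=\varphi_i^{-1}$. *)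

(* Defs.v *)
From HB Require Import structures.
From mathcomp Require Import all_boot all_algebra all_field.
From Stdlib Require Import Relation_Operators.

Set Implicit Arguments.
Unset Strict Implicit.
Unset Printing Implicit Defensive.

Import GRing.Theory.
Local Open Scope ring_scope.

Record fdmod (K : fieldType) (A : falgType K) : Type := FdMod {
  msort :> vectType K;
  mact : {linear A -> 'End(msort)};
  mact1 : mact 1 = \1%VF;
  mactM : forall a b, mact (a * b) = (mact a \o mact b)%VF }.

Section Modules.
Context {K : fieldType} {A : falgType K}.
Implicit Types M N P Q S T X Y Z : fdmod A.

Definition intertwine M N (a : A) (f : 'Hom(M, N)) : 'Hom(M, N) :=
  (f \o mact M a)%VF - (mact N a \o f)%VF.

Fact intertwine_is_linear M N a : linear (@intertwine M N a).
Proof.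
move=> k f g; rewrite /intertwine comp_lfunDl comp_lfunDr -comp_lfunZl.
by rewrite -comp_lfunZr scalerBr opprD addrACA.
Qed.

HB.instance Definition _ M N a :=
  GRing.isLinear.Build K 'Hom(M, N) 'Hom(M, N) _ (@intertwine M N a)
    (@intertwine_is_linear M N a).

(* The K-space Hom_A(M, N); it is enough to test A-linearity on a basis of A,
   see homvP. *)
Definition homv M N : {vspace 'Hom(M, N)} :=
  (\bigcap_(i < \dim {:A}) lker (linfun (@intertwine M N (vbasis {:A})`_i)))%VS.

Lemma homvP M N (f : 'Hom(M, N)) :
  reflect (forall a, f \o mact M a = mact N a \o f)%VF (f \in homv M N).
Proof.
have E a : (f \in lker (linfun (@intertwine M N a)))
         = ((f \o mact M a)%VF == (mact N a \o f)%VF).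
  by rewrite memv_ker lfunE /= /intertwine subr_eq0.
apply: (iffP idP) => [|h]; last first.
  rewrite /homv memvE; apply/subv_bigcapP => i _.
  by rewrite -memvE E h.
rewrite /homv memvE => /subv_bigcapP h a.
have Hb i : (i < \dim {:A})%N -> (f \o mact M (vbasis {:A})`_i
                          = mact N (vbasis {:A})`_i \o f)%VF.
  by move=> li; apply/eqP; rewrite -E memvE (h (Ordinal li)).
rewrite (coord_vbasis (memvf a)).
apply/lfunP => v; rewrite !comp_lfunE !linear_sum /= !sum_lfunE linear_sum /=.
apply: eq_bigr => i _; rewrite !linearZ /= !scale_lfunE linearZ /=.
by congr (_ *: _); rewrite -!comp_lfunE Hb.
Qed.

Definition mhom M N := subvs_of (homv M N).
HB.instance Definition _ M N := Vector.on (mhom M N).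

Definition mhom_val M N (f : mhom M N) : 'Hom(M, N) := vsval f.
Coercion mhom_val : mhom >-> hom.

Fact mid_subproof M : \1%VF \in homv M M.
Proof. by apply/homvP => a; rewrite comp_lfun1l comp_lfun1r. Qed.
Definition mid M : mhom M M := Subvs (mid_subproof M).

Fact mcomp_subproof M N P (g : mhom N P) (f : mhom M N) :
  (mhom_val g \o mhom_val f)%VF \in homv M P.
Proof.
apply/homvP => a; have /homvP/(_ a) Hg := valP g; have /homvP/(_ a) Hf := valP f.
by rewrite -comp_lfunA /mhom_val Hf !comp_lfunA Hg.
Qed.
Definition mcomp M N P (g : mhom N P) (f : mhom M N) : mhom M P :=
  Subvs (mcomp_subproof g f).

Definition injm M N (f : mhom M N) := lker f = 0%VS.
Definition surjm M N (f : mhom M N) := limg f = fullv.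
Definition misom M N := exists f : mhom M N, injm f /\ surjm f.
Definition is_zero M := ({: M} = 0)%VS.
Definition hom0 M N := forall f : mhom M N, f = 0.

Definition short_exact X Y Z (i : mhom X Y) (q : mhom Y Z) :=
  [/\ injm i, limg i = lker q & surjm q].

Definition mod0_act : {linear A -> 'End('rV[K]_0)} := \0%R.
Fact mod0_act1 : mod0_act 1 = \1%VF.
Proof. by apply/lfunP => v; apply/rowP; case. Qed.
Fact mod0_actM a b : mod0_act (a * b) = (mod0_act a \o mod0_act b)%VF.
Proof. by apply/lfunP => v; apply/rowP; case. Qed.
Definition mod0 : fdmod A := FdMod mod0_act1 mod0_actM.

Section DirectSum.
Variables M N : fdmod A.

Definition dsum_fun (a : A) (z : (M * N)%type) : (M * N)%type :=
  (mact M a z.1, mact N a z.2).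
Fact dsum_fun_is_linear a : linear (dsum_fun a).
Proof. by move=> k [x y] [x' y']; rewrite /dsum_fun /= !linearP. Qed.
HB.instance Definition _ a :=
  GRing.isLinear.Build K (M * N)%type (M * N)%type _ (dsum_fun a)
    (dsum_fun_is_linear a).

Definition dsum_act (a : A) : 'End((M * N)%type) := linfun (dsum_fun a).
Fact dsum_act_is_linear : linear dsum_act.
Proof.
move=> k a b; apply/lfunP => z; rewrite add_lfunE scale_lfunE !lfunE /=.
by rewrite /dsum_fun !linearP /= !add_lfunE !scale_lfunE.
Qed.
HB.instance Definition _ :=
  GRing.isLinear.Build K A 'End((M * N)%type) _ dsum_act dsum_act_is_linear.

Fact dsum_act1 : dsum_act 1 = \1%VF.
Proof. by apply/lfunP => -[x y]; rewrite !lfunE /= /dsum_fun !mact1 !lfunE. Qed.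
Fact dsum_actM a b : dsum_act (a * b) = (dsum_act a \o dsum_act b)%VF.
Proof.
apply/lfunP => -[x y]; rewrite comp_lfunE !lfunE /= /dsum_fun /=.
by rewrite !mactM !comp_lfunE.
Qed.
Definition dsum : fdmod A := FdMod dsum_act1 dsum_actM.
End DirectSum.

Fact regular_actM (a b : A) : amull (a * b) = (amull a \o amull b)%VF.
Proof. by apply/lfunP => x; rewrite comp_lfunE !lfunE /= mulrA. Qed.
Definition regular : fdmod A := FdMod (amull1 A) regular_actM.

Definition summand X M := exists Y, misom M (dsum X Y).

Definition indecomposable M :=
  ~ is_zero M /\ forall X Y, misom M (dsum X Y) -> is_zero X \/ is_zero Y.

Definition basic M := exists (m : nat) (L : 'I_m -> fdmod A),
  [/\ forall i, indecomposable (L i),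
      forall i j, misom (L i) (L j) -> i = j
    & misom M (\big[dsum/mod0]_(i < m) L i)].

Definition in_add M X := exists m : nat, summand X (\big[dsum/mod0]_(i < m) M).
Definition in_Gen M X := exists Y, in_add M Y /\ exists q : mhom Y X, surjm q.

(* Yoneda Ext^1(Q, X) = 0. *)
Definition ext1_zero Q X :=
  forall E (i : mhom X E) (q : mhom E Q), short_exact i q ->
    exists s : mhom Q E, mcomp q s = mid Q.

Definition subcat := fdmod A -> Prop.
Implicit Types V W : subcat.

Definition modA : subcat := fun=> True.
Definition same_subcat V W := forall X, V X <-> W X.

Record wide V : Prop := Wide {
  wide_iso : forall X Y, misom X Y -> V X -> V Y;
  wide_zero : V mod0;
  wide_ker : forall X Y Z (f : mhom X Y) (i : mhom Z X),
    V X -> V Y -> injm i -> limg i = lker f -> V Z;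
  wide_coker : forall X Y Z (f : mhom X Y) (q : mhom Y Z),
    V X -> V Y -> surjm q -> lker q = limg f -> V Z;
  wide_ext : forall X Y Z (i : mhom X Y) (q : mhom Y Z),
    V X -> V Z -> short_exact i q -> V Y }.

(* From here on, a notion with parameter V is the one of the abelian category V,
   for a wide subcategory V; monomorphisms and epimorphisms in V are its
   injective and surjective morphisms. *)

Definition simple_in V S :=
  [/\ V S, ~ is_zero S &
      forall X (f : mhom X S), V X -> injm f -> is_zero X \/ surjm f].

Definition has_rank V (r : nat) := exists L : 'I_r -> fdmod A,
  [/\ forall i, simple_in V (L i),
      forall i j, misom (L i) (L j) -> i = j
    & forall S, simple_in V S -> exists i, misom S (L i)].

Definition projective_in V P := V P /\
  forall X Y (g : mhom X Y) (f : mhom P Y), V X -> V Y -> surjm g ->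
    exists h : mhom P X, mcomp g h = f.

Definition progenerator V G :=
  projective_in V G /\ forall X, V X -> in_Gen G X.

(* The epimorphism from X onto the image of f is essential in V. *)
Definition essential_in V X Y (f : mhom X Y) :=
  forall Z (g : mhom Z X), V Z -> limg (mcomp f g) = limg f -> surjm g.

Definition min_presentation V P1 P0 M (d : mhom P1 P0) (p : mhom P0 M) :=
  [/\ projective_in V P1, projective_in V P0, surjm p & limg d = lker p]
  /\ essential_in V p /\ essential_in V d.

Definition dual (U : vectType K) := 'Hom(U, K^o).

(* N is the Auslander-Reiten translate D Tr of M computed in V.  Let P1 -> P0
   -> M -> 0 be a minimal projective presentation in V and G a progenerator of
   V, so that Hom(G, -) is an equivalence from V to the right modules over
   End(G) and Tr M is the cokernel of Hom(P0, G) -> Hom(P1, G).  The map theta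
   is an isomorphism from Hom(G, N) to D Tr M, seen as the annihilator in
   D Hom(P1, G) of the image of Hom(P0, G), and is End(G)-linear.
   For V = mod A one can take G = A. *)
Definition is_tau V M N := V N /\
  exists P1 P0 G (d : mhom P1 P0) (p : mhom P0 M)
         (theta : 'Hom(mhom G N, dual (mhom P1 G))),
  [/\ min_presentation V d p, progenerator V G, lker theta = 0%VS,
      forall xi : dual (mhom P1 G),
        (exists g, theta g = xi) <-> (forall v : mhom P0 G, xi (mcomp v d) = 0)
    & forall (g : mhom G N) (e : mhom G G) (u : mhom P1 G),
        theta (mcomp g e) u = theta g (mcomp e u)].

Definition tau_rigid V M := V M /\ exists N, is_tau V M N /\ hom0 M N.

Definition perp_tau V M : subcat :=
  fun X => V X /\ exists N, is_tau V M N /\ hom0 X N.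

Definition support_tau_rigid V M P :=
  [/\ tau_rigid V M, projective_in V P & hom0 P M].

Definition Jpair V M P : subcat :=
  fun X => [/\ perp_tau V M X, hom0 M X & hom0 P X].
Definition J V M : subcat := Jpair V M mod0.

Definition Gen_in V M : subcat := fun X => V X /\ in_Gen M X.

(* P(T); for T inside a wide subcategory V, extensions of objects of V lie in V,
   so that Ext^1 in V is Ext^1 in mod A. *)
Definition ext_projective (T : subcat) Q :=
  T Q /\ forall X, T X -> ext1_zero Q X.

(* Y is f_M X, the quotient of X by its largest subobject in Gen_V M. *)
Definition is_torsionfree_part V M X Y :=
  exists T (i : mhom T X) (q : mhom X Y),
  [/\ short_exact i q, Gen_in V M T &
      forall T' (i' : mhom T' X), injm i' -> Gen_in V M T' ->
        (limg i' <= limg i)%VS].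

Definition tau_tilting_finite V := exists (m : nat) (L : 'I_m -> fdmod A),
  forall M, basic M -> tau_rigid V M -> exists i, misom M (L i).

Fixpoint Jseq V (s : seq (fdmod A)) : subcat :=
  if s is X :: s' then J (Jseq V s') X else V.

Inductive tau_exceptional : subcat -> seq (fdmod A) -> Prop :=
| TauExcNil V : tau_exceptional V [::]
| TauExcRcons V s X : indecomposable X -> tau_rigid V X ->
    tau_exceptional (J V X) s -> tau_exceptional V (rcons s X).

Definition tau_es W (s : seq (fdmod A)) :=
  tau_exceptional modA s /\ same_subcat (Jseq modA s) W.

(* Mod M is the object M and Shift P the object P[1]. *)
Inductive obj := Mod of fdmod A | Shift of fdmod A.

Definition unshift (X : obj) := match X with Mod N => N | Shift N => N end.

(* The direct sum of M and X, as a pair. *)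
Definition add_obj M (X : obj) : fdmod A * fdmod A :=
  match X with Mod N => (dsum M N, mod0) | Shift P => (M, P) end.

Definition E_domain V M (X : obj) :=
  [/\ tau_rigid V M, indecomposable (unshift X),
      support_tau_rigid V (add_obj M X).1 (add_obj M X).2
    & if X is Mod N then ~ summand N M else True].

(* The graph of the bijection E_M, in V. *)
Definition is_E V M (X Y : obj) := E_domain V M X /\
  match Y with
  | Mod Y' => exists2 N, X = Mod N & ~ in_Gen M N /\ is_torsionfree_part V M N Y'
  | Shift Q =>
      [/\ if X is Mod N then in_Gen M N else True,
          indecomposable Q, projective_in (J V M) Q
        & same_subcat (fun Z => J V M Z /\ hom0 Q Z)
                      (Jpair V (add_obj M X).1 (add_obj M X).2)]
  end.

(* X is E_C^-1(B) for a module B; as E_M sends only modules to modules, this is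
   a module. *)
Definition is_Einv V C B X := is_E V C (Mod X) (Mod B).

Definition left_regular V B C := projective_in V C \/
  exists X, is_Einv V C B X /\ ~ ext_projective (perp_tau V X) C.

Definition right_regular V X Y := exists Z, is_Einv V Y X Z /\
  (ext_projective (perp_tau V Y) Z \/ ~ in_Gen Z Y).

(* C' is C_+ and B' is B_{C^}. *)
Definition mutation_data V B C (C' : obj) B' :=
  (projective_in V C /\ C' = Shift C /\ B' = B) \/
  (~ projective_in V C /\ C' = Mod C /\ is_Einv V C B B').

(* The graph of left mutation phi, up to isomorphism: (X, Y) is phi (B, C). *)
Definition left_mutation V B C X Y :=
  [/\ tau_exceptional V [:: B; C], tau_exceptional V [:: X; Y] &
      (left_regular V B C /\
        exists (C' : obj) B' (Z : obj), [/\ mutation_data V B C C' B', is_E V B' C' Z,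
                            misom X (unshift Z) & misom Y B'])
      \/
      [/\ ~ left_regular V B C, ~ right_regular V X Y
        & same_subcat (Jseq V [:: X; Y]) (Jseq V [:: B; C])]].

Inductive seq_isom : seq (fdmod A) -> seq (fdmod A) -> Prop :=
| SeqIsomNil : seq_isom [::] [::]
| SeqIsomCons X Y s t :
    misom X Y -> seq_isom s t -> seq_isom (X :: s) (Y :: t).

(* The graph of phi_i on tau-exceptional sequences (X_k, ..., X_n), up to
   isomorphism.  Here s = (X_k, ..., X_{i-1}, B, C, X_{i+2}, ..., X_n), and the
   size of s2 = (X_{i+2}, ..., X_n) determines the position. *)
Definition left_mut (n i : nat) (s t : seq (fdmod A)) :=
  exists s1 B C s2 t1 X Y t2,
  [/\ s = s1 ++ [:: B, C & s2], t = t1 ++ [:: X, Y & t2],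
      size s2 = (n - i.+1)%N
    & [/\ seq_isom s1 t1, seq_isom s2 t2
        & left_mutation (Jseq modA s2) B C X Y]].

(* psi_i, the inverse of phi_i. *)
Definition right_mut (n i : nat) (s t : seq (fdmod A)) := left_mut n i t s.

Definition mut_step (n r : nat) (s t : seq (fdmod A)) :=
  seq_isom s t \/
  exists i, (r < i < n)%N /\ (left_mut n i s t \/ right_mut n i s t).

(* The orbit relation of phi_{r+1}, psi_{r+1}, ..., phi_{n-1}, psi_{n-1} on
   sequences considered up to isomorphism. *)
Definition same_orbit (n r : nat) :=
  clos_refl_trans (seq (fdmod A)) (mut_step n r).

End Modules.

Arguments modA {K A} X.
Definition basic_algebra (K : fieldType) (A : falgType K) := basic (@regular K A).

(* Main.v *)
(* Irregular mutations are not needed.  By induction on the rank it is enough to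
   relate the possible last terms of a sequence realising W inside V, that is, the
   indecomposable tau-rigid objects X of V with W contained in J(X).  If C and X
   are compatible, or if P[1] and X are, then one left mutation relates C (or P)
   to X, unless both objects are projective.

   The g-vector of X defines a weight theta_X on dimension vectors, and W consists
   of theta_X-semistable objects.  As V is tau-tilting finite, every weight lies in
   the cone of a support tau-rigid object, and if the weight is a nonnegative
   combination of theta_X and theta_Y, then the summands of this object are again
   possible last terms.  Cones of two such weights are mutually compatible unless
   the weights take strictly opposite signs at some quotient of an indecomposable
   tau-rigid object; only finitely many pairs of values occur there, so that
   subdividing the segment from theta_X to theta_Y leads to a chain of compatible
   objects.  Two projectives P and P' are related by the segment from [P] to -[P'],
   and if theta_X and theta_Y are opposite, both X and Y are related to a projective
   orthogonal to W. *)

From HB Require Import structures.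
Require Import Defs.
From mathcomp Require Import all_boot all_order all_algebra all_field ring zify.
From Stdlib Require Import Relation_Operators Classical ClassicalEpsilon.
From Stdlib Require Import FunctionalExtensionality PropExtensionality.

Set Implicit Arguments.
Unset Strict Implicit.
Unset Printing Implicit Defensive.

Import Order.TTheory GRing.Theory Num.Theory.
Local Open Scope ring_scope.

(** The translate is traded for Ext: [tor V M] asks Ext^1(M, -) to vanish on quotients, so that
    later arguments only use exact sequences and minimal presentations, and [tau_tor] alone compares
    this with [is_tau]. As every category met is mod A or an iterated J, lemmas are stated for a
    wide [V] with a progenerator ([abcat]), a property that passes to J(M). Two points shape the
    induction. It is applied to J(C) and J(X), and joining the results takes a sequence realising W
    inside the intersection of J(C) and J(X); a sequence of [V] with another last term does not
    supply one, whence [Jseq_relative]. And a left mutation can only be exhibited once the value of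
    E_X at C or P[1] is known to exist. When it is shifted, the projective Q is found numerically:
    weights vanishing on J(X) are multiples of theta_X, which leaves a single simple object of J(X)
    outside the smaller category, and Q is its projective cover. The field is arbitrary, so an
    additive function on a category is a weight of it only up to a factor, supplied by
    [additive_scale]. *)

Notation "g \m f" := (mcomp g f) (at level 40, left associativity).

Arguments mhom_val : simpl never.
Arguments mcomp : simpl never.
Arguments mid : simpl never.

(** * Homomorphisms, subquotients and dimensions of modules *)

Section ModuleMaps.
Context {K : fieldType} {A : falgType K}.
Implicit Types M N P Q S T X Y Z : fdmod A.

Lemma mhom_eq M N (f g : mhom M N) : (forall v, f v = g v) -> f = g.
Proof. by move=> h; apply/val_inj/lfunP => v; apply: h. Qed.

Lemma mhom_act M N (f : mhom M N) a v : f (mact M a v) = mact N a (f v).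
Proof.
have /homvP/(_ a)/lfunP/(_ v) := valP f.
by rewrite !comp_lfunE.
Qed.

Fact mkhom_subproof M N (f : 'Hom(M, N)) :
  (forall a v, f (mact M a v) = mact N a (f v)) -> f \in homv M N.
Proof. by move=> h; apply/homvP => a; apply/lfunP => v; rewrite !comp_lfunE. Qed.

Definition mkhom M N (f : 'Hom(M, N)) h : mhom M N := Subvs (@mkhom_subproof M N f h).

Lemma mcompE M N P (g : mhom N P) (f : mhom M N) v : (g \m f) v = g (f v).
Proof. exact: comp_lfunE. Qed.

Lemma midE M (v : M) : mid M v = v.
Proof. exact: id_lfunE. Qed.

Lemma mhom0E M N (v : M) : (0 : mhom M N) v = 0.
Proof. exact: zero_lfunE. Qed.

Lemma mhomDE M N (f g : mhom M N) v : (f + g : mhom M N) v = f v + g v.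
Proof. exact: add_lfunE. Qed.

Lemma mhomNE M N (f : mhom M N) v : (- f : mhom M N) v = - f v.
Proof. exact: opp_lfunE. Qed.

Lemma mhomBE M N (f g : mhom M N) v : (f - g : mhom M N) v = f v - g v.
Proof. by rewrite mhomDE mhomNE. Qed.

Lemma mhomZE M N (k : K) (f : mhom M N) v : (k *: f : mhom M N) v = k *: f v.
Proof. exact: scale_lfunE. Qed.

Lemma mhom_sumE M N I (r : seq I) (P : pred I) (f : I -> mhom M N) v :
  (\sum_(i <- r | P i) f i : mhom M N) v = \sum_(i <- r | P i) f i v.
Proof.
elim/big_rec2: _ => [|i x y _ <-]; first exact: mhom0E.
exact: mhomDE.
Qed.

Lemma mh0 M N (f : mhom M N) : f 0 = 0. Proof. exact: linear0. Qed.
Lemma mhD M N (f : mhom M N) u v : f (u + v) = f u + f v. Proof. exact: linearD. Qed.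
Lemma mhB M N (f : mhom M N) u v : f (u - v) = f u - f v. Proof. exact: linearB. Qed.
Lemma mhN M N (f : mhom M N) v : f (- v) = - f v. Proof. exact: linearN. Qed.
Lemma mhZ M N (f : mhom M N) k v : f (k *: v) = k *: f v. Proof. exact: linearZ. Qed.
Lemma mhS M N (f : mhom M N) I (r : seq I) (P : pred I) (v : I -> M) :
  f (\sum_(i <- r | P i) v i) = \sum_(i <- r | P i) f (v i).
Proof. exact: linear_sum. Qed.

Definition mhE := (mcompE, midE, mhom0E, mhomDE, mhomNE, mhomZE, mhom_sumE).

Lemma mcompA M N P Q (h : mhom P Q) (g : mhom N P) (f : mhom M N) :
  h \m (g \m f) = h \m g \m f.
Proof. by apply: mhom_eq => v; rewrite !mhE. Qed.

Lemma mcomp1l M N (f : mhom M N) : mid N \m f = f.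
Proof. by apply: mhom_eq => v; rewrite !mhE. Qed.

Lemma mcomp1r M N (f : mhom M N) : f \m mid M = f.
Proof. by apply: mhom_eq => v; rewrite !mhE. Qed.

Lemma mcomp0l M N P (f : mhom M N) : (0 : mhom N P) \m f = 0.
Proof. by apply: mhom_eq => v; rewrite !mhE. Qed.

Lemma mcomp0r M N P (f : mhom N P) : f \m (0 : mhom M N) = 0.
Proof. by apply: mhom_eq => v; rewrite !mhE mh0. Qed.

Lemma mcomp_linr M N P (g : mhom N P) : linear (mcomp g : mhom M N -> mhom M P).
Proof. by move=> k f f'; apply: mhom_eq => v; rewrite !mhE linearP. Qed.

HB.instance Definition _ M N P g :=
  GRing.isLinear.Build K (mhom M N) (mhom M P) _ (mcomp g) (@mcomp_linr M N P g).

Definition mcompr M N P (f : mhom M N) (g : mhom N P) := g \m f.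

Lemma mcomp_linl M N P (f : mhom M N) : linear (mcompr f : mhom N P -> mhom M P).
Proof. by move=> k g g'; apply: mhom_eq => v; rewrite /mcompr !mhE. Qed.

HB.instance Definition _ M N P f :=
  GRing.isLinear.Build K (mhom N P) (mhom M P) _ (mcompr f) (@mcomp_linl M N P f).

Lemma mcompDl M N P (f : mhom M N) (g g' : mhom N P) : (g + g') \m f = g \m f + g' \m f.
Proof. exact: (linearD (mcompr f)). Qed.

Lemma mcompDr M N P (f f' : mhom M N) (g : mhom N P) : g \m (f + f') = g \m f + g \m f'.
Proof. exact: (linearD (mcomp g)). Qed.

Lemma mcompNl M N P (f : mhom M N) (g : mhom N P) : (- g) \m f = - (g \m f).
Proof. exact: (linearN (mcompr f)). Qed.

Lemma mcompNr M N P (f : mhom M N) (g : mhom N P) : g \m (- f) = - (g \m f).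
Proof. exact: (linearN (mcomp g)). Qed.

Lemma mcompBl M N P (f : mhom M N) (g g' : mhom N P) : (g - g') \m f = g \m f - g' \m f.
Proof. exact: (linearB (mcompr f)). Qed.

Lemma mcompBr M N P (f f' : mhom M N) (g : mhom N P) : g \m (f - f') = g \m f - g \m f'.
Proof. exact: (linearB (mcomp g)). Qed.

Lemma mcompZl M N P k (f : mhom M N) (g : mhom N P) : (k *: g) \m f = k *: (g \m f).
Proof. by apply: mhom_eq => v; rewrite !mhE. Qed.

Lemma mcompZr M N P k (f : mhom M N) (g : mhom N P) : g \m (k *: f) = k *: (g \m f).
Proof. by apply: mhom_eq => v; rewrite !mhE mhZ. Qed.

Lemma mcomp_suml M N P I (r : seq I) (Pr : pred I) (f : mhom M N) (g : I -> mhom N P) :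
  (\sum_(i <- r | Pr i) g i) \m f = \sum_(i <- r | Pr i) (g i \m f).
Proof. exact: (linear_sum (mcompr f)). Qed.

Lemma mcomp_sumr M N P I (r : seq I) (Pr : pred I) (f : I -> mhom M N) (g : mhom N P) :
  g \m (\sum_(i <- r | Pr i) f i) = \sum_(i <- r | Pr i) (g \m f i).
Proof. exact: (linear_sum (mcomp g)). Qed.

Lemma injmP M N (f : mhom M N) : injm f <-> (forall v, f v = 0 -> v = 0).
Proof.
split=> [h v fv0|h].
  have : v \in lker f by rewrite memv_ker fv0 eqxx.
  by rewrite (h : lker f = _) memv0 => /eqP.
apply/eqP; rewrite -subv0; apply/subvP => v.
by rewrite memv_ker memv0 => /eqP/h ->.
Qed.

Lemma injm_inj M N (f : mhom M N) : injm f -> injective f.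
Proof. by move/eqP/lker0P. Qed.

Lemma surjmP M N (f : mhom M N) : surjm f <-> (forall w, exists v, f v = w).
Proof.
split=> [h w|h].
  have : w \in limg f by rewrite (h : limg f = _) memvf.
  by case/memv_imgP => v _ ->; exists v.
apply/eqP; rewrite eqEsubv subvf /=; apply/subvP => w _.
by have [v <-] := h w; rewrite memv_img ?memvf.
Qed.

Lemma memv_limgP M N (f : mhom M N) w : reflect (exists v, f v = w) (w \in limg f).
Proof.
apply: (iffP memv_imgP) => [[v _ ->]|[v <-]]; first by exists v.
by exists v; rewrite ?memvf.
Qed.

Lemma limg_kerP M N P (f : mhom M N) (g : mhom N P) :
  limg f = lker g <-> (forall w, g w = 0 <-> exists v, f v = w).
Proof.
split=> [h w|h].
  split=> [gw|[v <-]].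
    by apply/memv_limgP; rewrite h memv_ker gw.
  apply/eqP; rewrite -memv_ker -h; apply/memv_limgP; by exists v.
apply/vspaceP => w; rewrite memv_ker; apply/memv_limgP/eqP => [|]; by apply h.
Qed.

Lemma sexP X Y Z (i : mhom X Y) (q : mhom Y Z) :
  short_exact i q <->
  [/\ forall v, i v = 0 -> v = 0, forall w, q w = 0 <-> exists v, i v = w
     & forall z, exists y, q y = z].
Proof.
split=> -[/injmP ? /limg_kerP ? /surjmP ?]; by split.
Qed.

Lemma factor_inj X Y Z (i : mhom Z Y) (f : mhom X Y) : injm i ->
  (forall x, exists z, i z = f x) -> exists g : mhom X Z, i \m g = f.
Proof.
move=> ii h.
have k v : f v \in limg i by apply/memv_limgP; apply: h.
pose g0 := ((i : 'Hom(_, _))^-1 \o f)%VF.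
have E v : i (g0 v) = f v by rewrite comp_lfunE limg_lfunVK.
have H a v : g0 (mact X a v) = mact Z a (g0 v).
  by apply: (injm_inj ii); rewrite E !mhom_act E.
by exists (mkhom H); apply: mhom_eq => v; rewrite mcompE E.
Qed.

Lemma factor_surj X Y Z (q : mhom X Z) (f : mhom X Y) : surjm q ->
  (forall x, q x = 0 -> f x = 0) -> exists g : mhom Z Y, g \m q = f.
Proof.
move=> qs h.
pose g0 := (f \o (q : 'Hom(_, _))^-1)%VF.
have E v : g0 (q v) = f v.
  apply/eqP; rewrite comp_lfunE -subr_eq0 -linearB /=; apply/eqP/h.
  rewrite linearB /= limg_lfunVK ?subrr //; apply/memv_limgP; by exists v.
have H a v : g0 (mact Z a v) = mact Y a (g0 v).
  have [w <-] := (surjmP q).1 qs v.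
  by rewrite -mhom_act !E mhom_act.
by exists (mkhom H); apply: mhom_eq => v; rewrite mcompE E.
Qed.

Lemma surj_epi X Y Z (q : mhom X Z) (f g : mhom Z Y) : surjm q -> f \m q = g \m q -> f = g.
Proof.
move=> /surjmP qs e; apply: mhom_eq => v; have [w <-] := qs v.
by rewrite -!mcompE e.
Qed.

Lemma inj_mono X Y Z (i : mhom Z Y) (f g : mhom X Z) : injm i -> i \m f = i \m g -> f = g.
Proof.
move=> /injm_inj ii e; apply: mhom_eq => v; apply: ii.
by rewrite -!mcompE e.
Qed.

Section Sub.
Variables (M : fdmod A) (U : {vspace M}).
Hypothesis Ust : forall a v, v \in U -> mact M a v \in U.

Definition sub_fun (a : A) (v : subvs_of U) : subvs_of U := vsproj U (mact M a (vsval v)).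
Fact sub_fun_lin a : linear (sub_fun a).
Proof. by move=> k u v; rewrite /sub_fun !linearP. Qed.
HB.instance Definition _ a :=
  GRing.isLinear.Build K (subvs_of U) (subvs_of U) _ (sub_fun a) (sub_fun_lin a).
Definition sub_act a : 'End(subvs_of U) := linfun (sub_fun a).
Fact sub_act_lin : linear sub_act.
Proof.
move=> k a b; apply/lfunP => v; rewrite add_lfunE scale_lfunE !lfunE /= /sub_fun.
by rewrite !linearP /= !add_lfunE !scale_lfunE linearP.
Qed.
HB.instance Definition _ := GRing.isLinear.Build K A 'End(subvs_of U) _ sub_act sub_act_lin.
Fact sub_act1 : sub_act 1 = \1%VF.
Proof. by apply/lfunP => v; rewrite !lfunE /= /sub_fun mact1 lfunE /= vsvalK. Qed.
Fact sub_actM a b : sub_act (a * b) = (sub_act a \o sub_act b)%VF.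
Proof.
apply/lfunP => v; rewrite comp_lfunE !lfunE /= /sub_fun.
by rewrite vsprojK ?mactM ?comp_lfunE // Ust // subvsP.
Qed.
Definition submod : fdmod A := FdMod sub_act1 sub_actM.

Fact sub_incl_subproof a (v : submod) :
  linfun (vsval : subvs_of U -> M) (mact submod a v) = mact M a (linfun (vsval : subvs_of U -> M) v).
Proof. by rewrite !lfunE /= /sub_fun vsprojK // Ust // subvsP. Qed.
Definition sub_incl : mhom submod M := @mkhom submod M (linfun (vsval : subvs_of U -> M)) sub_incl_subproof.
Lemma sub_inclE (v : submod) : sub_incl v = vsval v.
Proof. exact: lfunE. Qed.
End Sub.

Lemma submod_exists M (U : {vspace M}) :
  (forall a v, v \in U -> mact M a v \in U) ->
  exists (S : fdmod A) (i : mhom S M), injm i /\ (forall v, v \in U <-> exists s, i s = v).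
Proof.
move=> h; exists (submod h), (sub_incl h); split.
  by apply/injmP => v; rewrite sub_inclE => e; apply: subvs_inj.
move=> v; split=> [vU|[s <-]]; last by rewrite sub_inclE subvsP.
by exists (vsproj U v); rewrite sub_inclE vsprojK.
Qed.

Section Quo.
Variables (M : fdmod A) (T : vectType K) (f : 'Hom(M, T)).
Hypothesis fst : forall a v, f v = 0 -> f (mact M a v) = 0.

(** [f] is only [K]-linear, with a kernel stable under the action: the quotient by this kernel is
    carried by [limg f], and [f^-1] provides a linear section. *)
Definition quo_q (v : M) : subvs_of (limg f) := vsproj (limg f) (f v).
Fact quo_q_lin : linear quo_q.
Proof. by move=> k u v; rewrite /quo_q !linearP. Qed.
HB.instance Definition _ := GRing.isLinear.Build K M (subvs_of (limg f)) _ quo_q quo_q_lin.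
Definition quo_s (w : subvs_of (limg f)) : M := (f^-1)%VF (vsval w).
Fact quo_s_lin : linear quo_s.
Proof. by move=> k u v; rewrite /quo_s !linearP. Qed.
HB.instance Definition _ := GRing.isLinear.Build K (subvs_of (limg f)) M _ quo_s quo_s_lin.
Lemma quo_sK w : quo_q (quo_s w) = w.
Proof.
apply: subvs_inj; rewrite /quo_q vsprojK ?memv_img ?memvf //.
by rewrite /quo_s limg_lfunVK // subvsP.
Qed.
Lemma quo_q0 v : quo_q v = 0 <-> f v = 0.
Proof.
split=> [h|h]; last by rewrite /quo_q h linear0.
have := congr1 vsval h; rewrite /quo_q vsprojK ?memv_img ?memvf //.
Qed.
Lemma quo_qact a v w : quo_q v = quo_q w -> quo_q (mact M a v) = quo_q (mact M a w).
Proof.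
move=> e; apply/eqP; rewrite -subr_eq0 -!linearB; apply/eqP/quo_q0/fst/quo_q0.
by rewrite linearB /= e subrr.
Qed.

Definition quo_fun (a : A) (w : subvs_of (limg f)) := quo_q (mact M a (quo_s w)).
Fact quo_fun_lin a : linear (quo_fun a).
Proof. by move=> k u v; rewrite /quo_fun !linearP. Qed.
HB.instance Definition _ a :=
  GRing.isLinear.Build K (subvs_of (limg f)) (subvs_of (limg f)) _ (quo_fun a) (quo_fun_lin a).
Definition quo_act a : 'End(subvs_of (limg f)) := linfun (quo_fun a).
Fact quo_act_lin : linear quo_act.
Proof.
move=> k a b; apply/lfunP => v; rewrite add_lfunE scale_lfunE !lfunE /= /quo_fun.
by rewrite !linearP /= !add_lfunE !scale_lfunE linearP.
Qed.
HB.instance Definition _ := GRing.isLinear.Build K A 'End(subvs_of (limg f)) _ quo_act quo_act_lin.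
Fact quo_act1 : quo_act 1 = \1%VF.
Proof. by apply/lfunP => v; rewrite !lfunE /= /quo_fun mact1 lfunE /= quo_sK. Qed.
Fact quo_actM a b : quo_act (a * b) = (quo_act a \o quo_act b)%VF.
Proof.
apply/lfunP => v; rewrite comp_lfunE !lfunE /= /quo_fun mactM comp_lfunE.
by apply: quo_qact; rewrite quo_sK.
Qed.
Definition quomod : fdmod A := FdMod quo_act1 quo_actM.
Fact quo_proj_subproof a (v : M) :
  linfun quo_q (mact M a v) = mact quomod a (linfun quo_q v).
Proof. by rewrite !lfunE /= /quo_fun; apply: quo_qact; rewrite quo_sK. Qed.
Definition quo_proj : mhom M quomod := @mkhom M quomod (linfun quo_q) quo_proj_subproof.
Lemma quo_projE v : quo_proj v = quo_q v.
Proof. exact: lfunE. Qed.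
End Quo.

Lemma quomod_exists M (U : {vspace M}) :
  (forall a v, v \in U -> mact M a v \in U) ->
  exists (Q : fdmod A) (q : mhom M Q), surjm q /\ (forall v, q v = 0 <-> v \in U).
Proof.
move=> h; pose f := (\1 - projv U)%VF.
have fE v : f v = 0 <-> v \in U.
  rewrite add_lfunE opp_lfunE id_lfunE; split=> [/eqP|vU].
    by rewrite subr_eq0 => /eqP ->; rewrite memv_proj.
  by rewrite projv_id ?subrr.
have fst a v : f v = 0 -> f (mact M a v) = 0 by rewrite !fE; apply: h.
exists (quomod fst), (quo_proj fst); split.
  by apply/surjmP => w; exists (quo_s w); rewrite quo_projE quo_sK.
by move=> v; rewrite quo_projE quo_q0 fE.
Qed.

Lemma ker_exists M N (f : mhom M N) :
  exists (S : fdmod A) (i : mhom S M), injm i /\ (forall v, f v = 0 <-> exists s, i s = v).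
Proof.
have [a v|S [i [ii h]]] := @submod_exists M (lker f).
  by rewrite !memv_ker mhom_act => /eqP ->; rewrite linear0.
exists S, i; split=> // v; rewrite -h memv_ker; split=> [->//|/eqP//].
Qed.

Lemma coker_exists M N (f : mhom M N) :
  exists (S : fdmod A) (q : mhom N S), surjm q /\ (forall v, q v = 0 <-> exists s, f s = v).
Proof.
have [a v|S [i [ii h]]] := @quomod_exists N (limg f).
  by case/memv_limgP => w <-; rewrite -mhom_act; apply/memv_limgP; exists (mact M a w).
exists S, i; split=> // v; rewrite h; split=> [/memv_limgP//|?]; exact/memv_limgP.
Qed.

Lemma img_exists M N (f : mhom M N) :
  exists (S : fdmod A) (q : mhom M S) (i : mhom S N), [/\ surjm q, injm i & i \m q = f].
Proof.
have [a v|S [i [ii h]]] := @submod_exists N (limg f).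
  by case/memv_limgP => w <-; rewrite -mhom_act; apply/memv_limgP; exists (mact M a w).
have [x|q qE] := @factor_inj M N S i f ii.
  by apply/h/memv_limgP; exists x.
exists S, q, i; split=> //; apply/surjmP => s.
have /memv_limgP [v e] : i s \in limg f by apply/h; exists s.
by exists v; apply: (injm_inj ii); rewrite -mcompE qE.
Qed.

Lemma bijm_inv M N (f : mhom M N) : injm f -> surjm f ->
  exists g : mhom N M, g \m f = mid M /\ f \m g = mid N.
Proof.
move=> fi fs; have [x|g gE] := @factor_inj N N M f (mid N) fi.
  by have [v e] := (surjmP f).1 fs x; exists v; rewrite midE.
exists g; split=> //; apply: (inj_mono fi).
by rewrite mcompA gE mcomp1l mcomp1r.
Qed.

Lemma inv_bijm M N (f : mhom M N) (g : mhom N M) :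
  g \m f = mid M -> f \m g = mid N -> injm f /\ surjm f.
Proof.
move=> e1 e2; split.
  by apply/injmP => v h; rewrite -[v]midE -e1 mcompE h linear0.
by apply/surjmP => w; exists (g w); rewrite -mcompE e2 midE.
Qed.

Lemma retr_inj M N (f : mhom M N) (g : mhom N M) : g \m f = mid M -> injm f.
Proof. by move=> e; apply/injmP => v h; rewrite -[v]midE -e mcompE h linear0. Qed.

Lemma retr_surj M N (f : mhom M N) (g : mhom N M) : g \m f = mid M -> surjm g.
Proof. by move=> e; apply/surjmP => w; exists (f w); rewrite -mcompE e midE. Qed.

Lemma misomP M N : misom M N <->
  exists (f : mhom M N) (g : mhom N M), g \m f = mid M /\ f \m g = mid N.
Proof.
split=> [[f [fi fs]]|[f [g [e1 e2]]]].
  by have [g ?] := bijm_inv fi fs; exists f, g.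
by exists f; apply: inv_bijm e1 e2.
Qed.

Lemma misom_refl M : misom M M.
Proof. by apply/misomP; exists (mid M), (mid M); rewrite !mcomp1l. Qed.

Lemma misom_sym M N : misom M N -> misom N M.
Proof. by case/misomP => f [g [? ?]]; apply/misomP; exists g, f. Qed.

Lemma injm_comp M N P (g : mhom N P) (f : mhom M N) : injm g -> injm f -> injm (g \m f).
Proof.
by move=> /injmP gi /injmP fi; apply/injmP => v; rewrite mcompE => /gi/fi.
Qed.

Lemma surjm_comp M N P (g : mhom N P) (f : mhom M N) : surjm g -> surjm f -> surjm (g \m f).
Proof.
move=> /surjmP gi /surjmP fi; apply/surjmP => v.
by have [w <-] := gi v; have [u <-] := fi w; exists u; rewrite mcompE.
Qed.

Lemma surj_compl M N P (g : mhom N P) (f : mhom M N) : surjm (g \m f) -> surjm g.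
Proof.
move=> /surjmP h; apply/surjmP => w; have [v <-] := h w.
by exists (f v); rewrite mcompE.
Qed.

Lemma misom_trans M N P : misom M N -> misom N P -> misom M P.
Proof.
move=> [f [fi fs]] [g [gi gs]]; exists (g \m f).
by split; [apply: injm_comp | apply: surjm_comp].
Qed.

Lemma surj_mid M : surjm (mid M).
Proof. by apply/surjmP => w; exists w; rewrite midE. Qed.
Lemma is_zeroP M : is_zero M <-> (forall v : M, v = 0).
Proof.
split=> [h v|h].
  by have := memvf v; rewrite (h : fullv = _) memv0 => /eqP.
by apply/eqP; rewrite -subv0; apply/subvP => v _; rewrite memv0 (h v) eqxx.
Qed.

Lemma is_zero_mid M : is_zero M <-> mid M = 0.
Proof.
rewrite is_zeroP; split=> [h|h v]; first by apply: mhom_eq => v; rewrite !mhE (h v).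
by rewrite -[v]midE h mhom0E.
Qed.

Lemma mod0_zero : is_zero (mod0 : fdmod A).
Proof. by apply/is_zeroP => v; apply/rowP; case. Qed.

Lemma zero_misom M N : is_zero M -> is_zero N -> misom M N.
Proof.
move=> /is_zeroP M0 /is_zeroP N0; exists 0; split.
  by apply/injmP => v _; apply: M0.
by apply/surjmP => w; exists 0; rewrite (N0 w) linear0.
Qed.

Lemma misom_zero M N : misom M N -> is_zero M -> is_zero N.
Proof.
case=> f [_ /surjmP fs] /is_zeroP M0; apply/is_zeroP => w.
by have [v <-] := fs w; rewrite (M0 v) linear0.
Qed.

Definition dm M := \dim {:M}.
Definition hm M N := \dim {:mhom M N}.

Lemma dm0 M : is_zero M <-> dm M = 0%N.
Proof. by rewrite /is_zero /dm; split=> [->|/eqP]; rewrite ?dimv0 // dimv_eq0 => /eqP. Qed.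

Lemma hom0_dim M N : hom0 M N <-> hm M N = 0%N.
Proof.
rewrite /hm; split=> [h|/eqP].
  by apply/eqP; rewrite dimv_eq0 -subv0; apply/subvP => f _; rewrite (h f) mem0v.
rewrite dimv_eq0 => /eqP h f.
by have := memvf f; rewrite h memv0 => /eqP.
Qed.

Lemma sex_dim X Y Z (i : mhom X Y) (q : mhom Y Z) : short_exact i q -> dm Y = (dm X + dm Z)%N.
Proof.
case=> ii e qs; rewrite /dm -(limg_ker_dim q fullv) capfv -e (qs : limg q = _).
by congr (_ + _)%N; rewrite limg_dim_eq // capfv; apply: ii.
Qed.

Lemma misom_dim M N : misom M N -> dm M = dm N.
Proof.
case=> f [fi fs]; rewrite /dm -(limg_ker_dim f fullv) capfv.
by rewrite (fi : lker f = _) dimv0 (fs : limg f = _).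
Qed.

Lemma surj_dim M N (f : mhom M N) : surjm f -> (dm N <= dm M)%N.
Proof.
move=> fs; rewrite /dm -(limg_ker_dim f fullv) capfv (fs : limg f = _).
exact: leq_addl.
Qed.

Lemma surj_dim_inj M N (f : mhom M N) : surjm f -> (dm M <= dm N)%N -> injm f.
Proof.
move=> fs; rewrite {1}/dm -(limg_ker_dim f fullv) capfv (fs : limg f = _) /dm => le.
apply/eqP; rewrite -dimv_eq0.
by move: le; rewrite -{2}[\dim {:N}]add0n leq_add2r leqn0.
Qed.

Lemma inj_dim_surj M N (f : mhom M N) : injm f -> (dm N <= dm M)%N -> surjm f.
Proof.
move=> fi le; apply/eqP; rewrite eqEdim subvf /=.
by have := limg_ker_dim f fullv; rewrite capfv (fi : lker f = _) dimv0 add0n => ->.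
Qed.

Lemma inj_proper_dim M N (f : mhom M N) : injm f -> ~ surjm f -> (dm M < dm N)%N.
Proof. by move=> fi fs; rewrite ltnNge; apply/negP => /(inj_dim_surj fi). Qed.

Lemma sur2_isom M N (f : mhom M N) (g : mhom N M) : surjm f -> surjm g -> injm f.
Proof. by move=> fs gs; exact: surj_dim_inj fs (surj_dim gs). Qed.

Lemma surj_injm_hom0 X Y Z (q : mhom X Y) : surjm q -> hom0 X Z -> hom0 Y Z.
Proof.
by move=> qs h f; apply: (surj_epi qs); rewrite (h (f \m q)) mcomp0l.
Qed.

Lemma inj_hom0 X Y Z (i : mhom Y Z) : injm i -> hom0 X Z -> hom0 X Y.
Proof. by move=> ii h f; apply: (inj_mono ii); rewrite (h (i \m f)) mcomp0r. Qed.

Lemma hm_sex P X Y Z (i : mhom X Y) (q : mhom Y Z) : short_exact i q ->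
  (forall f : mhom P Z, exists g : mhom P Y, q \m g = f) -> hm P Y = (hm P X + hm P Z)%N.
Proof.
move=> [ii /limg_kerP e qs] h; pose F := linfun (mcomp q : mhom P Y -> mhom P Z).
pose G := linfun (mcomp i : mhom P X -> mhom P Y).
rewrite /hm -(limg_ker_dim F fullv) capfv; congr (_ + _)%N; last first.
  congr (\dim _); apply/eqP; rewrite eqEsubv subvf /=; apply/subvP => f _.
  by have [g <-] := h f; apply/memv_imgP; exists g; rewrite ?memvf ?lfunE.
have -> : lker F = limg G.
  apply/vspaceP => f; rewrite memv_ker lfunE /=; apply/eqP/memv_imgP.
    move=> e0; have [x|g <-] := @factor_inj P Y X i f ii.
      by apply/e; rewrite -mcompE e0 mhom0E.
    by exists g; rewrite ?memvf ?lfunE.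
  move=> [g _ ->]; rewrite lfunE /=; apply: mhom_eq => v; rewrite !mhE.
  by apply/e; exists ((g : mhom _ _) v).
rewrite limg_dim_eq // capfv; apply/eqP; rewrite -subv0; apply/subvP => f.
rewrite memv_ker lfunE memv0 /= => /eqP e0; apply/eqP/(inj_mono ii).
by rewrite mcomp0r e0.
Qed.

Lemma hm_bij X Y P Q (F : mhom X Y -> mhom P Q) : linear F ->
  (forall f, F f = 0 -> f = 0) -> (forall g, exists f, F f = g) -> hm X Y = hm P Q.
Proof.
move=> Fl Fi Fs.
pose Fb := GRing.isLinear.Build K (mhom X Y) (mhom P Q) _ F Fl.
pose FL : {linear mhom X Y -> mhom P Q} := HB.pack F Fb.
have FE f : linfun FL f = F f by rewrite lfunE.
have k0 : lker (linfun FL) = 0%VS.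
  apply/eqP; rewrite -subv0; apply/subvP => f; rewrite memv_ker FE memv0.
  by move=> /eqP/Fi ->.
rewrite /hm -(limg_ker_dim (linfun FL) fullv) capfv k0 dimv0 add0n.
congr (\dim _); apply/eqP; rewrite eqEsubv subvf /=; apply/subvP => g _.
by have [f <-] := Fs g; apply/memv_imgP; exists f; rewrite ?memvf ?FE.
Qed.

Lemma hm_isol X Y Z : misom X Y -> hm X Z = hm Y Z.
Proof.
case/misomP => f [g [e1 e2]]; apply: (@hm_bij _ _ _ _ (mcompr g)).
- exact: mcomp_linl.
- by move=> h e; rewrite -[h]mcomp1r -e1 mcompA (e : h \m g = 0) mcomp0l.
- by move=> h; exists (h \m f); rewrite /mcompr -mcompA e2 mcomp1r.
Qed.

Lemma hm_isor X Y Z : misom X Y -> hm Z X = hm Z Y.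
Proof.
case/misomP => f [g [e1 e2]]; apply: (@hm_bij _ _ _ _ (mcomp f)).
- exact: mcomp_linr.
- by move=> h e; rewrite -[h]mcomp1l -e1 -mcompA e mcomp0r.
- by move=> h; exists (g \m h); rewrite mcompA e2 mcomp1l.
Qed.

End ModuleMaps.

(** * Direct sums, generation and Krull-Schmidt theory *)

Section Sums.
Context {K : fieldType} {A : falgType K}.
Implicit Types M N P Q S T X Y Z : fdmod A.

Section Two.
Variables M N : fdmod A.
Definition dl_fun (v : M) : (M * N)%type := (v, 0).
Definition dr_fun (v : N) : (M * N)%type := (0, v).
Fact dl_lin : linear dl_fun.
Proof. by move=> k u v; rewrite /dl_fun; congr pair; rewrite /= scaler0 addr0. Qed.
Fact dr_lin : linear dr_fun.
Proof. by move=> k u v; rewrite /dr_fun; congr pair; rewrite /= scaler0 addr0. Qed.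
HB.instance Definition _ := GRing.isLinear.Build K M (M * N)%type _ dl_fun dl_lin.
HB.instance Definition _ := GRing.isLinear.Build K N (M * N)%type _ dr_fun dr_lin.
Definition pl_fun (v : (M * N)%type) : M := v.1.
Definition pr_fun (v : (M * N)%type) : N := v.2.
Fact pl_lin : linear pl_fun. Proof. by []. Qed.
Fact pr_lin : linear pr_fun. Proof. by []. Qed.
HB.instance Definition _ := GRing.isLinear.Build K (M * N)%type M _ pl_fun pl_lin.
HB.instance Definition _ := GRing.isLinear.Build K (M * N)%type N _ pr_fun pr_lin.

Fact dl_act a v : linfun dl_fun (mact M a v) = mact (dsum M N) a (linfun dl_fun v).
Proof. by rewrite !lfunE /= /dsum_fun /dl_fun /= linear0. Qed.
Fact dr_act a v : linfun dr_fun (mact N a v) = mact (dsum M N) a (linfun dr_fun v).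
Proof. by rewrite !lfunE /= /dsum_fun /dr_fun /= linear0. Qed.
Fact pl_act a (v : dsum M N) : linfun pl_fun (mact (dsum M N) a v) = mact M a (linfun pl_fun v).
Proof. by rewrite !lfunE. Qed.
Fact pr_act a (v : dsum M N) : linfun pr_fun (mact (dsum M N) a v) = mact N a (linfun pr_fun v).
Proof. by rewrite !lfunE. Qed.

Definition dl : mhom M (dsum M N) := @mkhom _ _ M (dsum M N) (linfun dl_fun) dl_act.
Definition dr : mhom N (dsum M N) := @mkhom _ _ N (dsum M N) (linfun dr_fun) dr_act.
Definition pl : mhom (dsum M N) M := @mkhom _ _ (dsum M N) M (linfun pl_fun) pl_act.
Definition pr : mhom (dsum M N) N := @mkhom _ _ (dsum M N) N (linfun pr_fun) pr_act.

Lemma dlE v : dl v = (v, 0) :> dsum M N. Proof. exact: lfunE. Qed.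
Lemma drE v : dr v = (0, v) :> dsum M N. Proof. exact: lfunE. Qed.
Lemma plE (v : dsum M N) : pl v = v.1. Proof. exact: lfunE. Qed.
Lemma prE (v : dsum M N) : pr v = v.2. Proof. exact: lfunE. Qed.

Lemma pldl : pl \m dl = mid M. Proof. by apply: mhom_eq => v; rewrite !mhE plE dlE. Qed.
Lemma prdr : pr \m dr = mid N. Proof. by apply: mhom_eq => v; rewrite !mhE prE drE. Qed.
Lemma prdl : pr \m dl = 0. Proof. by apply: mhom_eq => v; rewrite !mhE prE dlE. Qed.
Lemma pldr : pl \m dr = 0. Proof. by apply: mhom_eq => v; rewrite !mhE plE drE. Qed.
Lemma dsum_id : dl \m pl + dr \m pr = mid (dsum M N).
Proof.
apply: mhom_eq => -[v w]; rewrite !mhE dlE drE plE prE /=.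
by rewrite -[RHS]/(v, w); congr pair; rewrite /= ?addr0 ?add0r.
Qed.
End Two.

Definition copair M N Z (f : mhom M Z) (g : mhom N Z) : mhom (dsum M N) Z :=
  f \m pl M N + g \m pr M N.
Definition mpair M N Z (f : mhom Z M) (g : mhom Z N) : mhom Z (dsum M N) :=
  dl M N \m f + dr M N \m g.

Lemma copair_dl M N Z (f : mhom M Z) (g : mhom N Z) : copair f g \m dl M N = f.
Proof. by rewrite mcompDl -!mcompA pldl prdl mcomp1r mcomp0r addr0. Qed.
Lemma copair_dr M N Z (f : mhom M Z) (g : mhom N Z) : copair f g \m dr M N = g.
Proof. by rewrite mcompDl -!mcompA pldr prdr mcomp1r mcomp0r add0r. Qed.
Lemma copair_eta M N Z (h : mhom (dsum M N) Z) : h = copair (h \m dl M N) (h \m dr M N).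
Proof. by rewrite /copair -!mcompA -mcompDr dsum_id mcomp1r. Qed.
Lemma pl_mpair M N Z (f : mhom Z M) (g : mhom Z N) : pl M N \m mpair f g = f.
Proof. by rewrite mcompDr !mcompA pldl pldr mcomp1l mcomp0l addr0. Qed.
Lemma pr_mpair M N Z (f : mhom Z M) (g : mhom Z N) : pr M N \m mpair f g = g.
Proof. by rewrite mcompDr !mcompA prdl prdr mcomp1l mcomp0l add0r. Qed.
Lemma mpair_eta M N Z (h : mhom Z (dsum M N)) : h = mpair (pl M N \m h) (pr M N \m h).
Proof. by rewrite /mpair !mcompA -mcompDl dsum_id mcomp1l. Qed.
Lemma copair_mpair M N Z Y (f : mhom M Z) (g : mhom N Z) (h : mhom Y M) (k : mhom Y N) :
  copair f g \m mpair h k = f \m h + g \m k.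
Proof. by rewrite mcompDr !mcompA copair_dl copair_dr. Qed.
Lemma copair_comp M N Z Y (f : mhom M Z) (g : mhom N Z) (h : mhom Z Y) :
  h \m copair f g = copair (h \m f) (h \m g).
Proof. by rewrite /copair mcompDr !mcompA. Qed.
Lemma copairE M N Z (f : mhom M Z) (g : mhom N Z) v : copair f g v = f (pl M N v) + g (pr M N v).
Proof. by rewrite !mhE. Qed.
Lemma dsumE M N (v : dsum M N) : v = dl M N (pl M N v) + dr M N (pr M N v).
Proof. by rewrite -!mcompE -mhomDE dsum_id midE. Qed.

Lemma pl_dlE M N v : pl M N (dl M N v) = v. Proof. by rewrite -mcompE pldl midE. Qed.
Lemma pr_drE M N v : pr M N (dr M N v) = v. Proof. by rewrite -mcompE prdr midE. Qed.
Lemma pr_dlE M N v : pr M N (dl M N v) = 0. Proof. by rewrite -mcompE prdl mhom0E. Qed.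
Lemma pl_drE M N v : pl M N (dr M N v) = 0. Proof. by rewrite -mcompE pldr mhom0E. Qed.
Definition dsE := (pl_dlE, pr_drE, pr_dlE, pl_drE).

Lemma dsum_se M N : short_exact (dl M N) (pr M N).
Proof.
split; [exact: retr_inj (pldl _ _) | | exact: retr_surj (prdr _ _)].
apply/limg_kerP => w; split=> [h|[v <-]]; last by rewrite -mcompE prdl mhom0E.
by exists (pl _ _ w); rewrite {2}(dsumE w) h mh0 addr0.
Qed.

Lemma dsumC M N : misom (dsum M N) (dsum N M).
Proof.
apply/misomP; exists (mpair (pr M N) (pl M N)), (mpair (pr N M) (pl N M)).
split; rewrite [RHS]mpair_eta !mcomp1r /mpair mcompDl -!mcompA.
  by rewrite !pr_mpair !pl_mpair.
by rewrite !pr_mpair !pl_mpair.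
Qed.

Lemma summandP X M : summand X M <-> exists (s : mhom X M) (r : mhom M X), r \m s = mid X.
Proof.
split=> [[Y /misomP [f [g [e1 e2]]]]|[s [r e]]].
  exists (g \m dl X Y), (pl X Y \m f).
  by rewrite -mcompA (mcompA _ g) e2 mcomp1l pldl.
have [Y [i [ii kE]]] := ker_exists r; exists Y.
have re v : r (s v) = v by rewrite -mcompE e midE.
have [x|p pE] := @factor_inj _ _ _ _ _ i (mid M - s \m r) ii.
  by apply/kE; rewrite mhomBE mhB !mhE re subrr.
have ri0 : r \m i = 0.
  by apply: mhom_eq => v; rewrite !mhE; apply/kE; exists v.
have ps : p \m s = 0.
  by apply: (inj_mono ii); rewrite mcompA pE mcompBl -mcompA e mcomp1l mcomp1r subrr mcomp0r.
have pi1 : p \m i = mid Y.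
  by apply: (inj_mono ii); rewrite mcompA pE mcompBl -mcompA ri0 mcomp0r mcomp1l subr0 mcomp1r.
apply/misomP; exists (mpair r p), (copair s i); split.
  by rewrite copair_mpair pE addrC subrK.
rewrite [RHS]mpair_eta [LHS]mpair_eta !mcomp1r !mcompA pl_mpair pr_mpair.
rewrite !copair_comp e ri0 ps pi1 /copair /mpair !mcomp0l !mcomp1l.
by rewrite addr0 add0r.
Qed.

Lemma summand_dl X Y : summand X (dsum X Y).
Proof. by exists Y; apply: misom_refl. Qed.

Lemma summand_dr X Y : summand Y (dsum X Y).
Proof. by exists X; apply: dsumC. Qed.

Lemma summand_trans X Y Z : summand X Y -> summand Y Z -> summand X Z.
Proof.
move=> /summandP [s [r e]] /summandP [s' [r' e']]; apply/summandP.
exists (s' \m s), (r \m r').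
by rewrite -mcompA (mcompA r') e' mcomp1l.
Qed.

Lemma summand_iso X Y : misom X Y -> summand X Y.
Proof. by case/misomP => f [g [e1 e2]]; apply/summandP; exists f, g. Qed.

Lemma dsum_dim M N : dm (dsum M N) = (dm M + dm N)%N.
Proof. exact: sex_dim (dsum_se M N). Qed.

Lemma dsum0r M N : is_zero N -> misom (dsum M N) M.
Proof.
move=> N0; exists (pl M N); split; last exact: retr_surj (pldl _ _).
apply/injmP => v h; rewrite (dsumE v) h mh0 add0r.
by rewrite ((is_zeroP N).1 N0 (pr M N v)) linear0.
Qed.

(** * Powers and generation *)

Definition pw M m : fdmod A := \big[dsum/mod0]_(i < m) M.

Lemma pwP M m : exists (ins : 'I_m -> mhom M (pw M m)) (prs : 'I_m -> mhom (pw M m) M),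
  (forall i j, prs j \m ins i = if i == j then mid M else 0) /\
  \sum_i (ins i \m prs i) = mid (pw M m).
Proof.
elim: m => [|m [ins [prs [h1 h2]]]].
  exists (fun=> 0), (fun=> 0); split; first by case.
  have -> : pw M 0 = mod0 by rewrite /pw big_ord0.
  by rewrite big_ord0; apply/esym/is_zero_mid/mod0_zero.
have -> : pw M m.+1 = dsum M (pw M m) by rewrite /pw big_ord_recl.
exists (fun i => if unlift ord0 i is Some j then dr _ _ \m ins j else dl _ _).
exists (fun i => if unlift ord0 i is Some j then prs j \m pr _ _ else pl _ _).
split=> [i j|].
  case: unliftP => [i'|] ->; case: unliftP => [j'|] ->.
  - rewrite -mcompA (mcompA (pr _ _)) prdr mcomp1l h1.
    by rewrite (inj_eq lift_inj).
  - by rewrite -mcompA prdl mcomp0r.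
  - by rewrite mcompA pldr mcomp0l.
  - by rewrite eqxx pldl.
rewrite big_ord_recl unlift_none; under eq_bigr => i _ do rewrite liftK.
rewrite -[RHS]dsum_id; congr (_ + _).
rewrite -[dr _ _ \m pr _ _]mcomp1r -[in RHS](mcomp1l (pr _ _)) -h2.
rewrite mcomp1r mcomp_suml mcomp_sumr; apply: eq_bigr => i _.
by rewrite !mcompA.
Qed.

Lemma hom_basis M N : exists m (f : 'I_m -> mhom M N), forall g, exists c : 'I_m -> K,
  g = \sum_i c i *: f i.
Proof.
exists (\dim {: mhom M N}), (fun i => (vbasis fullv)`_i) => g.
exists (fun i => coord (vbasis fullv) i g).
exact: coord_vbasis (memvf g).
Qed.

(** A right [add M]-approximation: one copy of [M] for each element of a basis of Hom(M, X). *)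
Lemma univ_out M X : exists m (q : mhom (pw M m) X),
  forall g : mhom M X, exists h, q \m h = g.
Proof.
have [m [f fE]] := hom_basis M X; have [ins [prs [h1 h2]]] := pwP M m.
exists m, (\sum_i (f i \m prs i)) => g; have [c ->] := fE g.
exists (\sum_i c i *: ins i); rewrite mcomp_sumr; apply: eq_bigr => i _.
rewrite mcompZr mcomp_suml (bigD1 i) //= -mcompA h1 eqxx mcomp1r.
rewrite big1 ?addr0 // => j ji; rewrite -mcompA h1 eq_sym (negPf ji).
by rewrite mcomp0r.
Qed.

Lemma univ_in M X : exists m (u : mhom X (pw M m)),
  forall g : mhom X M, exists h, h \m u = g.
Proof.
have [m [f fE]] := hom_basis X M; have [ins [prs [h1 h2]]] := pwP M m.
exists m, (\sum_i (ins i \m f i)) => g; have [c ->] := fE g.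
exists (\sum_i c i *: prs i); rewrite mcomp_suml; apply: eq_bigr => i _.
rewrite mcompZl mcomp_sumr (bigD1 i) //= mcompA h1 eqxx mcomp1l.
rewrite big1 ?addr0 // => j ji; rewrite mcompA h1 (negPf ji).
by rewrite mcomp0l.
Qed.

Definition gen M X := exists m (q : mhom (pw M m) X), surjm q.

Lemma genP M X : in_Gen M X <-> gen M X.
Proof.
split=> [[Y [[m /summandP [s [r e]]] [q qs]]]|[m [q qs]]].
  by exists m, (q \m r); apply: surjm_comp qs (retr_surj e).
exists (pw M m); split; last by exists q.
by exists m; apply/summand_iso/misom_refl.
Qed.

Lemma pw_hom_out M m Z (f g : mhom (pw M m) Z) :
  (forall h : mhom M (pw M m), f \m h = g \m h) -> f = g.
Proof.
move=> h; have [ins [prs [h1 h2]]] := pwP M m.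
by rewrite -[f]mcomp1r -[g]mcomp1r -h2 !mcomp_sumr; apply: eq_bigr => i _; rewrite !mcompA h.
Qed.

Lemma pw_hom_in M m Z (f g : mhom Z (pw M m)) :
  (forall h : mhom (pw M m) M, h \m f = h \m g) -> f = g.
Proof.
move=> h; have [ins [prs [h1 h2]]] := pwP M m.
by rewrite -[f]mcomp1l -[g]mcomp1l -h2 !mcomp_suml; apply: eq_bigr => i _; rewrite -!mcompA h.
Qed.

Lemma pw_lift_out M m X Y (g : mhom X Y) :
  (forall f : mhom M Y, exists h, g \m h = f) ->
  forall f : mhom (pw M m) Y, exists h, g \m h = f.
Proof.
move=> H f; have [ins [prs [h1 h2]]] := pwP M m.
have [k kE] := choice _ (fun i : 'I_m => H (f \m ins i)).
exists (\sum_i k i \m prs i); rewrite mcomp_sumr.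
rewrite -[f]mcomp1r -h2 mcomp_sumr; apply: eq_bigr => i _.
by rewrite !mcompA kE.
Qed.

Lemma pw_lift_in M m X Y (g : mhom X Y) :
  (forall f : mhom X M, exists h, h \m g = f) ->
  forall f : mhom X (pw M m), exists h, h \m g = f.
Proof.
move=> H f; have [ins [prs [h1 h2]]] := pwP M m.
have [k kE] := choice _ (fun i : 'I_m => H (prs i \m f)).
exists (\sum_i ins i \m k i); rewrite mcomp_suml.
rewrite -[f]mcomp1l -h2 mcomp_suml; apply: eq_bigr => i _.
by rewrite -!mcompA kE.
Qed.

Lemma hom0_pwl M m Z : hom0 M Z -> hom0 (pw M m) Z.
Proof. by move=> h f; apply: pw_hom_out => g; rewrite mcomp0l; apply: h. Qed.

Lemma hom0_pwr M m Z : hom0 Z M -> hom0 Z (pw M m).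
Proof. by move=> h f; apply: pw_hom_in => g; rewrite mcomp0r; apply: h. Qed.

Lemma gen_refl M : gen M M.
Proof.
have [ins [prs [h1 h2]]] := pwP M 1; exists 1%N, (prs ord0).
by apply: (@retr_surj _ _ _ _ (ins ord0)); rewrite h1 eqxx.
Qed.

Lemma gen_surj M X Y (q : mhom X Y) : surjm q -> gen M X -> gen M Y.
Proof. by move=> qs [m [p ps]]; exists m, (q \m p); apply: surjm_comp. Qed.

Lemma gen_hom0 M X Z : gen M X -> hom0 M Z -> hom0 X Z.
Proof. by move=> [m [q qs]] h; apply: (surj_injm_hom0 qs); apply: hom0_pwl. Qed.

Lemma gen_univ M X m (q : mhom (pw M m) X) :
  (forall g : mhom M X, exists h, q \m h = g) -> gen M X -> surjm q.
Proof.
move=> uq [k [p ps]].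
have [h hE] := pw_lift_out uq p.
by move: ps; rewrite -hE => /surj_compl.
Qed.

Lemma gen_pw M X m : gen M X -> gen M (pw X m).
Proof.
move=> gX; have [k [q qu]] := univ_out M (pw X m).
exists k, q; have [ins [prs [h1 h2]]] := pwP X m.
apply/surjmP => w.
have [k' [p /surjmP ps]] := gX.
have H i : exists v, q v = ins i (prs i w).
  have [v <-] := ps (prs i w); have [h hE] := pw_lift_out qu (ins i \m p).
  by exists (h v); rewrite -mcompE hE mcompE.
have [v vE] := choice _ H; exists (\sum_i v i).
rewrite mhS; under eq_bigr => i _ do rewrite vE -mcompE.
by rewrite -mhom_sumE h2 midE.
Qed.

Lemma gen_trans M X Y : gen M X -> gen X Y -> gen M Y.
Proof. by move=> gX [m [q qs]]; apply: (gen_surj qs); apply: gen_pw. Qed.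

Lemma gen_dsum M X Y : gen M X -> gen M Y -> gen M (dsum X Y).
Proof.
move=> gX gY; have [k [q qu]] := univ_out M (dsum X Y); exists k, q.
have [a [p /surjmP ps]] := gX; have [b [p' /surjmP ps']] := gY.
have [h hE] := pw_lift_out qu (dl _ _ \m p).
have [h' hE'] := pw_lift_out qu (dr _ _ \m p').
apply/surjmP => w; have [v vE] := ps (pl _ _ w); have [v' vE'] := ps' (pr _ _ w).
exists (h v + h' v'); rewrite mhD -!mcompE hE hE' !mcompE.
by rewrite vE vE' -dsumE.
Qed.

Lemma gen_zero M X : is_zero X -> gen M X.
Proof.
move=> X0; exists 0%N, 0; apply/surjmP => w; exists 0.
by rewrite linear0 ((is_zeroP X).1 X0 w).
Qed.

Lemma gen_iso M X Y : misom X Y -> gen M X -> gen M Y.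
Proof. by case=> f [_ fs]; exact: gen_surj fs. Qed.

(** [T] is the image of an approximation. Maps [M -> F] that do not lift to [X] may survive;
    excluding them takes Ext^1(M, T) = 0, see [fq_exists]. *)
Lemma trace_exists M X : exists T F (i : mhom T X) (q : mhom X F),
  [/\ short_exact i q, gen M T & forall f : mhom M X, q \m f = 0].
Proof.
have [m [u uu]] := univ_out M X.
have [T [p [i [ps ii e]]]] := img_exists u.
have [F [q [qs qE]]] := coker_exists i.
exists T, F, i, q; split.
- by split=> //; apply/limg_kerP => w; apply: qE.
- by exists m, p.
- move=> f; have [h <-] := uu f; apply: mhom_eq => v; rewrite -e !mhE.
  by apply/qE; exists (p (h v)).
Qed.

(** * Fitting's lemma and local endomorphism rings *)

Definition mexp M (f : mhom M M) n := iter n (mcomp f) (mid M).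

Lemma mexpS M (f : mhom M M) n : mexp f n.+1 = f \m mexp f n.
Proof. by []. Qed.

Lemma mexpSr M (f : mhom M M) n : mexp f n.+1 = mexp f n \m f.
Proof.
elim: n => [|n IH]; first by rewrite /mexp /= mcomp1l mcomp1r.
by rewrite mexpS {1}IH mcompA.
Qed.

Lemma mexpD M (f : mhom M M) m n : mexp f (m + n) = mexp f m \m mexp f n.
Proof.
elim: m => [|m IH]; first by rewrite add0n /mexp /= mcomp1l.
by rewrite addSn !mexpS IH mcompA.
Qed.

(** The images of the powers decrease, so two consecutive ones agree. With [0 < n] the power
    [mexp f n] factors through [f], which is how surjectivity is carried back to [f]. *)
Lemma mexp_stab M (f : mhom M M) : exists n, (0 < n)%N /\
  forall v, exists w, mexp f n v = mexp f (n + n) w.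
Proof.
pose d k := \dim (limg (mexp f k)).
have dS k : (limg (mexp f k.+1) <= limg (mexp f k))%VS.
  apply/subvP => _ /memv_limgP [v <-]; apply/memv_limgP; exists (f v).
  by rewrite mexpSr mcompE.
have dle k : (d k.+1 <= d k)%N by apply: dimvS.
have [n n0 nE] : exists2 n, (0 < n)%N & d n = d n.+1.
  have main m : forall k, (d k <= m)%N -> (0 < k)%N -> exists2 n, (0 < n)%N & d n = d n.+1.
    elim: m => [|m IH] k dk k0.
      by exists k => //; apply/eqP; rewrite eqn_leq dle andbT; apply: leq_trans dk _.
    have [e|ne] := eqVneq (d k) (d k.+1); first by exists k.
    apply: (IH k.+1) => //; rewrite -ltnS; apply: leq_trans dk.
    by rewrite ltn_neqAle eq_sym ne dle.
  exact: (main (d 1%N) 1%N).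
have step : forall v, exists w, mexp f n v = mexp f n.+1 w.
  have /eqP e : limg (mexp f n.+1) == limg (mexp f n).
    by rewrite eqEdim dS -/(d _) -/(d n.+1) nE leqnn.
  move=> v; have : mexp f n v \in limg (mexp f n.+1) by rewrite e memv_img ?memvf.
  by case/memv_limgP => w <-; exists w.
have stepk k : forall v, exists w, mexp f n v = mexp f (n + k) w.
  elim: k => [|k IH] v; first by exists v; rewrite addn0.
  have [w ->] := IH v; have [w' e] := step w.
  exists w'; rewrite addnC mexpD mcompE e -mcompE -mexpD; congr (mexp f _ _).
  by rewrite !addnS addnC.
exists n; split=> //.
Qed.

(** [X] is the stable image of [f]. The composite [r \m s] is the restriction of [mexp f n] to it,
    an automorphism rather than the identity; [b] is its inverse, so that [b \m r] retracts [s]. *)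
Lemma fitting M (f : mhom M M) : exists n X (s : mhom X M) (r : mhom M X) (b : mhom X X),
  [/\ (0 < n)%N, s \m r = mexp f n, b \m (r \m s) = mid X & (r \m s) \m b = mid X].
Proof.
have [n [n0 nE]] := mexp_stab f.
have [X [r [s [rs si e]]]] := img_exists (mexp f n).
have sE v : s (r v) = mexp f n v by rewrite -mcompE e.
have su : surjm (r \m s).
  apply/surjmP => x; have [v <-] := (surjmP r).1 rs x.
  have [w E] := nE v; exists (r w); apply: (injm_inj si).
  by rewrite mcompE !sE -mcompE -mexpD -E.
have inj : injm (r \m s) by apply: surj_dim_inj.
have [b [b1 b2]] := bijm_inv inj su.
by exists n, X, s, r, b.
Qed.

Lemma indec_fitting M (f : mhom M M) : indecomposable M ->
  surjm f \/ exists n, mexp f n = 0.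
Proof.
move=> [M0 Mi]; have [n [X [s [r [b [n0 e b1 b2]]]]]] := fitting f.
have [Y h] : summand X M by apply/summandP; exists s, (b \m r); rewrite -mcompA.
case: (Mi _ _ h) => Z0.
  by right; exists n; rewrite -e -[s]mcomp1r ((is_zero_mid X).1 Z0) mcomp0r mcomp0l.
left; have le : (dm M <= dm X)%N.
  by rewrite (misom_dim h) dsum_dim ((dm0 Y).1 Z0) addn0.
have ss : surjm s.
  apply: inj_dim_surj le; apply: (@retr_inj _ _ _ _ _ (b \m r)).
  by rewrite -mcompA.
case: n n0 e => // n _ e; apply: (@surj_compl _ _ _ _ _ _ (mexp f n)).
rewrite -mexpS -e; apply: surjm_comp ss _.
by apply: (@surj_compl _ _ _ _ _ _ (s \m b)); rewrite mcompA b2; apply: surj_mid.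
Qed.

Lemma surj_endo_inv M (f : mhom M M) : surjm f -> exists g, g \m f = mid M /\ f \m g = mid M.
Proof. by move=> fs; apply: (bijm_inv _ fs); apply: surj_dim_inj fs (leqnn _). Qed.

Lemma nilp_sub_surj M (f : mhom M M) n : mexp f n = 0 -> surjm (mid M - f).
Proof.
move=> e; apply: inj_dim_surj => //; apply/injmP => v; rewrite mhomBE midE => /eqP.
rewrite subr_eq0 => /eqP vE.
have H k : mexp f k v = v by elim: k => [|k IH]; rewrite ?midE // mexpS mcompE IH.
by rewrite -(H n) e mhom0E.
Qed.

(** Up to the automorphism [f + g] the two maps add up to the identity. By Fitting's lemma the first
    is invertible or nilpotent, and 1 minus a nilpotent map is invertible. *)
Lemma indec_local M (f g : mhom M M) : indecomposable M -> surjm (f + g) -> surjm f \/ surjm g.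
Proof.
move=> iM h; have [k [k1 k2]] := surj_endo_inv h.
case: (indec_fitting (k \m f) iM) => [s|[n e]].
  left; apply: (@surj_compl _ _ _ _ _ _ (mid M)); rewrite mcomp1r.
  have -> : f = (f + g) \m (k \m f) by rewrite mcompA k2 mcomp1l.
  by apply: surjm_comp.
right; have -> : g = (f + g) \m (k \m g) by rewrite mcompA k2 mcomp1l.
apply: surjm_comp => //.
have -> : k \m g = mid M - k \m f by rewrite -k1 mcompDr addrC addKr.
exact: nilp_sub_surj e.
Qed.

Lemma indec_local_sum M (I : finType) (f : I -> mhom M M) : indecomposable M ->
  surjm (\sum_i f i) -> exists i, surjm (f i).
Proof.
move=> iM; have main (s : seq I) : surjm (\sum_(i <- s) f i) -> exists i, surjm (f i).
  elim: s => [|i s IH].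
    rewrite big_nil => /surjmP h; case: iM => [[]]; apply/is_zeroP => v.
    by have [w <-] := h v; rewrite mhom0E.
  by rewrite big_cons => /(indec_local iM) [|/IH //]; exists i.
exact: main.
Qed.

Lemma endo_fact_summand X M (s : mhom X M) (r : mhom M X) : surjm (r \m s) -> summand X M.
Proof.
move=> h; have [g [g1 g2]] := surj_endo_inv h.
by apply/summandP; exists s, (g \m r); rewrite -mcompA.
Qed.

Lemma indec_summand_pw X M m : indecomposable X -> summand X (pw M m) -> summand X M.
Proof.
move=> iX /summandP [s [r e]]; have [ins [prs [h1 h2]]] := pwP M m.
have : surjm (\sum_i (r \m ins i \m (prs i \m s))).
  under eq_bigr => i _ do rewrite -mcompA (mcompA (ins i)).
  rewrite -mcomp_sumr -mcomp_suml h2 mcomp1l e; exact: surj_mid.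
by case/(indec_local_sum iX) => i /endo_fact_summand.
Qed.

Lemma indec_summand_dsum X M N : indecomposable X -> summand X (dsum M N) ->
  summand X M \/ summand X N.
Proof.
move=> iX /summandP [s [r e]].
have : surjm ((r \m dl M N) \m (pl M N \m s) + (r \m dr M N) \m (pr M N \m s)).
  have -> : (r \m dl M N) \m (pl M N \m s) + (r \m dr M N) \m (pr M N \m s) = mid X.
    rewrite -!mcompA -mcompDr (mcompA (dl M N)) (mcompA (dr M N)) -mcompDl.
    by rewrite dsum_id mcomp1l.
  exact: surj_mid.
by case/(indec_local iX) => /endo_fact_summand; [left | right].
Qed.

Lemma indec_summand X M : indecomposable M -> ~ is_zero X -> summand X M -> misom X M.
Proof.
move=> [_ iM] X0 [Y h]; case: (iM _ _ h) => // /dsum0r h'.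
exact/misom_sym/(misom_trans h)/h'.
Qed.

Lemma indec_iso X Y : misom X Y -> indecomposable X -> indecomposable Y.
Proof.
move=> h [X0 iX]; split; first by move=> /(misom_zero (misom_sym h)).
by move=> U W /(misom_trans h)/iX.
Qed.

(** Existence of decompositions into indecomposables, by induction on the dimension, in the form of
    an induction principle. *)
Lemma indec_ind (Phi : fdmod A -> Prop) :
  (forall X Y, misom X Y -> Phi X -> Phi Y) -> (forall X, is_zero X -> Phi X) ->
  (forall X, indecomposable X -> Phi X) -> (forall X Y, Phi X -> Phi Y -> Phi (dsum X Y)) ->
  forall X, Phi X.
Proof.
move=> Pi P0 PI PD X; have [n] := ubnP (dm X); elim: n X => // n IH X lt.
have [z|nz] := classic (is_zero X); first exact: P0.
have [i|ni] := classic (indecomposable X); first exact: PI.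
have [U [W [h U0 W0]]] : exists U W, [/\ misom X (dsum U W), ~ is_zero U & ~ is_zero W].
  apply: NNPP => h; apply: ni; split=> // U W iso.
  have [?|U0] := classic (is_zero U); first by left.
  by right; apply: NNPP => W0; apply: h; exists U, W.
have e := misom_dim h; rewrite dsum_dim in e.
have pos Z : ~ is_zero Z -> (0 < dm Z)%N.
  by move=> Z0; rewrite lt0n; apply/eqP => /dm0.
apply: (Pi _ _ (misom_sym h)); rewrite ltnS in lt.
apply: PD; apply: IH; apply: leq_trans lt; rewrite e.
  by rewrite -[X in (X < _)%N]addn0 ltn_add2l pos.
by rewrite -[X in (X < _)%N]add0n ltn_add2r pos.
Qed.

(** Nakayama's lemma over the local ring End X, whose radical consists of the endomorphisms that are
    not onto. [X] is finitely generated over it by a [K]-basis; if all [g i] were in the radical,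
    generators could be removed one at a time until [X] is zero. *)
Lemma nakayama_indec X (I : finType) (g : I -> mhom X X) : indecomposable X ->
  (forall x, exists v : I -> X, x = \sum_i g i (v i)) -> exists i, surjm (g i).
Proof.
move=> iX span; apply: NNPP => nos.
have nsum (J : finType) (h : I -> J -> mhom X X) j : ~ surjm (\sum_i (g i \m h i j)).
  by move/(indec_local_sum iX) => [i /surj_compl gi]; apply: nos; exists i.
have main m : forall x : 'I_m -> X,
    (forall y, exists e : 'I_m -> mhom X X, y = \sum_j e j (x j)) -> is_zero X.
  elim: m => [|m IH] x xs.
    by apply/is_zeroP => y; have [e ->] := xs y; rewrite big_ord0.
  have [v vE] := span (x ord0).
  have [e eE] := choice _ (fun i : I => xs (v i)).
  pose h j : mhom X X := \sum_i (g i \m e i j).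
  have xE : x ord0 = \sum_j (h j : mhom X X) (x j).
    rewrite {1}vE; under eq_bigr => i _ do rewrite eE mhS.
    rewrite exchange_big; apply: eq_bigr => j _.
    by rewrite mhom_sumE; apply: eq_bigr => i _; rewrite mcompE.
  have : surjm ((mid X - h ord0) + h ord0) by rewrite subrK; apply: surj_mid.
  case/(indec_local iX) => [/surj_endo_inv [k [k1 k2]]|/nsum []].
  (* [h ord0] is in the radical, so [mid X - h ord0] is invertible with inverse [k]: the relation
     [xE] can be solved for the first generator. *)
  have x0E : x ord0 = \sum_(j < m) (k \m h (lift ord0 j)) (x (lift ord0 j)).
    have : (mid X - h ord0 : mhom X X) (x ord0) = \sum_(j < m) h (lift ord0 j) (x (lift ord0 j)).
      by rewrite mhomBE midE {1}xE big_ord_recl addrC addKr.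
    move/(congr1 k); rewrite -mcompE k1 midE => ->.
    by rewrite mhS; apply: eq_bigr => j _; rewrite mcompE.
  apply: (IH (fun j => x (lift ord0 j))) => y; have [f ->] := xs y.
  exists (fun j => f ord0 \m (k \m h (lift ord0 j)) + f (lift ord0 j)).
  rewrite big_ord_recl {1}x0E mhS -big_split /=; apply: eq_bigr => j _.
  by rewrite mhomDE !mcompE.
case: iX => X0 _; apply: X0.
apply: (main (\dim {: X}) (fun i => (vbasis {: X})`_i)) => y.
exists (fun i => coord (vbasis {: X}) i y *: mid X).
rewrite {1}(coord_vbasis (memvf y)); apply: eq_bigr => i _.
by rewrite mhomZE midE.
Qed.

(** Composing the two epimorphisms componentwise gives endomorphisms of [X] whose images span [X].
    One of them is onto by Nakayama, and it factors through [Y]. *)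
Lemma gen_antisym X Y : indecomposable X -> indecomposable Y -> gen X Y -> gen Y X -> misom X Y.
Proof.
move=> iX iY [a [p ps]] [b [q qs]].
have [ins [prs [h1 h2]]] := pwP X a; have [ins' [prs' [h1' h2']]] := pwP Y b.
pose g (ij : 'I_b * 'I_a) : mhom X X := (q \m ins' ij.1) \m (p \m ins ij.2).
have [|[i j] /endo_fact_summand] := @nakayama_indec X _ g iX.
  move=> x; have [y <-] := (surjmP q).1 qs x.
  have [z zE] := choice _ (fun i => (surjmP p).1 ps (prs' i y)).
  exists (fun ij => prs ij.2 (z ij.1)).
  rewrite -(pair_big xpredT xpredT (fun i j => g (i, j) (prs j (z i)))) /=.
  rewrite -{1}[y]midE -h2' mhom_sumE mhS; apply: eq_bigr => i _.
  rewrite mcompE -zE -{1}[z i]midE -h2 mhom_sumE !mhS.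
  by apply: eq_bigr => j _; rewrite !mcompE.
by move=> sXY; apply: indec_summand sXY => //; case: iX.
Qed.

End Sums.

(** * Extensions, projectives and simples in a wide subcategory *)

Section WideCats.
Context {K : fieldType} {A : falgType K}.
Implicit Types (M N P Q S T X Y Z : fdmod A) (V W U : fdmod A -> Prop).

(** Pull the extension back along [f]: a section of the pull-back [B -> M], followed by the
    projection to [E], is the lift. *)
Lemma ext_lift M Y E E' (i : mhom Y E) (g : mhom E E') (f : mhom M E') :
  ext1_zero M Y -> short_exact i g -> exists h, g \m h = f.
Proof.
move=> hM /sexP [ii kE gs].
have [B [j [ji jE]]] := ker_exists (copair g (- f) : mhom (dsum E M) E').
have jE0 w : g (pl E M w) = f (pr E M w) <-> exists s, j s = w.
  rewrite -jE copairE mhomNE; split=> [->|/eqP]; first exact: subrr.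
  by rewrite subr_eq0 => /eqP.
have [|i' iE] := @factor_inj _ _ _ _ _ j (dl E M \m i) ji.
  by move=> x; apply/jE0; rewrite mcompE !dsE mh0; apply/kE; exists x.
have iE' v : j (i' v) = dl E M (i v) by rewrite -mcompE iE mcompE.
have [|s sE] := hM B i' (pr E M \m j).
  apply/sexP; split.
  - by move=> v h; apply: ii; rewrite -(pl_dlE M (i v)) -iE' h !mh0.
  - move=> w; rewrite mcompE; split=> [h|[v <-]]; last by rewrite iE' dsE.
    have : g (pl E M (j w)) = 0 by rewrite ((jE0 (j w)).2 _) ?h ?mh0 //; exists w.
    move/kE => [v vE]; exists v; apply: (injm_inj ji).
    by rewrite iE' vE [RHS]dsumE h mh0 addr0.
  - move=> m; have [e eE] := gs (f m).
    have /jE0 [b bE] : g (pl E M (dl E M e + dr E M m)) = f (pr E M (dl E M e + dr E M m)).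
      by rewrite !mhD !dsE !mh0 addr0 add0r eE.
    by exists b; rewrite mcompE bE mhD !dsE add0r.
exists (pl E M \m (j \m s)); apply: mhom_eq => m; rewrite !mcompE.
rewrite ((jE0 (j (s m))).2 _); last by exists (s m).
by rewrite -[in RHS](midE m) -sE !mcompE.
Qed.

Lemma ext1_summand M M' Y : summand M M' -> ext1_zero M' Y -> ext1_zero M Y.
Proof.
move=> /summandP [s [r e]] h E i q se.
by have [k kE] := ext_lift r h se; exists (k \m s); rewrite mcompA kE.
Qed.

Lemma ext1_isol M M' Y : misom M M' -> ext1_zero M' Y -> ext1_zero M Y.
Proof. by move/summand_iso; apply: ext1_summand. Qed.

Lemma ext1_dsum M M' Y : ext1_zero M Y -> ext1_zero M' Y -> ext1_zero (dsum M M') Y.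
Proof.
move=> h h' E i q se; have [k kE] := ext_lift (dl M M') h se.
have [k' kE'] := ext_lift (dr M M') h' se.
by exists (copair k k'); rewrite copair_comp kE kE' [RHS]copair_eta !mcomp1l.
Qed.

Lemma ext1_zerol M Y : is_zero M -> ext1_zero M Y.
Proof.
by move=> M0 E i q se; exists 0; rewrite mcomp0r; apply/esym/is_zero_mid.
Qed.

Lemma ext1_pw M m Y : ext1_zero M Y -> ext1_zero (pw M m) Y.
Proof.
move=> h; elim: m => [|m IH].
  by apply: ext1_zerol; rewrite /pw big_ord0; apply: mod0_zero.
have -> : pw M m.+1 = dsum M (pw M m) by rewrite /pw big_ord_recl.
exact: ext1_dsum.
Qed.

Section Wide.
Variable V : fdmod A -> Prop.
Hypothesis hV : wide V.

Lemma wide_img X Y S (q : mhom X S) (i : mhom S Y) : surjm q -> injm i -> V X -> V Y -> V S.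
Proof.
move=> qs ii VX VY; have [C [c [cs cE]]] := coker_exists (i \m q).
have VC : V C.
  by apply: (wide_coker hV VX VY cs); apply/esym/limg_kerP.
apply: (@wide_ker _ _ _ hV _ _ _ c _ VY VC ii); apply/limg_kerP => w; rewrite cE.
split=> -[v <-]; first by exists (q v); rewrite mcompE.
by have [x <-] := (surjmP q).1 qs v; exists x; rewrite mcompE.
Qed.

Lemma wide_dsum X Y : V X -> V Y -> V (dsum X Y).
Proof. by move=> VX VY; apply: (wide_ext hV VX VY (dsum_se X Y)). Qed.

Lemma wide_pw X m : V X -> V (pw X m).
Proof.
move=> VX; elim: m => [|m IH]; first by rewrite /pw big_ord0; apply: wide_zero hV.
have -> : pw X m.+1 = dsum X (pw X m) by rewrite /pw big_ord_recl.
exact: wide_dsum.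
Qed.

Lemma wide_summand X M : summand X M -> V M -> V X.
Proof.
by move=> /summandP [s [r e]] VM; apply: (wide_img (retr_surj e) (retr_inj e)).
Qed.

Lemma wide_iszero X : is_zero X -> V X.
Proof.
by move=> X0; apply: (wide_iso hV (zero_misom mod0_zero X0)); apply: wide_zero.
Qed.

Lemma wide_sub X Y Z (i : mhom X Y) (q : mhom Y Z) : short_exact i q -> V Y -> V Z -> V X.
Proof. by case=> ii e _ VY VZ; apply: (wide_ker hV VY VZ ii e). Qed.

Lemma wide_quo X Y Z (i : mhom X Y) (q : mhom Y Z) : short_exact i q -> V X -> V Y -> V Z.
Proof. by case=> ii e qs VX VY; apply: (wide_coker hV VX VY qs (esym e)). Qed.

Lemma quo_se X Y (q : mhom X Y) : surjm q -> exists T (i : mhom T X), short_exact i q.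
Proof.
move=> qs; have [T [i [ii iE]]] := ker_exists q; exists T, i.
by split=> //; apply/limg_kerP.
Qed.

Lemma quo_seV X Y (q : mhom X Y) : surjm q -> V X -> V Y ->
  exists T (i : mhom T X), V T /\ short_exact i q.
Proof.
move=> qs VX VY; have [T [i se]] := quo_se qs; exists T, i; split=> //.
exact: wide_sub se VX VY.
Qed.

Lemma sub_se X Y (i : mhom X Y) : injm i -> exists Z (q : mhom Y Z), short_exact i q.
Proof.
move=> ii; have [Z [q [qs qE]]] := coker_exists i; exists Z, q.
by split=> //; apply/limg_kerP.
Qed.

Lemma sub_seV X Y (i : mhom X Y) : injm i -> V X -> V Y ->
  exists Z (q : mhom Y Z), V Z /\ short_exact i q.
Proof.
move=> ii VX VY; have [Z [q se]] := sub_se ii; exists Z, q; split=> //.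
exact: wide_quo se VX VY.
Qed.

Lemma ker_V X Y (f : mhom X Y) : V X -> V Y -> exists T (i : mhom T X),
  [/\ V T, injm i & forall v, f v = 0 <-> exists s, i s = v].
Proof.
move=> VX VY; have [T [i [ii iE]]] := ker_exists f; exists T, i; split=> //.
by apply: (@wide_ker _ _ _ hV _ _ _ f _ VX VY ii); apply/limg_kerP.
Qed.

Lemma coker_V X Y (f : mhom X Y) : V X -> V Y -> exists T (i : mhom Y T),
  [/\ V T, surjm i & forall v, i v = 0 <-> exists s, f s = v].
Proof.
move=> VX VY; have [T [i [ii iE]]] := coker_exists f; exists T, i; split=> //.
by apply: (wide_coker hV VX VY ii); apply/esym/limg_kerP.
Qed.

Lemma img_V X Y (f : mhom X Y) : V X -> V Y -> exists S (q : mhom X S) (i : mhom S Y),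
  [/\ V S, surjm q, injm i & i \m q = f].
Proof.
move=> VX VY; have [S [q [i [qs ii e]]]] := img_exists f; exists S, q, i; split=> //.
exact: wide_img qs ii VX VY.
Qed.

Lemma gen_V M X Y (i : mhom X Y) : V M -> gen M X -> injm i -> V Y -> V X.
Proof. by move=> VM [m [q qs]] ii VY; exact: (wide_img qs ii (wide_pw m VM) VY). Qed.

Lemma trace_V M X : V M -> V X -> exists T F (i : mhom T X) (q : mhom X F),
  [/\ V T, V F, short_exact i q, gen M T & forall f : mhom M X, q \m f = 0].
Proof.
move=> VM VX; have [T [F [i [q [se gT h]]]]] := trace_exists M X.
have VT : V T by case: (se) => ii _ _; exact: gen_V VM gT ii VX.
by exists T, F, i, q; split=> //; exact: wide_quo se VT VX.
Qed.

(** * Projective objects *)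

Notation proj := (projective_in V).

Lemma proj_V P : proj P -> V P. Proof. by case. Qed.

Lemma proj_lift P X Y (g : mhom X Y) (f : mhom P Y) : proj P -> V X -> V Y -> surjm g ->
  exists h, g \m h = f.
Proof. by case=> _; apply. Qed.

Lemma proj_ext P Y : proj P -> V Y -> ext1_zero P Y.
Proof.
move=> hP VY E i q se; apply: (proj_lift _ hP) => //; last by case: se.
  exact: (wide_ext hV VY (proj_V hP) se).
exact: proj_V hP.
Qed.

Lemma ext_proj P : V P -> (forall Y, V Y -> ext1_zero P Y) -> proj P.
Proof.
move=> VP h; split=> // X Y g f VX VY gs.
have [T [i [VT se]]] := quo_seV gs VX VY.
exact: (ext_lift f (h _ VT) se).
Qed.

Lemma proj_summand P Q : summand P Q -> proj Q -> proj P.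
Proof.
move=> s hQ; apply: ext_proj; first exact: wide_summand s (proj_V hQ).
by move=> Y VY; apply: (ext1_summand s); apply: proj_ext.
Qed.

Lemma proj_iso P Q : misom P Q -> proj P -> proj Q.
Proof. by move=> /misom_sym/summand_iso; apply: proj_summand. Qed.

Lemma proj_dsum P Q : proj P -> proj Q -> proj (dsum P Q).
Proof.
move=> hP hQ; apply: ext_proj; first by apply: wide_dsum; apply: proj_V.
by move=> Y VY; apply: ext1_dsum; apply: proj_ext.
Qed.

Lemma proj_zero P : is_zero P -> proj P.
Proof.
move=> P0; apply: ext_proj; first exact: wide_iszero.
by move=> Y VY; apply: ext1_zerol.
Qed.

Lemma proj_pw P m : proj P -> proj (pw P m).
Proof.
move=> hP; apply: ext_proj; first by apply/wide_pw/proj_V.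
by move=> Y VY; apply/ext1_pw/proj_ext.
Qed.

Lemma proj_split P X (q : mhom X P) : proj P -> V X -> surjm q -> exists s, q \m s = mid P.
Proof. by move=> hP VX qs; apply: proj_lift => //; apply: proj_V. Qed.

Lemma proj_hm P X Y Z (i : mhom X Y) (q : mhom Y Z) : proj P -> V X -> V Y -> short_exact i q ->
  hm P Y = (hm P X + hm P Z)%N.
Proof.
move=> hP VX VY se; apply: (hm_sex se) => f.
by apply: (proj_lift _ hP VY (wide_quo se VX VY)); case: se.
Qed.

Lemma essP X Y (p : mhom X Y) : surjm p ->
  (essential_in V p <-> forall Z (g : mhom Z X), V Z -> surjm (p \m g) -> surjm g).
Proof.
move=> ps; split=> h Z g VZ e; apply: h => //; first by rewrite (ps : limg p = _).
by rewrite /surjm e.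
Qed.

(** A lift of [q] through [q \m g] yields an endomorphism [g \m h] of [P] over [X]. It cannot be
    nilpotent, since that would make [q] zero; so it is onto, and [g] with it. *)
Lemma indec_proj_ess P X (q : mhom P X) : proj P -> indecomposable P -> V X -> surjm q ->
  ~ is_zero X -> forall Z (g : mhom Z P), V Z -> surjm (q \m g) -> surjm g.
Proof.
move=> hP iP VX qs X0 Z g VZ s; have [h hE] := proj_lift q hP VZ VX s.
case: (indec_fitting (g \m h) iP) => [/surj_compl //|[n nE]].
case: X0; apply/is_zeroP => x; have [v <-] := (surjmP q).1 qs x.
have H k : q \m mexp (g \m h) k = q.
  elim: k => [|k IH]; first exact: mcomp1r.
  by rewrite mexpSr mcompA IH mcompA.
by rewrite -(H n) nE mcomp0r mhom0E.
Qed.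

(** * Simple objects *)

Lemma simple_surj X S (f : mhom X S) : V X -> simple_in V S -> f <> 0 -> surjm f.
Proof.
move=> VX [VS S0 hS] f0; have [I [q [i [VI qs ii e]]]] := img_V f VX VS.
case: (hS _ i VI ii) => [/is_zeroP I0|si]; last by rewrite -e; apply: surjm_comp.
by case: f0; apply: mhom_eq => v; rewrite -e mcompE (I0 (q v)) mh0 mhom0E.
Qed.

Lemma simple_inj X S (f : mhom S X) : V X -> simple_in V S -> f <> 0 -> injm f.
Proof.
move=> VX [VS S0 hS] f0; have [I [i [VI ii iE]]] := ker_V f VS VX.
case: (hS _ i VI ii) => [/is_zeroP I0|si].
  by apply/injmP => v /iE [w <-]; rewrite (I0 w) mh0.
case: f0; apply: mhom_eq => v; rewrite mhom0E; apply/iE.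
exact: (surjmP i).1.
Qed.

Lemma simple_iso S S' (f : mhom S S') : simple_in V S -> simple_in V S' -> f <> 0 -> misom S S'.
Proof.
move=> hS hS' f0; exists f; split; first by apply: simple_inj f0 => //; case: hS'.
by apply: simple_surj f0 => //; case: hS.
Qed.

Lemma surj_ne0 X Y (q : mhom X Y) : surjm q -> ~ is_zero Y -> q <> 0.
Proof.
move=> /surjmP qs Y0 e; apply: Y0; apply/is_zeroP => y.
by have [x <-] := qs y; rewrite e mhom0E.
Qed.

Lemma simple_quotient X : V X -> ~ is_zero X -> exists S (q : mhom X S), simple_in V S /\ surjm q.
Proof.
move=> VX X0.
have [n] : exists n, exists S (q : mhom X S), [/\ V S, ~ is_zero S, surjm q & (dm S <= n)%N].
  by exists (dm X), X, (mid X); split=> //; apply: surj_mid.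
elim: n => [|n IH] [S [q [VS S0 qs le]]].
  by case: S0; apply/dm0/eqP; rewrite -leqn0.
have [h|h] := classic (exists S (q : mhom X S), [/\ V S, ~ is_zero S, surjm q & (dm S <= n)%N]).
  exact: IH.
exists S, q; split=> //; split=> // Y f VY fi.
have [?|Y0] := classic (is_zero Y); [by left | right].
have [C [c [VC se]]] := sub_seV fi VY VS.
have [C0|C0] := classic (is_zero C).
  apply: inj_dim_surj fi _; rewrite (sex_dim se) ((dm0 C).1 C0) addn0; exact: leqnn.
case: h; exists C, (c \m q); split=> //; first by apply: surjm_comp qs; case: se.
rewrite -ltnS (leq_trans _ le) // (sex_dim se) -[X in (X < _)%N]add0n ltn_add2r lt0n.
by apply/eqP => /dm0.
Qed.

Lemma indec_proj_simple P P' S (q : mhom P S) (q' : mhom P' S) : proj P -> proj P' ->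
  indecomposable P -> indecomposable P' -> simple_in V S -> surjm q -> surjm q' -> misom P P'.
Proof.
move=> hP hP' iP iP' [VS S0 _] qs qs'.
have [a aE] := proj_lift q hP (proj_V hP') VS qs'.
have [b bE] := proj_lift q' hP' (proj_V hP) VS qs.
have as_ : surjm a.
  by apply: (indec_proj_ess hP' iP' VS qs' S0 (proj_V hP)); rewrite aE.
have bs : surjm b.
  by apply: (indec_proj_ess hP iP VS qs S0 (proj_V hP')); rewrite bE.
by exists a; split=> //; apply: sur2_isom as_ bs.
Qed.

(** If [q] did not vanish on the kernel of [q'], it would map this kernel onto [S], and essentiality
    of [q] would make the kernel all of [P]. So [q] factors through [q']. *)
Lemma indec_proj_top P S S' (q : mhom P S) (q' : mhom P S') : proj P -> indecomposable P ->
  simple_in V S -> simple_in V S' -> surjm q -> surjm q' -> misom S S'.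
Proof.
move=> hP iP hS hS' qs qs'; have [VS S0 _] := hS; have [VS' S0' _] := hS'.
have [T [i [VT se]]] := quo_seV qs' (proj_V hP) VS'.
have /sexP [ii iE _] := se.
have e : q \m i = 0.
  apply: NNPP => ne; have s := simple_surj VT hS ne.
  have := indec_proj_ess hP iP VS qs S0 VT s => /surjmP is_.
  apply: (surj_ne0 qs' S0'); apply: mhom_eq => v; rewrite mhom0E.
  by apply/iE; apply: is_.
have [|f fE] := @factor_surj _ _ _ _ _ q' q qs'.
  by move=> x /iE [y <-]; rewrite -mcompE e mhom0E.
apply/misom_sym/(@simple_iso _ _ f hS' hS) => f0.
by apply: (surj_ne0 qs S0); rewrite -fE f0 mcomp0l.
Qed.

Lemma simple_proj_hom P S S' (q : mhom P S) : proj P -> indecomposable P ->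
  simple_in V S -> simple_in V S' -> surjm q -> ~ hom0 P S' -> misom S S'.
Proof.
move=> hP iP hS hS' qs /not_all_ex_not [f f0].
exact: indec_proj_top qs (simple_surj (proj_V hP) hS' f0).
Qed.

Section Enough.
Hypothesis hG : exists G, progenerator V G.

Lemma enough_proj X : V X -> exists P (p : mhom P X), proj P /\ surjm p.
Proof.
move=> VX; have [G [hP hX]] := hG; have /genP [m [q qs]] := hX _ VX.
by exists (pw G m), q; split=> //; apply: proj_pw.
Qed.

(** An epimorphism that is not essential produces an endomorphism [g \m h'] of [P] over [X] that is
    not onto. Its stable image is a smaller projective summand still covering [X]. *)
Lemma proj_cover X : V X -> exists P (p : mhom P X), [/\ proj P, surjm p & essential_in V p].
Proof.
move=> VX; have [P [p [hP ps]]] := enough_proj VX.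
have [n] := ubnP (dm P); elim: n P p hP ps => // n IH P p hP ps lt.
have [e|] := classic (essential_in V p); first by exists P, p.
rewrite essP // => h.
have [Z [g [VZ s ns]]] : exists Z (g : mhom Z P), [/\ V Z, surjm (p \m g) & ~ surjm g].
  apply: NNPP => h'; apply: h => Z g VZ s; apply: NNPP => ns.
  by apply: h'; exists Z, g.
have [h' hE] := proj_lift p hP VZ VX s.
have [k [Y [a [r [b [k0 e b1 b2]]]]]] := fitting (g \m h').
have H j : p \m mexp (g \m h') j = p.
  elim: j => [|j IHj]; first exact: mcomp1r.
  by rewrite mexpSr mcompA IHj mcompA.
have sY : summand Y P by apply/summandP; exists a, (b \m r); rewrite -mcompA.
apply: (IH Y (p \m a)); first exact: proj_summand sY hP.
  by apply: (@surj_compl _ _ _ _ _ _ r); rewrite -mcompA e H.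
rewrite ltnS in lt; apply: leq_trans lt; apply: (@inj_proper_dim _ _ _ _ a).
  by apply: (@retr_inj _ _ _ _ _ (b \m r)); rewrite -mcompA.
move=> as_; apply: ns; case: k k0 e {H} => // k _ e.
apply: (@surj_compl _ _ _ _ _ _ (h' \m mexp (g \m h') k)); rewrite mcompA -mexpS -e.
apply: surjm_comp as_ _.
by apply: (@surj_compl _ _ _ _ _ _ (a \m b)); rewrite mcompA b2; apply: surj_mid.
Qed.

Lemma simple_cover S : simple_in V S -> exists P (q : mhom P S),
  [/\ proj P, indecomposable P & surjm q].
Proof.
move=> hS; have [VS S0 _] := hS; have [P [p [hP ps /(essP ps) ep]]] := proj_cover VS.
exists P, p; split=> //; split.
  by move=> /is_zeroP P0; apply: (surj_ne0 ps S0); apply: mhom_eq => v; rewrite (P0 v) !mh0.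
have key X Y : misom P (dsum X Y) -> p <> 0 -> is_zero X \/ is_zero Y.
  move=> /misomP [f [g [e1 e2]]] _.
  have VX : V (dsum X Y) by apply: wide_iso (proj_V hP) => //; apply/misomP; exists f, g.
  have [x0|x0] := classic (p \m (g \m dl X Y) = 0); last first.
    right; have VXX : V X by apply: wide_summand (summand_dl X Y) VX.
    have := ep _ (g \m dl X Y) VXX (simple_surj VXX hS x0) => s.
    have /surjmP s' : surjm (dl X Y).
      have -> : dl X Y = f \m (g \m dl X Y) by rewrite mcompA e2 mcomp1l.
      exact: surjm_comp (retr_surj e2) s.
    apply/is_zeroP => y; have [x xE] := s' (dr X Y y).
    by rewrite -[y]midE -(prdr X Y) mcompE -xE -mcompE prdl mhom0E.
  left; have [y0|y0] := classic (p \m (g \m dr X Y) = 0).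
    case: (surj_ne0 ps S0); have -> : p = p \m g \m f by rewrite -mcompA e1 mcomp1r.
    rewrite [p \m g]copair_eta -!mcompA x0 y0 /copair !mcomp0l addr0; exact: mcomp0l.
  have VY : V Y by apply: wide_summand (summand_dr X Y) VX.
  have := ep _ (g \m dr X Y) VY (simple_surj VY hS y0) => s.
  have /surjmP s' : surjm (dr X Y).
    have -> : dr X Y = f \m (g \m dr X Y) by rewrite mcompA e2 mcomp1l.
    exact: surjm_comp (retr_surj e2) s.
  apply/is_zeroP => y; have [x xE] := s' (dl X Y y).
  by rewrite -[y]midE -(pldl X Y) mcompE -xE -mcompE pldr mhom0E.
by move=> X Y h; apply: key h (surj_ne0 ps S0).
Qed.

Lemma min_pres_exists M : V M -> exists P1 P0 (d : mhom P1 P0) (p : mhom P0 M),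
  min_presentation V d p.
Proof.
move=> VM; have [P0 [p [hP0 ps ep]]] := proj_cover VM.
have [O [w [VO /sexP [wi wE _]]]] := quo_seV ps (proj_V hP0) VM.
have [P1 [c [hP1 cs ec]]] := proj_cover VO.
exists P1, P0, (w \m c), p; split; first split=> //.
  apply/limg_kerP => v; rewrite wE; split=> -[x xE].
    by have [y yE] := (surjmP c).1 cs x; exists y; rewrite mcompE yE.
  by exists (c x); rewrite -mcompE.
split=> // Z g VZ e; apply: ec => //; rewrite (cs : limg c = _).
apply/surjmP => o; have : w o \in limg (w \m c).
  by have [y <-] := (surjmP c).1 cs o; apply/memv_limgP; exists y; rewrite mcompE.
rewrite -e => /memv_limgP [z zE]; exists z; apply: ((injm_inj ((injmP w).2 wi))).
by rewrite -zE !mcompE.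
Qed.

End Enough.
End Wide.
End WideCats.

(** * Minimal presentations, torsion classes and g-vectors *)

Section Presentations.
Context {K : fieldType} {A : falgType K}.
Implicit Types (M N P Q S T X Y Z : fdmod A) (V W U : fdmod A -> Prop).

Definition extends P1 P0 (d : mhom P1 P0) Z := forall f : mhom P1 Z, exists g, g \m d = f.

(** The sequence 0 -> Hom(M, Z) -> Hom(P0, Z) -> Hom(P1, Z) is exact, and [c] is the dimension of
    its last cokernel. For a minimal presentation in V and Z in V this is dim Hom(Z, tau M), the
    Auslander-Reiten formula. *)
Lemma coker_rank P1 P0 M (d : mhom P1 P0) (p : mhom P0 M) Z : surjm p -> limg d = lker p ->
  exists c, (hm P0 Z + c = hm M Z + hm P1 Z)%N /\ (c = 0%N <-> extends d Z).
Proof.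
move=> ps /limg_kerP pE.
pose F := linfun (mcompr d : mhom P0 Z -> mhom P1 Z).
pose G := linfun (mcompr p : mhom M Z -> mhom P0 Z).
have kF : lker F = limg G.
  apply/vspaceP => f; rewrite memv_ker lfunE /=; apply/eqP/memv_imgP.
    move=> e0; have [x|g <-] := @factor_surj _ _ _ _ _ p f ps.
      by move=> /pE [y <-]; rewrite -mcompE [f \m d]e0 mhom0E.
    by exists g; rewrite ?memvf ?lfunE.
  move=> [g _ ->]; rewrite lfunE /=; apply: mhom_eq => v; rewrite /mcompr !mhE.
  by rewrite (pE _).2 ?mh0 //; exists v.
have kG : lker G = 0%VS.
  apply/eqP; rewrite -subv0; apply/subvP => f.
  rewrite memv_ker lfunE memv0 /= => /eqP e0; apply/eqP/(surj_epi ps).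
  by rewrite mcomp0l -e0.
have dG : \dim (limg G) = hm M Z by rewrite limg_dim_eq // capfv.
have le : (\dim (limg F) <= hm P1 Z)%N by apply/dimvS/subvf.
exists (hm P1 Z - \dim (limg F))%N; split.
  have := limg_ker_dim F fullv; rewrite capfv kF dG /hm => <-.
  by rewrite -addnA subnKC.
split=> [/eqP|h].
  rewrite subn_eq0 => le' f; have /eqP eF : limg F == fullv by rewrite eqEdim subvf.
  have := memvf f; rewrite -eF => /memv_imgP [g _ ->]; exists g.
  by rewrite lfunE.
apply/eqP; rewrite subn_eq0; apply/dimvS/subvP => f _.
by have [g <-] := h f; apply/memv_imgP; exists g; rewrite ?memvf ?lfunE.
Qed.

Lemma hm_dsuml P Q Z : hm (dsum P Q) Z = (hm P Z + hm Q Z)%N.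
Proof.
have [_ e qs] := dsum_se P Q.
have [c [cE c0]] := coker_rank Z qs e.
rewrite [RHS]addnC -cE; suff -> : c = 0%N by rewrite addn0.
by apply/c0 => f; exists (f \m pl P Q); rewrite -mcompA pldl mcomp1r.
Qed.

Lemma hm_zerol P Z : is_zero P -> hm P Z = 0%N.
Proof.
move=> /is_zero_mid P0; apply/hom0_dim => f.
by rewrite -[f]mcomp1r P0 mcomp0r.
Qed.

(** Push the sequence out along [f]: a splitting of the resulting extension of [M] by [Y] gives a
    retraction onto [Y], whose restriction to [P0] extends [f]. *)
Lemma ext1_extend O P0 M Y (w : mhom O P0) (p : mhom P0 M) (f : mhom O Y) :
  short_exact w p -> ext1_zero M Y -> exists g, g \m w = f.
Proof.
move=> /sexP [wi wE ps] h.
have [E [c [cs cE]]] := coker_exists (mpair f (- w)).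
have cE' v : c v = 0 <-> exists o, f o = pl Y P0 v /\ - w o = pr Y P0 v.
  rewrite cE; split=> -[o].
    by move=> <-; exists o; rewrite -!mcompE pl_mpair pr_mpair mhomNE.
  move=> [e1 e2]; exists o; rewrite [RHS]dsumE -e1 -e2.
  by rewrite mhomDE !mcompE mhomNE.
have [|q qE] := @factor_surj _ _ _ _ _ c (p \m pr Y P0) cs.
  by move=> x /cE' [o [_ e]]; rewrite mcompE -e mhN (wE _).2 ?oppr0 //; exists o.
have qE' v : q (c v) = p (pr Y P0 v) by rewrite -mcompE qE mcompE.
have se : short_exact (c \m dl Y P0) q.
  apply/sexP; split.
  - move=> v; rewrite mcompE => /cE' [o []]; rewrite !dsE => <- /eqP.
    by rewrite oppr_eq0 => /eqP/wi ->; rewrite mh0.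
  - move=> e; have [v <-] := (surjmP c).1 cs e; rewrite qE'; split.
      move/wE => [o oE]; exists (pl Y P0 v + f o).
      apply/eqP; rewrite mcompE -subr_eq0 -mhB; apply/eqP/cE'; exists o.
      by rewrite !mhB !dsE sub0r addrC addKr oE.
    by move=> [y]; rewrite mcompE => yE; rewrite -qE' -yE qE' dsE mh0.
  - by move=> m; have [x <-] := ps m; exists (c (dr Y P0 x)); rewrite qE' dsE.
have [s sE] := h _ _ _ se; have /sexP [ii iE _] := se.
have [|t tE] := @factor_inj _ _ _ _ _ (c \m dl Y P0) (mid E - s \m q) ((injmP _).2 ii).
  move=> x; apply/iE; rewrite mhomBE midE mhB mcompE -[q (s _)]mcompE sE.
  by rewrite midE subrr.
have ti y : t ((c \m dl Y P0) y) = y.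
  apply: (injm_inj ((injmP (c \m dl Y P0)).2 ii)); rewrite -[LHS]mcompE tE mhomBE midE.
  by rewrite [(s \m q) _]mcompE (iE ((c \m dl Y P0) y)).2 ?mh0 ?subr0 //; exists y.
exists (t \m (c \m dr Y P0)); apply: mhom_eq => o; rewrite !mcompE.
rewrite -[RHS]ti mcompE; congr (t _); apply/eqP; rewrite -subr_eq0 -mhB; apply/eqP/cE'.
by exists (- o); rewrite !mhB !dsE !mhN opprK subr0 sub0r.
Qed.

Lemma ext1_crit P1 P0 M Y (d : mhom P1 P0) (p : mhom P0 M) : surjm p -> limg d = lker p ->
  ext1_zero P0 Y -> extends d Y -> ext1_zero M Y.
Proof.
move=> ps /limg_kerP pE h0 hd E i q se; have [h hE] := ext_lift p h0 se.
have /sexP [ii iE qs] := se.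
have [|f fE] := @factor_inj _ _ _ _ _ i (h \m d) ((injmP i).2 ii).
  by move=> x; apply/iE; rewrite mcompE -mcompE hE; apply/pE; exists x.
have [g gE] := hd f.
have [|s sE] := @factor_surj _ _ _ _ _ p (h - i \m g) ps.
  move=> x /pE [y <-]; rewrite mhomBE -!mcompE -(mcompA i) gE fE; exact: subrr.
exists s; apply: (surj_epi ps); rewrite -mcompA sE mcompBr hE mcompA mcomp1l.
have -> : q \m i = 0 by apply: mhom_eq => v; rewrite !mhE; apply/iE; exists v.
by rewrite mcomp0l subr0.
Qed.

(* By Auslander-Smalo this is the class of Z in V with Hom(Z, tau M) = 0; see perp_tauP. *)
Definition tor V M : fdmod A -> Prop := fun Z =>
  V Z /\ forall Y (q : mhom Z Y), V Y -> surjm q -> ext1_zero M Y.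

Record abcat V : Prop := AbCat { ab_w : wide V; ab_g : exists G, progenerator V G }.

Lemma ess_elem V X Y (f : mhom X Y) : essential_in V f <->
  (forall Z (g : mhom Z X), V Z -> (forall x, exists z, f (g z) = f x) -> surjm g).
Proof.
have E Z (g : mhom Z X) : limg (f \m g) = limg f <-> forall x, exists z, f (g z) = f x.
  split=> [h x|h].
    have : f x \in limg (f \m g) by rewrite h; apply/memv_limgP; exists x.
    by move=> /memv_limgP [z zE]; exists z; rewrite -mcompE.
  apply/vspaceP => w; apply/memv_limgP/memv_limgP => -[z <-].
    by exists (g z); rewrite mcompE.
  by have [y yE] := h z; exists y; rewrite mcompE.
by split=> h Z g VZ e; apply: h => //; apply/E.
Qed.

Section InV.
Variable V : fdmod A -> Prop.
Hypothesis aV : abcat V.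
Let hV := ab_w aV.
Let hG := ab_g aV.
Notation proj := (projective_in V).

Lemma torP M P1 P0 (d : mhom P1 P0) (p : mhom P0 M) Z : min_presentation V d p -> V M ->
  (tor V M Z <-> V Z /\ extends d Z).
Proof.
move=> [[hP1 hP0 ps dE] [ep /ess_elem ed]] VM; have pE := (limg_kerP _ _).1 dE.
split=> -[VZ h]; split=> //; last first.
  move=> Y q VY qs; apply: (ext1_crit ps dE); first exact: (proj_ext hV hP0 VY).
  move=> f; have [f' fE] := proj_lift f hP1 VZ VY qs; have [g gE] := h f'.
  by exists (q \m g); rewrite -mcompA gE fE.
move=> f; have VP1 := proj_V hP1; have VP0 := proj_V hP0.
have [T [k [VT ki kE]]] := ker_V hV d VP1 VP0.
have [I [r [j [VI rs ji e]]]] := img_V hV (f \m k) VT VZ.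
have [Y [c [VY se]]] := sub_seV hV ji VI VZ; have /sexP [_ cE cs] := se.
have [O [de [w [des wi we]]]] := img_exists d.
have [|fb fbE] := @factor_surj _ _ _ _ _ de (c \m f) des.
  move=> x xE; have /kE [s <-] : d x = 0 by rewrite -we mcompE xE mh0.
  by rewrite mcompE; apply/cE; exists (r s); rewrite -mcompE e mcompE.
have [|g0 gE] := @ext1_extend _ _ _ _ w p fb _ (h Y c VY ((surjmP c).2 cs)).
  apply/sexP; split; [exact/injmP | | exact/surjmP].
  move=> v; rewrite pE; split=> -[x <-]; first by exists (de x); rewrite -mcompE we.
  by have [y <-] := (surjmP de).1 des x; exists y; rewrite -mcompE we.
have [h0 hE] := proj_lift g0 hP0 VZ VY ((surjmP c).2 cs).
have [|psi psE] := @factor_inj _ _ _ _ _ j (f - h0 \m d) ji.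
  move=> x; apply/cE; rewrite mhomBE mhB -!mcompE mcompA hE -we mcompA gE fbE.
  exact: subrr.
have pk v : psi (k v) = r v.
  apply: (injm_inj ji); rewrite -mcompE psE mhomBE mcompE.
  by rewrite (kE (k v)).2 ?mh0 ?subr0 -?mcompE ?e //; exists v.
have [B [n [VB ni nE]]] := ker_V hV psi VP1 VI.
(* On the kernel of [d] the difference [psi] already takes all its values, so the kernels of [psi]
   and [d] together span [P1]; essentiality of [d] makes the kernel of [psi] everything. *)
have ns : surjm n.
  apply: ed => // x; have [y yE] := (surjmP r).1 rs (psi x).
  have /nE [b bE] : psi (x - k y) = 0 by rewrite mhB pk yE subrr.
  exists b; rewrite bE mhB (kE (k y)).2 ?subr0 //; by exists y.
exists h0; apply/eqP; rewrite eq_sym -subr_eq0 -psE; apply/eqP; apply: mhom_eq => x.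
by rewrite mcompE (nE x).2 ?mh0 ?mhom0E //; apply: (surjmP n).1.
Qed.

Lemma ess_unique P1 P1' B (d : mhom P1 B) (d' : mhom P1' B) : V B -> proj P1 -> proj P1' ->
  essential_in V d -> essential_in V d' -> limg d = limg d' -> misom P1 P1'.
Proof.
move=> VB h h' ed ed' e.
have key Q Q' (u : mhom Q B) (u' : mhom Q' B) : proj Q -> proj Q' -> essential_in V u' ->
    limg u = limg u' -> exists x : mhom Q Q', surjm x.
  move=> hQ hQ' eu eE; have [I [r [j [VI rs ji je]]]] := img_V hV u' (proj_V hQ') VB.
  have [|s sE] := @factor_inj _ _ _ _ _ j u ji.
    move=> x; have : u x \in limg u' by rewrite -eE; apply/memv_limgP; exists x.
    by move=> /memv_limgP [y yE]; exists (r y); rewrite -mcompE je.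
  have [x xE] := proj_lift s hQ (proj_V hQ') VI rs.
  exists x; apply: eu (proj_V hQ) _.
  by rewrite -je -mcompA xE sE je.
have [x xs] := key _ _ d d' h h' ed' e; have [y ys] := key _ _ d' d h' h ed (esym e).
by exists x; split=> //; apply: sur2_isom xs ys.
Qed.

(** The g-vector of [M], encoded by its pairing with dimension vectors; on [V] it is dim Hom(M, Z) -
    dim Hom(Z, tau M). *)
Definition is_g M (th : fdmod A -> int) := exists P1 P0 (d : mhom P1 P0) (p : mhom P0 M),
  min_presentation V d p /\ forall Z, th Z = (hm P0 Z)%:Z - (hm P1 Z)%:Z.

Lemma is_g_unique M M' th th' : misom M M' -> V M -> V M' -> is_g M th -> is_g M' th' ->
  forall Z, th Z = th' Z.
Proof.
move=> /misomP [f [g [e1 e2]]] VM VM'.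
move=> [P1 [P0 [d [p [[[hP1 hP0 ps dE] [ep ed]] tE]]]]].
move=> [P1' [P0' [d' [p' [[[hP1' hP0' ps' dE'] [ep' ed']] tE']]]]] Z.
have [a aE] := proj_lift (f \m p) hP0 (proj_V hP0') VM' ps'.
have [b bE] := proj_lift (g \m p') hP0' (proj_V hP0) VM ps.
have as_ : surjm a.
  apply: ((essP V ps').1 ep' _ _ (proj_V hP0)); rewrite aE.
  exact: surjm_comp (retr_surj e2) ps.
have bs : surjm b.
  apply: ((essP V ps).1 ep _ _ (proj_V hP0')); rewrite bE.
  exact: surjm_comp (retr_surj e1) ps'.
have ai := sur2_isom as_ bs.
have isoP0 : misom P0 P0' by exists a.
have isoP1 : misom P1 P1'.
  apply: (@ess_unique _ _ _ (a \m d) d') => //; first exact: proj_V hP0'.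
    apply/ess_elem => Y u VY h; move/ess_elem: ed; apply=> // x; have [z zE] := h x.
    by exists z; apply: (injm_inj ai); rewrite -!mcompE mcompE zE.
  rewrite dE'; apply/limg_kerP => w; have pE := (limg_kerP _ _).1 dE.
  have [x xE] := (surjmP a).1 as_ w.
  have -> : p' w = f (p x) by rewrite -xE -!mcompE aE.
  split=> [h|[v vE]].
    have : p x = 0 by rewrite -[p x]midE -e1 mcompE h mh0.
    by move/pE => [v vE]; exists v; rewrite mcompE vE.
  rewrite (pE x).2 ?mh0 //; exists v; apply: (injm_inj ai).
  by rewrite xE -vE mcompE.
by rewrite tE tE' (hm_isol Z isoP0) (hm_isol Z isoP1).
Qed.

Definition theta M := epsilon (inhabits (fun=> 0 : int)) (is_g M).

Lemma thetaP M : V M -> is_g M (theta M).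
Proof.
move=> VM; apply: epsilon_spec.
have [P1 [P0 [d [p h]]]] := min_pres_exists hV hG VM.
by exists (fun Z => (hm P0 Z)%:Z - (hm P1 Z)%:Z), P1, P0, d, p.
Qed.

Lemma theta_pres M P1 P0 (d : mhom P1 P0) (p : mhom P0 M) Z : V M -> min_presentation V d p ->
  theta M Z = (hm P0 Z)%:Z - (hm P1 Z)%:Z.
Proof.
move=> VM h; apply: (@is_g_unique M M _ (fun Z => (hm P0 Z)%:Z - (hm P1 Z)%:Z)) => //.
- exact: misom_refl.
- exact: thetaP.
- by exists P1, P0, d, p.
Qed.

Lemma theta_iso M M' Z : misom M M' -> V M -> theta M Z = theta M' Z.
Proof.
move=> h VM; have VM' := wide_iso hV h VM.
by apply: (is_g_unique h VM VM'); apply: thetaP.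
Qed.

Lemma theta_rank M Z : V M -> exists c, theta M Z = (hm M Z)%:Z - c%:Z /\
  (V Z -> (c = 0%N <-> tor V M Z)).
Proof.
move=> VM; have [P1 [P0 [d [p [h tE]]]]] := thetaP VM.
have [[_ _ ps dE] _] := h; have [c [cE c0]] := coker_rank Z ps dE.
exists c; split=> [|VZ].
  rewrite tE; apply/eqP; rewrite subr_eq addrAC -PoszD -cE PoszD addrK.
  exact: eqxx.
rewrite (torP Z h VM) c0; split=> [|[]] //.
Qed.

Lemma theta_tor M Z : V M -> tor V M Z -> theta M Z = (hm M Z)%:Z.
Proof.
move=> VM tZ; have VZ := proj1 tZ; have [c [-> c0]] := theta_rank Z VM.
by rewrite ((c0 VZ).2 tZ) subr0.
Qed.

Lemma theta_hom0 M Z : V M -> V Z -> hom0 M Z ->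
  theta M Z <= 0 /\ (theta M Z = 0 -> tor V M Z).
Proof.
move=> VM VZ /hom0_dim h; have [c [-> c0]] := theta_rank Z VM; rewrite h sub0r.
split; first by rewrite oppr_le0.
by move=> /eqP; rewrite oppr_eq0 => /eqP [/(c0 VZ).1].
Qed.

(** * Functions of the form [P] - [Q] *)

(* The weights given by the classes of K_0(proj V). *)
Definition gfun (th : fdmod A -> int) := exists P Q, [/\ proj P, proj Q &
  forall Z, th Z = (hm P Z)%:Z - (hm Q Z)%:Z].

Lemma gfun_theta M : V M -> gfun (theta M).
Proof.
by move=> /thetaP [P1 [P0 [d [p [[[h1 h0 _ _] _] tE]]]]]; exists P0, P1.
Qed.

Lemma gfun_proj P : proj P -> gfun (fun Z => (hm P Z)%:Z).
Proof.
move=> hP; exists P, mod0; split=> //; first exact/proj_zero/mod0_zero.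
by move=> Z; rewrite (hm_zerol _ mod0_zero) subr0.
Qed.

Lemma gfunD th th' : gfun th -> gfun th' -> gfun (fun Z => th Z + th' Z).
Proof.
move=> [P [Q [hP hQ e]]] [P' [Q' [hP' hQ' e']]].
exists (dsum P P'), (dsum Q Q'); split; try exact: proj_dsum.
by move=> Z; rewrite !hm_dsuml e e' !PoszD opprD addrACA.
Qed.

Lemma gfunN th : gfun th -> gfun (fun Z => - th Z).
Proof.
by move=> [P [Q [hP hQ e]]]; exists Q, P; split=> // Z; rewrite e opprB.
Qed.

Lemma gfun0 : gfun (fun=> 0).
Proof.
by exists mod0, mod0; split; try exact/proj_zero/mod0_zero; move=> Z; rewrite subrr.
Qed.

Lemma gfunMn th n : gfun th -> gfun (fun Z => th Z *+ n).
Proof.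
move=> h; elim: n => [|n IH].
  have [P [Q [hP hQ e]]] := gfun0; exists P, Q; split=> // Z; rewrite mulr0n; exact: e.
have [P [Q [hP hQ e]]] := gfunD h IH; exists P, Q; split=> // Z; rewrite mulrS; exact: e.
Qed.

Lemma gfunMz th (a : int) : gfun th -> gfun (fun Z => a * th Z).
Proof.
move=> h; case: a => n.
  have [P [Q [hP hQ e]]] := gfunMn n h; exists P, Q; split=> // Z.
  by rewrite -e -[n%:Z]natz mulr_natl.
have [P [Q [hP hQ e]]] := gfunN (gfunMn n.+1 h); exists P, Q; split=> // Z.
by rewrite -e NegzE mulNr -[n.+1%:Z]natz mulr_natl.
Qed.

Lemma gfun_ext th th' : th =1 th' -> gfun th -> gfun th'.
Proof. by move=> e [P [Q [hP hQ h]]]; exists P, Q; split=> // Z; rewrite -e. Qed.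

Definition additive_on (th : fdmod A -> int) :=
  (forall X Y, misom X Y -> th X = th Y) /\
  forall X Y Z (i : mhom X Y) (q : mhom Y Z), V X -> V Y -> V Z -> short_exact i q ->
    th Y = th X + th Z.

Lemma gfun_additive th : gfun th -> additive_on th.
Proof.
move=> [P [Q [hP hQ e]]]; split=> [X Y h|X Y Z i q VX VY VZ se].
  by rewrite !e (hm_isor P h) (hm_isor Q h).
by rewrite !e (proj_hm hV hP VX VY se) (proj_hm hV hQ VX VY se) !PoszD opprD addrACA.
Qed.

Lemma additive0 th X : additive_on th -> is_zero X -> th X = 0.
Proof.
move=> [hi ha] X0; have VX := wide_iszero hV X0.
have se : short_exact (dl X X) (pr X X) := dsum_se X X.
have := ha _ _ _ _ _ VX (wide_dsum hV VX VX) VX se.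
rewrite (hi _ _ (dsum0r X X0)) => /eqP; rewrite -{1}[th X]addr0 (inj_eq (addrI _)).
by move=> /eqP ->.
Qed.

(** The composition multiplicities are chosen before [th]: one choice serves all additive functions
    at once, as the matrix argument of [rank_J] requires. *)
Lemma comp_mult n (L : 'I_n -> fdmod A) X :
  (forall S, simple_in V S -> exists i, misom S (L i)) -> V X ->
  exists m : 'I_n -> nat, forall th, additive_on th -> th X = \sum_i th (L i) *+ m i.
Proof.
move=> hL; have [k] := ubnP (dm X); elim: k X => // k IH X lt VX.
have [X0|X0] := classic (is_zero X).
  exists (fun=> 0%N) => th h; rewrite (additive0 h X0) big1 // => i _; exact: mulr0n.
have [S [q [hS qs]]] := simple_quotient hV VX X0; have [VS S0 _] := hS.
have [T [i [VT se]]] := quo_seV hV qs VX VS.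
have [|m mE] := IH T _ VT.
  rewrite ltnS in lt; apply: leq_trans lt; rewrite (sex_dim se) -[X in (X < _)%N]addn0.
  by rewrite ltn_add2l lt0n; apply/eqP => /dm0.
have [j jE] := hL S hS.
exists (fun i => m i + (i == j))%N => th h.
rewrite (h.2 _ _ _ _ _ VT VX VS se) (mE _ h) (h.1 _ _ jE).
under [RHS]eq_bigr => l _ do rewrite mulrnDr.
rewrite big_split /=; congr (_ + _).
by rewrite (bigD1 j) //= eqxx mulr1n big1 ?addr0 // => l /negPf ->; rewrite mulr0n.
Qed.

(** * Closure properties of [tor] *)

Lemma tor_V M Z : tor V M Z -> V Z. Proof. by case. Qed.

Lemma tor_ext1 M Z : tor V M Z -> ext1_zero M Z.
Proof. by case=> VZ h; apply: (h Z (mid Z)) => //; apply: surj_mid. Qed.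

Lemma tor_quo M Z Y (q : mhom Z Y) : surjm q -> V Y -> tor V M Z -> tor V M Y.
Proof.
by move=> qs VY [VZ h]; split=> // W r VW rs; apply: (h W (r \m q)) => //; apply: surjm_comp.
Qed.

Lemma tor_iso M Z Y : misom Z Y -> tor V M Z -> tor V M Y.
Proof.
move=> h t; have VY := wide_iso hV h (tor_V t).
by case: h => f [_ fs]; apply: tor_quo fs VY t.
Qed.

Lemma tor_ext M X Y Z (i : mhom X Y) (q : mhom Y Z) : V M -> short_exact i q ->
  tor V M X -> tor V M Z -> tor V M Y.
Proof.
move=> VM se; have [P1 [P0 [d [p h]]]] := min_pres_exists hV hG VM.
have [[hP1 hP0 _ _] _] := h.
rewrite !(torP _ h VM) => -[VX hX] [VZ hZ]; have VY := wide_ext hV VX VZ se; split=> // f.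
have [ii /limg_kerP iE qs] := se.
have [g gE] := hZ (q \m f); have [h0 hE] := proj_lift g hP0 VY VZ qs.
have [|f' fE] := @factor_inj _ _ _ _ _ i (f - h0 \m d) ii.
  by move=> x; apply/iE; rewrite mhomBE mhB -!mcompE mcompA hE gE; apply: subrr.
have [g' gE'] := hX f'.
by exists (h0 + i \m g'); rewrite mcompDl -mcompA gE' fE addrC subrK.
Qed.

Lemma tor_zero M Z : is_zero Z -> tor V M Z.
Proof.
move=> Z0; split; first exact: wide_iszero.
move=> Y q VY qs E i r se; have /is_zeroP Y0 : is_zero Y.
  by apply/is_zeroP => y; have [z <-] := (surjmP q).1 qs y; rewrite ((is_zeroP Z).1 Z0 z) mh0.
have [ii /limg_kerP iE rs] := se.
have ri : injm r by apply/injmP => e /iE [y <-]; rewrite (Y0 y) mh0.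
by have [s [_ sE]] := bijm_inv ri rs; exists s.
Qed.

Lemma tor_dsumr M X Y : V M -> tor V M X -> tor V M Y -> tor V M (dsum X Y).
Proof. by move=> VM; apply: tor_ext VM (dsum_se X Y). Qed.

Lemma tor_pw M X m : V M -> tor V M X -> tor V M (pw X m).
Proof.
move=> VM h; elim: m => [|m IH].
  by rewrite /pw big_ord0; apply/tor_zero/mod0_zero.
have -> : pw X m.+1 = dsum X (pw X m) by rewrite /pw big_ord_recl.
exact: tor_dsumr.
Qed.

Lemma tor_gen M X Y : V M -> tor V M X -> gen X Y -> V Y -> tor V M Y.
Proof. by move=> VM t [m [q qs]] VY; exact: (tor_quo qs VY (tor_pw m VM t)). Qed.

Lemma tor_summandr M X Y : summand X Y -> tor V M Y -> tor V M X.
Proof.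
move=> h t; have VX := wide_summand hV h (tor_V t).
by case/summandP: h => s [r e]; apply: tor_quo (retr_surj e) VX t.
Qed.

Lemma tor_summandl M N Z : summand M N -> tor V N Z -> tor V M Z.
Proof.
by move=> h [VZ t]; split=> // Y q VY qs; exact: (ext1_summand h (t Y q VY qs)).
Qed.

Lemma tor_isol M N Z : misom M N -> tor V M Z -> tor V N Z.
Proof. by move=> /misom_sym/summand_iso; apply: tor_summandl. Qed.

Lemma tor_dsuml M N Z : tor V M Z -> tor V N Z -> tor V (dsum M N) Z.
Proof.
move=> [VZ t] [_ t']; split=> // Y q VY qs.
by apply: ext1_dsum; [apply: t qs | apply: t' qs].
Qed.

Lemma tor_pwl M m Z : tor V M Z -> tor V (pw M m) Z.
Proof. by move=> [VZ t]; split=> // Y q VY qs; apply/ext1_pw/(t Y q). Qed.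

Lemma tor_zerol M Z : is_zero M -> V Z -> tor V M Z.
Proof. by move=> M0 VZ; split=> // Y q VY qs; apply: ext1_zerol. Qed.

Lemma tor_proj P Z : proj P -> V Z -> tor V P Z.
Proof. by move=> hP VZ; split=> // Y q VY qs; exact: (proj_ext hV hP VY). Qed.

(** * Decomposition of presentations *)

(** Restricted to the part of [Z] that [f'] sends to zero, the first component of [g] still covers
    [X], as [f] is essential. This allows first components to be corrected, so the part with zero
    first component covers [X'], and the two parts together cover the sum. *)
Lemma ess_dsum X Y X' Y' (f : mhom X Y) (f' : mhom X' Y') : V X -> V X' -> V Y -> V Y' ->
  essential_in V f -> essential_in V f' ->
  essential_in V (mpair (f \m pl X X') (f' \m pr X X')).
Proof.
move=> VX VX' VY VY' /ess_elem ef /ess_elem ef'; apply/ess_elem => Z g VZ h.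
set F := mpair _ _ in h.
have FE w : F w = dl _ _ (f (pl _ _ w)) + dr _ _ (f' (pr _ _ w)).
  by rewrite mhomDE !mcompE.
have h' x x' : exists z, f (pl _ _ (g z)) = f x /\ f' (pr _ _ (g z)) = f' x'.
  have [z zE] := h (dl _ _ x + dr _ _ x'); exists z.
  have e1 := congr1 (pl Y Y') zE; have e2 := congr1 (pr Y Y') zE.
  move: e1 e2; rewrite !FE !mhD !dsE !addr0 !add0r !mh0 !addr0 !add0r.
  by move=> -> ->.
have [N1 [n1 [VN1 _ nE1]]] := ker_V hV (f' \m (pr _ _ \m g)) VZ VY'.
have [N2 [n2 [VN2 _ nE2]]] := ker_V hV (pl _ _ \m g) VZ VX.
have s1 : surjm (pl _ _ \m g \m n1).
  apply: ef => // x; have [z [e1 e2]] := h' x 0.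
  have /nE1 [y yE] : (f' \m (pr X X' \m g)) z = 0 by rewrite !mcompE e2 mh0.
  by exists y; rewrite !mcompE yE.
have s2 : surjm (pr _ _ \m g \m n2).
  apply: ef' => // x'; have [z [e1 e2]] := h' 0 x'.
  rewrite mh0 in e1.
  have [y yE] := (surjmP _).1 s1 (pl _ _ (g z)); rewrite !mcompE in yE.
  have /nE2 [u uE] : (pl X X' \m g) (z - n1 y) = 0 by rewrite mhB !mcompE yE subrr.
  exists u; rewrite !mcompE uE !mhB -[f' (pr _ _ (g (n1 y)))]mcompE.
  have : (f' \m (pr X X' \m g)) (n1 y) = 0 by apply/nE1; exists y.
  by rewrite !mcompE => ->; rewrite subr0.
apply/surjmP => w; have [y yE] := (surjmP _).1 s1 (pl _ _ w); rewrite !mcompE in yE.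
have [u uE] := (surjmP _).1 s2 (pr _ _ w - pr _ _ (g (n1 y))); rewrite !mcompE in uE.
have u0 : pl _ _ (g (n2 u)) = 0 by rewrite -mcompE; apply/nE2; exists u.
exists (n1 y + n2 u); rewrite [LHS]dsumE [RHS]dsumE !mhD yE uE u0 mh0 addr0.
by congr (_ + _); rewrite -mhD addrC subrK.
Qed.

Lemma theta_dsum M N Z : V M -> V N -> theta (dsum M N) Z = theta M Z + theta N Z.
Proof.
move=> VM VN.
have [P1 [P0 [d [p [[[hP1 hP0 ps dE] [ep ed]] tE]]]]] := thetaP VM.
have [P1' [P0' [d' [p' [[[hP1' hP0' ps' dE'] [ep' ed']] tE']]]]] := thetaP VN.
rewrite (@theta_pres _ _ _ (mpair (d \m pl _ _) (d' \m pr _ _))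
   (mpair (p \m pl _ _) (p' \m pr _ _))).
- by rewrite !hm_dsuml tE tE' !PoszD opprD addrACA.
- exact: wide_dsum.
have V1 := proj_V hP1; have V0 := proj_V hP0; have V1' := proj_V hP1'; have V0' := proj_V hP0'.
split; last by split; apply: ess_dsum.
split; try exact: proj_dsum.
  apply/surjmP => w; have [x xE] := (surjmP p).1 ps (pl _ _ w).
  have [x' xE'] := (surjmP p').1 ps' (pr _ _ w); exists (dl _ _ x + dr _ _ x').
  rewrite mhomDE !mcompE !(mhD, dsE, mh0, addr0, add0r) xE xE'; exact/esym/dsumE.
have pE := (limg_kerP _ _).1 dE; have pE' := (limg_kerP _ _).1 dE'.
apply/limg_kerP => w; rewrite mhomDE !mcompE; split=> [h|[v <-]].
  have := congr1 (pl _ _) h; rewrite !(mhD, dsE, mh0, addr0, add0r) => /pE [x xE].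
  have := congr1 (pr _ _) h; rewrite !(mhD, dsE, mh0, addr0, add0r) => /pE' [x' xE'].
  exists (dl _ _ x + dr _ _ x').
  rewrite mhomDE !mcompE !(mhD, dsE, mh0, addr0, add0r) xE xE'; exact/esym/dsumE.
rewrite mhomDE !mcompE !(mhD, dsE, mh0, addr0, add0r).
by rewrite (pE _).2 ?(pE' _).2 ?mh0 ?addr0 //; [exists (pr _ _ v) | exists (pl _ _ v)].
Qed.

Lemma theta_proj P Z : proj P -> theta P Z = (hm P Z)%:Z.
Proof.
move=> hP; rewrite (@theta_pres P mod0 P 0 (mid P) Z (proj_V hP)).
  by rewrite (hm_zerol _ mod0_zero) subr0.
have p0 := proj_zero hV mod0_zero; split; first split=> //; first exact: surj_mid.
  apply/limg_kerP => w; rewrite midE; split=> [->|[v <-]]; last exact: mhom0E.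
  by exists 0; rewrite mh0.
split; apply/ess_elem => Y g VY h.
  by apply/surjmP => w; have [z] := h w; rewrite !midE => <-; exists z.
apply/surjmP => w; exists 0; rewrite mh0; apply/esym.
exact: ((is_zeroP mod0).1 mod0_zero).
Qed.

Lemma theta_zero M Z : is_zero M -> theta M Z = 0.
Proof.
by move=> M0; rewrite theta_proj ?hm_zerol //; apply: proj_zero.
Qed.

Lemma split_ker P Q (a : mhom P Q) : proj P -> proj Q -> surjm a ->
  exists R (i : mhom R P) (r : mhom P R) (s : mhom Q P), [/\ proj R, r \m i = mid R,
   a \m s = mid Q, a \m i = 0 & i \m r + s \m a = mid P].
Proof.
move=> hP hQ as_; have [s sE] := proj_split hQ (proj_V hP) as_.
have [R [i [VR ii iE]]] := ker_V hV a (proj_V hP) (proj_V hQ).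
have [|r rE] := @factor_inj _ _ _ _ _ i (mid P - s \m a) ii.
  move=> x; apply/iE; rewrite mhomBE mhB midE -[a ((s \m a) x)]mcompE mcompA sE mcomp1l.
  exact: subrr.
have ai : a \m i = 0 by apply: mhom_eq => v; rewrite !mhE; apply/iE; exists v.
have ri : r \m i = mid R.
  by apply: (inj_mono ii); rewrite mcompA rE mcompBl -mcompA ai mcomp0r subr0 mcomp1l mcomp1r.
exists R, i, r, s; split=> //; last by rewrite rE subrK.
by apply: (proj_summand hV _ hP); apply/summandP; exists i, r.
Qed.

Lemma split_hm P Q R (a : mhom P Q) (i : mhom R P) (r : mhom P R) (s : mhom Q P) Z :
  r \m i = mid R -> a \m s = mid Q -> a \m i = 0 -> i \m r + s \m a = mid P ->
  hm P Z = (hm Q Z + hm R Z)%N.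
Proof.
move=> e1 e2 e3 e4; have qs := retr_surj e2.
have ex : limg i = lker a.
  apply/limg_kerP => w; split=> [h|[v <-]]; last by rewrite -mcompE e3 mhom0E.
  by exists (r w); rewrite -[RHS]midE -e4 mhomDE !mcompE h mh0 addr0.
have [c [cE c0]] := coker_rank Z qs ex.
rewrite -cE (c0.2 _) ?addn0 // => f; exists (f \m r).
by rewrite -mcompA e1 mcomp1r.
Qed.

(* Q is what remains after splitting a minimal presentation and a trivial complex off the given one. *)
Lemma theta_nonmin P1 P0 M (d : mhom P1 P0) (p : mhom P0 M) : V M -> proj P1 -> proj P0 ->
  surjm p -> limg d = lker p -> exists Q, [/\ proj Q,
    forall Z, (hm P0 Z)%:Z - (hm P1 Z)%:Z = theta M Z - (hm Q Z)%:Z,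
    forall Z, extends d Z -> hom0 Q Z
    & exists (i : mhom Q P1) (r : mhom P1 Q), r \m i = mid Q /\ d \m i = 0].
Proof.
move=> VM h1 h0 ps dE; have pE := (limg_kerP _ _).1 dE.
have [M1 [M0 [e [m [[[k1 k0 ms eE] [em ee]] tE]]]]] := thetaP VM.
have mE := (limg_kerP _ _).1 eE.
have [a aE] := proj_lift p h0 (proj_V k0) VM ms.
have as_ : surjm a by apply: ((essP V ms).1 em _ _ (proj_V h0)); rewrite aE.
have [R [i [r [s [hR ri sE ai id0]]]]] := split_ker h0 k0 as_.
(* The complement [R] is killed by [p], so it lies in the image of [d] and also splits off [P1]:
   this is the trivial complex [R -> R]. What is left of [P1] is [P']. *)
have rds : surjm (r \m d).
  apply/surjmP => x; have /pE [y yE] : p (i x) = 0.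
    by rewrite -aE -mcompE -mcompA ai mcomp0r mhom0E.
  by exists y; rewrite mcompE yE -mcompE ri midE.
have [P' [i1 [r1 [s1 [hP' r1i1 rs1 ri1 id1]]]]] := split_ker h1 hR rds.
have me : m \m e = 0 by apply: mhom_eq => v; rewrite !mhE; apply/mE; exists v.
have pd : p \m d = 0 by apply: mhom_eq => v; rewrite !mhE; apply/pE; exists v.
have [O [de [w [des wi we]]]] := img_exists e.
have VO : V O by apply: (wide_img hV des wi); [apply: proj_V k1 | apply: proj_V k0].
have [|u uE] := @factor_inj _ _ _ _ _ w (a \m d \m i1) wi.
  move=> x; have /mE [y yE] : m ((a \m d \m i1) x) = 0.
    by rewrite -mcompE !mcompA aE pd mcomp0l mhom0E.
  by exists (de y); rewrite -mcompE we.
have [b bE] := proj_lift u hP' (proj_V k1) VO des.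
have eb : e \m b = a \m d \m i1 by rewrite -we -mcompA bE uE.
(* By minimality of [e] it is enough to reach [e x]: move it to [P0] by the section [s], lift it
   along [d], and drop the component along [R], which is zero. The kernel of [b] will be [Q]. *)
have bs : surjm b.
  move/ess_elem: ee; apply=> [|x]; first exact: proj_V hP'.
  have aE' v : m (a v) = p v by rewrite -mcompE aE.
  have sE' v : a (s v) = v by rewrite -mcompE sE midE.
  have id0' v : i (r v) + s (a v) = v by rewrite -!mcompE -mhomDE id0 midE.
  have id1' v : i1 (r1 v) + s1 (r (d v)) = v.
    by have := congr1 (fun h : mhom _ _ => h v) id1; rewrite mhomDE !mcompE midE.
  have rs0 v : r (s v) = 0.
    have : i (r (s v)) = 0 by apply: (addIr (s v)); rewrite add0r -{2}(sE' v) id0'.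
    by move=> /(congr1 r); rewrite -[LHS]mcompE ri midE mh0.
  have /pE [y yE] : p (s (e x)) = 0 by rewrite -aE' sE'; apply/mE; exists x.
  exists (r1 y); rewrite -[LHS]mcompE eb !mcompE.
  by have := id1' y; rewrite yE rs0 mh0 addr0 => ->; rewrite yE sE'.
have [Q [j [t [s2 [hQ tj bs2 bj id2]]]]] := split_ker hP' k1 bs.
have dij : d \m (i1 \m j) = 0.
  have ad v : a (d (i1 (j v))) = 0.
    have := congr1 (fun h : mhom _ _ => h (j v)) eb; rewrite !mcompE => <-.
    by rewrite -[b (j v)]mcompE bj mhom0E mh0.
  have rd v : r (d (i1 (j v))) = 0.
    by have := congr1 (fun h : mhom _ _ => h (j v)) ri1; rewrite !mcompE mhom0E.
  apply: mhom_eq => v; rewrite !mcompE mhom0E -[LHS]midE -id0 mhomDE !mcompE.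
  by rewrite ad rd !mh0 addr0.
have tij : (t \m r1) \m (i1 \m j) = mid Q by rewrite -mcompA (mcompA r1) r1i1 mcomp1l.
exists Q; split=> //.
- move=> Z; rewrite tE (split_hm Z ri sE ai id0) (split_hm Z r1i1 rs1 ri1 id1).
  rewrite (split_hm Z tj bs2 bj id2) !PoszD; ring.
- move=> Z hZ f; have [g gE] := hZ (f \m (t \m r1)).
  by rewrite -[f]mcomp1r -tij mcompA -gE -mcompA dij mcomp0r.
- by exists (i1 \m j), (t \m r1).
Qed.

End InV.
End Presentations.

(** * The Auslander-Reiten translate and its torsion class *)

Section Translate.
Context {K : fieldType} {A : falgType K}.
Implicit Types (M N P Q S T X Y Z : fdmod A).
Variable V : fdmod A -> Prop.
Hypothesis aV : abcat V.
Let hV := ab_w aV.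
Let hG := ab_g aV.
Notation proj := (projective_in V).

Lemma functional_sep (E : vectType K) (I : {vspace E}) w : w \notin I ->
  exists b : dual E, (forall x, x \in I -> b x = 0) /\ b w != 0.
Proof.
move=> wI; pose f := (\1 - projv I)%VF.
have fw : f w != 0.
  rewrite add_lfunE opp_lfunE id_lfunE subr_eq0; apply: contraNneq wI => ->.
  exact: memv_proj.
pose X := vbasis {: E}.
have [i ni] : exists i, coord X i (f w) != 0.
  apply: NNPP => h; move/eqP: fw; apply; rewrite (coord_vbasis (memvf (f w))).
  apply: big1 => i _; have [->|ne] := eqVneq (coord X i (f w)) 0; first by rewrite scale0r.
  by case: h; exists i.
have lin : linear (fun x => coord X i (f x) : K^o) by move=> k u v; rewrite !linearP.
pose bL : {linear E -> K^o} := HB.pack (fun x => coord X i (f x) : K^o)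
  (GRing.isLinear.Build K E K^o _ _ lin).
exists (linfun bL); split=> [x xI|]; rewrite lfunE //=.
by rewrite add_lfunE opp_lfunE id_lfunE projv_id // subrr linear0.
Qed.

Section Pairing.
Variables (M N P1 P0 G : fdmod A) (d : mhom P1 P0) (p : mhom P0 M).
Variable th : 'Hom(mhom G N, dual (mhom P1 G)).
Hypotheses (hd : min_presentation V d p) (hp : progenerator V G).
Hypothesis th0 : lker th = 0%VS.
Hypothesis thE : forall xi : dual (mhom P1 G),
  (exists g, th g = xi) <-> (forall v : mhom P0 G, xi (mcomp v d) = 0).
Hypothesis thM : forall (g : mhom G N) (e : mhom G G) (u : mhom P1 G),
  th (mcomp g e) u = th g (mcomp e u).

Let hP1 : proj P1. Proof. by case: hd => -[]. Qed.
Let hP0 : proj P0. Proof. by case: hd => -[]. Qed.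
Let VG : V G. Proof. by case: hp => /proj_V. Qed.

Lemma th_inj g : (forall u, th g u = 0) -> g = 0.
Proof.
move=> h; have /eqP/lker0P ti := th0; apply: ti; rewrite linear0.
by apply/lfunP => u; rewrite zero_lfunE.
Qed.

Lemma gen_cover Z : V Z -> exists b (q : mhom (pw G b) Z), surjm q.
Proof. by move=> VZ; case: hp => _ /(_ _ VZ)/genP. Qed.

(** [th] extends to a pairing of Hom(Z, N) with Hom(P1, Z) by writing a map [P1 -> Z] as a sum of
    [g i \m u i]. Two such expressions agree because a relation lifts to the kernel of a cover [q]
    of their span and, [P1] being projective, to a power of [G], where [thM] moves endomorphisms of
    [G] across. *)
Lemma pairing_wd Z (h : mhom Z N) m (g : 'I_m -> mhom G Z) (u : 'I_m -> mhom P1 G) : V Z ->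
  \sum_i (g i \m u i) = 0 -> \sum_i th (h \m g i) (u i) = 0.
Proof.
move=> VZ e; have [ins [prs [h1 h2]]] := pwP G m.
pose q := \sum_i (g i \m prs i); pose w := \sum_i (ins i \m u i).
have prw i : prs i \m w = u i.
  rewrite mcomp_sumr (bigD1 i) //= mcompA h1 eqxx mcomp1l big1 ?addr0 // => j ji.
  by rewrite mcompA h1 (negPf ji) mcomp0l.
have qw : q \m w = 0.
  by rewrite mcomp_suml -[RHS]e; apply: eq_bigr => i _; rewrite -mcompA prw.
have [T [k [VT ki kE]]] := ker_V hV q (wide_pw hV m VG) VZ.
have [|w' wE] := @factor_inj _ _ _ _ _ k w ki.
  by move=> x; apply/kE; rewrite -mcompE qw mhom0E.
have [l [c cs]] := gen_cover VT.
have [v vE] := proj_lift w' hP1 (wide_pw hV l VG) VT cs.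
have [ins' [prs' [h1' h2']]] := pwP G l.
pose ee i j := prs i \m k \m c \m ins' j; pose vv j := prs' j \m v.
have uE i : u i = \sum_j (ee i j \m vv j).
  rewrite /ee /vv; under eq_bigr => j _ do rewrite -mcompA (mcompA (ins' j)).
  by rewrite -mcomp_sumr -mcomp_suml h2' mcomp1l -prw -wE -vE !mcompA.
have gE j : \sum_i (g i \m ee i j) = 0.
  rewrite (_ : \sum_i _ = q \m k \m c \m ins' j).
    have -> : q \m k = 0 by apply: mhom_eq => x; rewrite mcompE mhom0E; apply/kE; exists x.
    by rewrite !mcomp0l.
  by rewrite !mcomp_suml; apply: eq_bigr => i _; rewrite !mcompA.
under eq_bigr => i _ do rewrite uE linear_sum /=.
rewrite exchange_big big1 // => j _.
under eq_bigr => i _ do rewrite -thM -mcompA.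
by rewrite -sum_lfunE -linear_sum -mcomp_sumr gE mcomp0r linear0 zero_lfunE.
Qed.

Lemma hom0_of_extends Z : V Z -> extends d Z -> hom0 Z N.
Proof.
move=> VZ hZ h; have [b [q qs]] := gen_cover VZ.
apply: (surj_epi qs); rewrite mcomp0l; apply: pw_hom_out => g.
rewrite mcomp0l -mcompA; apply: th_inj => u.
have [w' wE] := hZ (q \m g \m u).
have [w wE'] := proj_lift w' hP0 (wide_pw hV b VG) VZ qs.
have [ins [prs [h1 h2]]] := pwP G b.
(* Index zero carries the map [q \m g \m u]; the others carry the negative of its factorisation
   through [d], on which [th] vanishes by [thE]. The pairing of the zero sum isolates the first
   term. *)
pose gg (i : 'I_b.+1) := if unlift ord0 i is Some j then q \m ins j else q \m g.
pose uu (i : 'I_b.+1) := if unlift ord0 i is Some j then - (prs j \m w \m d) else u.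
have e : \sum_i (gg i \m uu i) = 0.
  rewrite big_ord_recl /gg /uu unlift_none.
  under eq_bigr => j _ do rewrite liftK mcompNr -!mcompA (mcompA (ins j)).
  rewrite sumrN -mcomp_sumr -mcomp_suml h2 mcomp1l mcompA wE' wE; exact: subrr.
have := pairing_wd h VZ e; rewrite big_ord_recl big1 /gg /uu ?unlift_none ?addr0 // => j _.
rewrite liftK linearN /=; apply/eqP; rewrite oppr_eq0; apply/eqP.
by apply: (thE _).1; exists (h \m (q \m ins j)).
Qed.

(** A map [f] that does not extend is detected by a functional [b] vanishing on the image of Hom(d,
    Z). Through [thE], [b] turns maps [G -> Z] into maps [G -> N], compatibly with relations, hence
    gives a map [Z -> N]. As this map is zero, so is [b f]. *)
Lemma extends_of_hom0 Z : V Z -> hom0 Z N -> extends d Z.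
Proof.
move=> VZ hZ f; pose F := linfun (mcompr d : mhom P0 Z -> mhom P1 Z).
have [/memv_imgP [g _ ->]|/functional_sep [b [bI bf]]] := boolP (f \in limg F).
  by exists g; rewrite lfunE.
have [m [q qs]] := gen_cover VZ; have [ins [prs [h1 h2]]] := pwP G m.
have H (g : mhom G Z) : exists n : mhom G N, forall u : mhom P1 G, th n u = b (g \m u).
  pose xi : dual (mhom P1 G) := (b \o linfun (mcomp g))%VF.
  have [|n nE] := (thE xi).2.
    move=> v; rewrite comp_lfunE lfunE /= mcompA; apply: bI.
    by apply/memv_imgP; exists (g \m v); rewrite ?memvf ?lfunE.
  by exists n => u; rewrite nE comp_lfunE lfunE.
have [n nE] := choice _ (fun i : 'I_m => H (q \m ins i)).
have [T [k [VT ki kE]]] := ker_V hV q (wide_pw hV m VG) VZ.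
have [l [c cs]] := gen_cover VT.
pose nn := \sum_i (n i \m prs i).
have nk : nn \m k = 0.
  apply: (surj_epi cs); rewrite mcomp0l; apply: pw_hom_out => g; rewrite mcomp0l.
  apply: th_inj => u; rewrite !mcomp_suml linear_sum sum_lfunE.
  under eq_bigr => i _ do rewrite -!mcompA thM nE.
  rewrite -linear_sum /=.
  under eq_bigr => i _ do rewrite -!mcompA (mcompA (ins i)).
  rewrite -mcomp_sumr -mcomp_suml h2 mcomp1l !mcompA.
  have -> : q \m k = 0 by apply: mhom_eq => x; rewrite mcompE mhom0E; apply/kE; exists x.
  by rewrite !mcomp0l linear0.
have [|h hE] := @factor_surj _ _ _ _ _ q nn qs.
  by move=> x /kE [y <-]; rewrite -mcompE nk mhom0E.
have n0 i : n i = 0.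
  have <- : nn \m ins i = n i.
    rewrite mcomp_suml (bigD1 i) //= -mcompA h1 eqxx mcomp1r big1 ?addr0 // => j ji.
    by rewrite -mcompA h1 eq_sym (negPf ji) mcomp0r.
  by rewrite -hE (hZ h) !mcomp0l.
have [w wE] := proj_lift f hP1 (wide_pw hV m VG) VZ qs.
case/negP: bf; apply/eqP; rewrite -wE -[w]mcomp1l -h2 mcomp_suml mcomp_sumr linear_sum /=.
apply: big1 => i _; rewrite -mcompA mcompA.
by rewrite -nE n0 linear0 zero_lfunE.
Qed.

End Pairing.

Lemma tau_tor M N Z : V M -> V Z -> is_tau V M N -> (hom0 Z N <-> tor V M Z).
Proof.
move=> VM VZ [VN [P1 [P0 [G [d [p [th [hd hp th0 thE thM]]]]]]]].
rewrite (torP aV Z hd VM); split=> [h|[_ h]].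
  by split=> //; exact: (extends_of_hom0 hd hp th0 thE thM VZ h).
exact: (hom0_of_extends hd hp th0 thE thM VZ h).
Qed.

(** [Y] is the End(G)-module that Hom(G, N) has to be. A [K]-basis of [Y] gives generators, encoded
    in the evaluation [Tf'] on Hom(G, G^b), and a basis of the kernel [R] of this evaluation gives
    relations; [N] is the cokernel of the corresponding map G^a -> G^b. *)
Lemma tau_exists M : V M -> exists N, is_tau V M N.
Proof.
move=> VM; have [P1 [P0 [d [p hd]]]] := min_pres_exists hV hG VM.
have [G hp] := hG; have [hPG _] := hp; have VG := proj_V hPG.
pose F := linfun (mcompr d : mhom P0 G -> mhom P1 G).
have rlin : linear (fun xi : dual (mhom P1 G) => (xi \o F)%VF).
  by move=> k x y; rewrite comp_lfunDl -comp_lfunZl.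
pose rL : {linear dual (mhom P1 G) -> 'Hom(mhom P0 G, K^o)} :=
  HB.pack (fun xi : dual (mhom P1 G) => (xi \o F)%VF) (GRing.isLinear.Build K _ _ _ _ rlin).
pose Y := lker (linfun rL).
have YE xi : xi \in Y <-> forall v : mhom P0 G, xi (v \m d) = 0.
  rewrite memv_ker lfunE /=; split=> [/eqP e v|h].
    by have := congr1 (fun f => fun_of_lfun f v) e; rewrite comp_lfunE lfunE zero_lfunE.
  by apply/eqP/lfunP => v; rewrite comp_lfunE lfunE zero_lfunE; apply: h.
pose b := \dim Y; pose xi (i : 'I_b) := (vbasis Y)`_i.
have xiY i : xi i \in Y by apply: vbasis_mem; apply: mem_nth; rewrite size_tuple.
have [ins [prs [h1 h2]]] := pwP G b.
pose Tf' (x : mhom G (pw G b)) : dual (mhom P1 G) :=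
  \sum_i (xi i \o linfun (mcomp (prs i \m x)))%VF.
have TE x u : Tf' x u = \sum_i xi i (prs i \m x \m u).
  by rewrite sum_lfunE; apply: eq_bigr => i _; rewrite comp_lfunE lfunE.
have Tlin : linear Tf'.
  move=> k x y; apply/lfunP => u; rewrite add_lfunE scale_lfunE !TE scaler_sumr -big_split.
  apply: eq_bigr => i _ /=.
  by rewrite mcompDr mcompZr mcompDl mcompZl linearP.
pose TL : {linear mhom G (pw G b) -> dual (mhom P1 G)} :=
  HB.pack Tf' (GRing.isLinear.Build K _ _ _ _ Tlin).
pose R := lker (linfun TL).
pose a := \dim R; pose r (l : 'I_a) := (vbasis R)`_l.
have rR l : Tf' (r l) = 0.
  have : r l \in R by apply: vbasis_mem; apply: mem_nth; rewrite size_tuple.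
  by rewrite memv_ker lfunE => /eqP.
have [ins' [prs' [h1' h2']]] := pwP G a.
pose rr := \sum_l ((r l : mhom G (pw G b)) \m prs' l).
have rri l : rr \m ins' l = r l.
  rewrite mcomp_suml (bigD1 l) //= -mcompA h1' eqxx mcomp1r big1 ?addr0 // => j ji.
  by rewrite -mcompA h1' eq_sym (negPf ji) mcomp0r.
have [N [c [VN cs cE]]] := coker_V hV rr (wide_pw hV a VG) (wide_pw hV b VG).
have c0 x : c \m x = 0 <-> Tf' x = 0.
  split=> [e|e].
    have [I [s [j [VI ss ji je]]]] := img_V hV rr (wide_pw hV a VG) (wide_pw hV b VG).
    have [|x' xE] := @factor_inj _ _ _ _ _ j x ji.
      move=> v; have /cE [y yE] : c (x v) = 0 by rewrite -mcompE e mhom0E.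
      by exists (s y); rewrite -mcompE je.
    have [y yE] := proj_lift x' hPG (wide_pw hV a VG) VI ss.
    have xE' : x = \sum_l (r l : mhom G (pw G b)) \m (prs' l \m y).
      by rewrite -xE -yE mcompA je mcomp_suml; apply: eq_bigr => l _; rewrite mcompA.
    apply/lfunP => u; rewrite TE zero_lfunE xE'.
    under eq_bigr => i _ do rewrite mcomp_sumr mcomp_suml linear_sum /=.
    rewrite exchange_big big1 // => l _.
    have := congr1 (fun f => fun_of_lfun f (prs' l \m y \m u)) (rR l).
    rewrite zero_lfunE TE => E0; rewrite -[RHS]E0; apply: eq_bigr => i _.
    by rewrite !mcompA.
  have : x \in R by rewrite memv_ker lfunE /= e.
  move=> /coord_vbasis ->; rewrite mcomp_sumr; apply: big1 => l _.
  rewrite mcompZr (_ : c \m _ = 0) ?scaler0 //.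
  rewrite -[_`_l]/(r l) -rri mcompA (_ : c \m rr = 0) ?mcomp0l //.
  by apply: mhom_eq => v; rewrite mcompE mhom0E; apply/cE; exists v.
pose L := linfun (mcomp c : mhom G (pw G b) -> mhom G N).
pose th := (linfun TL \o L^-1)%VF.
have Ls (g : mhom G N) : exists x, c \m x = g.
  exact: proj_lift hPG (wide_pw hV b VG) VN cs.
have thc x : th (c \m x) = Tf' x.
  rewrite comp_lfunE lfunE /=; apply/eqP; rewrite -subr_eq0.
  rewrite -(linearB TL); apply/eqP/c0; rewrite mcompBr.
  have -> : c \m (L^-1)%VF (c \m x) = L (L^-1%VF (L x)) by rewrite !lfunE.
  rewrite limg_lfunVK ?memv_img ?memvf // lfunE /=; exact: subrr.
exists N; split=> //; exists P1, P0, G, d, p, th; split=> //.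
- apply/eqP; rewrite -subv0; apply/subvP => g; have [x <-] := Ls g.
  by rewrite memv_ker thc memv0 => /eqP/c0 ->.
- move=> z; split=> [[g <-] v|h].
    have [x <-] := Ls g; rewrite thc TE; apply: big1 => i _.
    by rewrite mcompA; apply: (YE (xi i)).1.
  have /coord_vbasis zE : z \in Y by apply/YE.
  exists (c \m \sum_i (coord (vbasis Y) i z *: ins i)); rewrite thc.
  apply/lfunP => u; rewrite TE {2}zE sum_lfunE; apply: eq_bigr => i _.
  rewrite scale_lfunE mcomp_sumr (bigD1 i) //= mcompZr h1 eqxx big1 => [|j ji].
    by rewrite addr0 mcompZl mcomp1l linearZ.
  by rewrite mcompZr h1 (negPf ji) scaler0.
- move=> g e u; have [x <-] := Ls g; rewrite -mcompA !thc !TE.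
  by apply: eq_bigr => i _; rewrite !mcompA.
Qed.

Lemma perp_tauP M Z : V M -> (perp_tau V M Z <-> tor V M Z).
Proof.
move=> VM; split=> [[VZ [N [hN h0]]]|t]; first by apply: (tau_tor VM VZ hN).1.
have VZ := tor_V t; split=> //; have [N hN] := tau_exists VM; exists N; split=> //.
exact: (tau_tor VM VZ hN).2.
Qed.

Lemma tau_rigidP M : tau_rigid V M <-> tor V M M.
Proof.
split=> [[VM [N [hN h0]]]|t]; first by apply: (tau_tor VM VM hN).1.
have VM := tor_V t; split=> //; have [N hN] := tau_exists VM; exists N; split=> //.
exact: (tau_tor VM VM hN).2.
Qed.

End Translate.

(** * Perpendicular categories and their projectives *)

Section Reduction.
Context {K : fieldType} {A : falgType K}.
Implicit Types (M N P Q S T X Y Z B C E R G : fdmod A).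
Variable V : fdmod A -> Prop.
Hypothesis aV : abcat V.
Let hV := ab_w aV.
Let hG := ab_g aV.
Notation proj := (projective_in V).
Notation rig M := (tor V M M).

Lemma JP M Z : V M -> (J V M Z <-> tor V M Z /\ hom0 M Z).
Proof.
move=> VM; rewrite -(perp_tauP aV Z VM); split=> [[h1 h2 _]|[h1 h2]]; split=> //.
by apply/hom0_dim/hm_zerol/mod0_zero.
Qed.

Lemma JpairP M P Z : V M -> (Jpair V M P Z <-> [/\ tor V M Z, hom0 M Z & hom0 P Z]).
Proof. by move=> VM; have e := perp_tauP aV Z VM; split=> -[? ? ?]; split=> //; apply/e. Qed.

Lemma J_V M Z : V M -> J V M Z -> V Z.
Proof. by move=> VM /(JP _ VM) [/tor_V]. Qed.

Lemma im_lift X P1 P0 M (d : mhom P1 P0) (p : mhom P0 M) (f : mhom X P0) : proj X -> V P1 -> V P0 ->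
  limg d = lker p -> p \m f = 0 -> exists g, d \m g = f.
Proof.
move=> hX V1 V0 /limg_kerP pE e; have [I [s [j [VI ss ji je]]]] := img_V hV d V1 V0.
have [|x xE] := @factor_inj _ _ _ _ _ j f ji.
  move=> v; have /pE [y yE] : p (f v) = 0 by rewrite -mcompE e mhom0E.
  by exists (s y); rewrite -mcompE je.
have [g gE] := proj_lift x hX V1 VI ss.
by exists g; rewrite -je -mcompA gE.
Qed.

(** Images are quotients and subobjects, so they stay in J. For a kernel [Z] of [X -> I], an
    extension to [P0] of a map [P1 -> Z], taken in [X], induces a map [M -> I]; this is zero, so the
    extension lands in [Z]. For a cokernel, Ext^1(M, I) = 0 lifts maps from [M] to [Y], where they
    vanish. *)
Lemma wide_J M : V M -> wide (J V M).
Proof.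
move=> VM; have jp Z := JP Z VM.
have [P1 [P0 [d [p hd]]]] := min_pres_exists hV hG VM; have [[hP1 hP0 ps dE] _] := hd.
have pE := (limg_kerP _ _).1 dE; have V1 := proj_V hP1; have V0 := proj_V hP0.
have tp Z := torP aV Z hd VM.
have imgJ X Y I (s : mhom X I) (j : mhom I Y) : J V M X -> J V M Y -> surjm s -> injm j ->
    J V M I.
  move=> /jp [tX _] /jp [tY hY] ss ji; apply/jp; split; last exact: inj_hom0 ji hY.
  exact: tor_quo ss (wide_img hV ss ji (tor_V tX) (tor_V tY)) tX.
split.
- move=> X Y h /jp [tX hX]; apply/jp; split; first exact: tor_iso aV _ _ _ h tX.
  by case/misomP: h => f [g [e1 e2]]; apply: (inj_hom0 (retr_inj e2)).
- apply/jp; split; first exact/(tor_zero aV)/mod0_zero.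
  move=> f; apply: mhom_eq => v; rewrite mhom0E; exact: (is_zeroP mod0).1 mod0_zero _.
- move=> X Y Z f i JX JY ii /limg_kerP iE.
  have [tX hX] := (jp X).1 JX; have [tY hY] := (jp Y).1 JY.
  have VX := tor_V tX; have VY := tor_V tY.
  have [I [s [j [VI ss ji je]]]] := img_V hV f VX VY.
  have [tI hI] := (jp I).1 (imgJ _ _ _ s j JX JY ss ji).
  have iE' v : s v = 0 <-> exists z, i z = v.
    rewrite -iE -je mcompE; split=> [->|h]; first exact: mh0.
    exact: (injmP j).1 ji _ h.
  have VZ : V Z by apply: (@wide_ker _ _ _ hV _ _ _ f i VX VY ii); apply/limg_kerP.
  apply/jp; split; last exact: inj_hom0 ii hX.
  apply/tp; split=> // g; have [_ /(_ (i \m g)) [h hE]] := (tp X).1 tX.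
  have [|h' hE'] := @factor_surj _ _ _ _ _ p (s \m h) ps.
    move=> x /pE [y <-]; rewrite mcompE -[h (d y)]mcompE hE mcompE.
    by apply/iE'; exists (g y).
  have [|k kE] := @factor_inj _ _ _ _ _ i h ii.
    by move=> x; apply/iE'; rewrite -mcompE -hE' (hI h') mcomp0l mhom0E.
  by exists k; apply: (inj_mono ii); rewrite mcompA kE.
- move=> X Y Z f q JX JY qs qE.
  have [tX hX] := (jp X).1 JX; have [tY hY] := (jp Y).1 JY.
  have VX := tor_V tX; have VY := tor_V tY.
  have [I [s [j [VI ss ji je]]]] := img_V hV f VX VY.
  have [tI hI] := (jp I).1 (imgJ _ _ _ s j JX JY ss ji).
  have VZ : V Z by exact: (wide_coker hV VX VY qs qE).
  apply/jp; split; first exact: tor_quo qs VZ tY.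
  move=> g; have se : short_exact j q.
    split=> //; rewrite qE -je; apply/vspaceP => w.
    apply/memv_limgP/memv_limgP => -[v <-]; last by exists (s v); rewrite mcompE.
    by have [y <-] := (surjmP s).1 ss v; exists y; rewrite mcompE.
  have [h <-] := ext_lift g (tor_ext1 tI) se.
  by rewrite (hY h) mcomp0r.
- move=> X Y Z i q /jp [tX hX] /jp [tZ hZ] se; apply/jp; split.
    exact: tor_ext aV _ _ _ _ _ _ VM se tX tZ.
  move=> f; have /sexP [ii iE qs] := se.
  have [|g gE] := @factor_inj _ _ _ _ _ i f ((injmP i).2 ii).
    by move=> x; apply/iE; rewrite -mcompE (hZ (q \m f)) mhom0E.
  by rewrite -gE (hX g) mcomp0r.
Qed.

(** * Bongartz completion *)

(** [E] is the push-out of [R <- P1^m -> P0^m], the left map collecting a basis of Hom(P1, R) and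
    the right one being a sum of copies of [d]. Using all maps from [P1], not only those factoring
    through the image of [d], gives the strong condition [tor V M E]. The last two clauses describe
    maps from projectives to [E] and their relations, for use in [bongartz_kill]. *)
Lemma bongartz M R P1 P0 (d : mhom P1 P0) (p : mhom P0 M) : rig M -> proj R ->
  min_presentation V d p ->
  exists m E (eta : mhom R E) (pi : mhom E (pw M m)) (c0 : mhom (pw P0 m) E) (u : 'I_m -> mhom P1 R),
  [/\ V E, surjm pi, limg eta = lker pi, tor V M E & forall Z, tor V M Z -> ext1_zero E Z] /\
  [/\ forall Z, tor V M Z -> forall f : mhom R Z, exists g, g \m eta = f,
      forall X (f : mhom X E), proj X -> exists x y, f = c0 \m x + eta \m y
    & exists prs : 'I_m -> mhom (pw P0 m) P0,
      forall X (x : mhom X (pw P0 m)) (y : mhom X R), proj X -> c0 \m x + eta \m y = 0 ->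
      exists t : 'I_m -> mhom X P1, (forall i, prs i \m x = d \m t i) /\ y = \sum_i (u i \m t i)].
Proof.
move=> rM hR hd; have VM := tor_V rM; have [[hP1 hP0 ps dE] _] := hd.
have tp Z := torP aV Z hd VM; have pE := (limg_kerP _ _).1 dE.
have V1 := proj_V hP1; have V0 := proj_V hP0; have VR := proj_V hR.
have [m [u uE]] := hom_basis P1 R.
have [ins1 [prs1 [a1 b1]]] := pwP P1 m; have [ins0 [prs0 [a0 b0]]] := pwP P0 m.
have [insM [prsM [aM bM]]] := pwP M m.
have pickr (X Y : fdmod A) (prs : 'I_m -> mhom X Y) (ins : 'I_m -> mhom Y X)
    (W : fdmod A) (f : 'I_m -> mhom W Y) :
    (forall i j, prs j \m ins i = if i == j then mid Y else 0) ->
    forall j, prs j \m (\sum_i (ins i \m f i)) = f j.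
  move=> h j; rewrite mcomp_sumr (bigD1 j) //= mcompA h eqxx mcomp1l big1 ?addr0 // => i ij.
  by rewrite mcompA h (negPf ij) mcomp0l.
have pickl (X Y : fdmod A) (prs : 'I_m -> mhom X Y) (ins : 'I_m -> mhom Y X)
    (Z : fdmod A) (g : 'I_m -> mhom Y Z) :
    (forall i j, prs j \m ins i = if i == j then mid Y else 0) ->
    forall j, (\sum_i (g i \m prs i)) \m ins j = g j.
  move=> h j; rewrite mcomp_suml (bigD1 j) //= -mcompA h eqxx mcomp1r big1 ?addr0 // => i ij.
  by rewrite -mcompA h eq_sym (negPf ij) mcomp0r.
pose dm : mhom (pw P1 m) (pw P0 m) := \sum_i (ins0 i \m (d \m prs1 i)); pose uu : mhom (pw P1 m) R := \sum_i (u i \m prs1 i).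
pose W := mpair dm uu.
have dm_prs i : prs0 i \m dm = d \m prs1 i by rewrite (pickr _ _ _ _ _ _ a0).
have dm_ins i : dm \m ins1 i = ins0 i \m d.
  rewrite -(pickl _ _ _ _ _ (fun i => ins0 i \m d) a1); congr (_ \m _).
  by apply: eq_bigr => j _; rewrite mcompA.
have uu_ins i : uu \m ins1 i = u i by rewrite (pickl _ _ _ _ _ _ a1).
have Vp1 := wide_pw hV m V1; have Vp0 := wide_pw hV m V0; have VpM := wide_pw hV m VM.
have VD : V (dsum (pw P0 m) R) by apply: wide_dsum.
have [E [c [VE cs cE]]] := coker_V hV W Vp1 VD.
pose c0 := c \m dl (pw P0 m) R; pose eta := c \m dr (pw P0 m) R.
have cdec v : c v = c0 (pl _ _ v) + eta (pr _ _ v).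
  by rewrite {1}(dsumE v) mhD !mcompE.
have cW : c0 \m dm + eta \m uu = 0.
  apply: mhom_eq => v; rewrite mhomDE mhom0E !mcompE -mhD; apply/cE; exists v.
  by rewrite mhomDE !mcompE.
have etau i : eta \m u i = - (c0 \m (ins0 i \m d)).
  apply/eqP; rewrite -addr_eq0 addrC -dm_ins -uu_ins.
  by rewrite !mcompA -mcompDl cW mcomp0l.
have etab (b : mhom P1 R) : exists g : mhom P0 E, eta \m b = g \m d.
  have [k ->] := uE b; exists (- \sum_i (k i *: (c0 \m ins0 i))).
  rewrite mcomp_sumr mcompNl mcomp_suml -sumrN; apply: eq_bigr => i _.
  by rewrite mcompZr etau mcompZl scalerN -mcompA.
have clift X (f : mhom X E) : proj X -> exists x y, f = c0 \m x + eta \m y.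
  move=> hX; have [g <-] := proj_lift f hX VD VE cs.
  exists (pl _ _ \m g), (pr _ _ \m g); apply: mhom_eq => v.
  by rewrite mcompE cdec mhomDE !mcompE.
pose pm : mhom (pw P0 m) (pw M m) := \sum_i (insM i \m (p \m prs0 i)).
have pm_prs i : prsM i \m pm = p \m prs0 i by rewrite (pickr _ _ _ _ _ _ aM).
have pdm : pm \m dm = 0.
  rewrite mcomp_suml; apply: big1 => i _.
  rewrite -!mcompA dm_prs (mcompA p) (_ : p \m d = 0) ?mcomp0l ?mcomp0r //.
  by apply: mhom_eq => v; rewrite mcompE mhom0E; apply/pE; exists v.
have [|pi piE] := @factor_surj _ _ _ _ _ c (pm \m pl _ _) cs.
  by move=> x /cE [s <-]; rewrite -mcompE -mcompA pl_mpair pdm mhom0E.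
have pic v : pi (c v) = pm (pl _ _ v) by rewrite -mcompE piE mcompE.
have pms : surjm pm.
  apply/surjmP => w; have [x xE] := choice _ (fun i => (surjmP p).1 ps (prsM i w)).
  exists (\sum_i ins0 i (x i)); rewrite -[RHS]midE -bM mhom_sumE mhom_sumE.
  apply: eq_bigr => i _; rewrite !mcompE -xE; congr (insM i (p _)).
  rewrite mhS (bigD1 i) //= -mcompE a0 eqxx midE big1 ?addr0 // => j ji.
  by rewrite -mcompE a0 (negPf ji) mhom0E.
have pmker X (x : mhom X (pw P0 m)) : proj X -> pm \m x = 0 -> exists t, dm \m t = x.
  move=> hX e; have [|t tE] := choice (fun i (t : mhom X P1) => d \m t = prs0 i \m x).
    move=> i; apply: (im_lift hX V1 V0 dE).
    by rewrite mcompA -pm_prs -mcompA e mcomp0r.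
  exists (\sum_i (ins1 i \m t i)); rewrite mcomp_sumr -[RHS]mcomp1l -b0 mcomp_suml.
  by apply: eq_bigr => i _; rewrite mcompA dm_ins -!mcompA tE.
have Wext Z : tor V M Z -> forall f : mhom (pw P1 m) Z, exists g : mhom (pw P0 m) Z, g \m dm = f.
  move=> /tp [VZ hZ] f; have [g gE] := choice _ (fun i => hZ (f \m ins1 i)).
  exists (\sum_i (g i \m prs0 i)); rewrite mcomp_suml -[RHS]mcomp1r -b1 mcomp_sumr.
  by apply: eq_bigr => i _; rewrite -mcompA dm_prs mcompA gE mcompA.
exists m, E, eta, pi, c0, u; split; split=> //.
- by apply: (@surj_compl _ _ _ _ _ _ c); rewrite piE; apply: surjm_comp pms (retr_surj (pldl _ _)).
- apply/limg_kerP => w; split=> [h|[v <-]].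
    have [v vE] := (surjmP c).1 cs w; move: h; rewrite -vE pic => h.
    have [x xE] : exists x, dm x = pl _ _ v.
      have [|y yE] := choice (fun i y => d y = prs0 i (pl _ _ v)).
        move=> i; apply/pE; rewrite -mcompE -pm_prs mcompE h; exact: mh0.
      exists (\sum_i ins1 i (y i)); rewrite mhS -[RHS]midE -b0 mhom_sumE.
      by apply: eq_bigr => i _; rewrite -mcompE dm_ins !mcompE yE.
    exists (pr _ _ v - uu x); rewrite mhB cdec -xE addrC; apply/eqP; rewrite -subr_eq0.
    rewrite opprD addrACA subrr addr0 -opprD oppr_eq0 addrC -!mcompE -mhomDE cW mhom0E.
    exact: eqxx.
  by rewrite mcompE pic dsE mh0.
- apply/tp; split=> // f; have [al [be ->]] := clift _ f hP1.
  have [g1 ->] := etab be.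
  have /tp [_ /(_ (pm \m al)) [g gE]] := tor_pw aV m VM rM.
  have [g' gE'] := proj_lift g hP0 Vp0 VpM pms.
  have [|t tE] := pmker _ (al - g' \m d) hP1; first by rewrite mcompBr mcompA gE' gE subrr.
  have [g2 g2E] := etab (uu \m t).
  exists (c0 \m g' - g2 + g1); rewrite !mcompDl mcompNl; congr (_ + _).
  have -> : al = g' \m d + dm \m t by rewrite tE addrC subrK.
  rewrite mcompDr mcompA; congr (_ + _); apply/eqP.
  by rewrite -g2E eq_sym -addr_eq0 !mcompA -mcompDl cW mcomp0l.
- move=> Z tZ; have VZ := tor_V tZ.
  apply: (@ext1_crit _ _ (pw P1 m) (dsum (pw P0 m) R) _ _ W c cs).
  + by apply/limg_kerP.
  + by apply: (proj_ext hV _ VZ); apply: proj_dsum => //; apply: proj_pw.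
  + move=> f; have [g gE] := Wext Z tZ f; exists (copair g 0).
    by rewrite copair_mpair gE mcomp0l addr0.
- move=> Z tZ f; have [g gE] := Wext Z tZ (f \m uu).
  have [|h hE] := @factor_surj _ _ _ _ _ c (copair (- g) f) cs.
    move=> x /cE [s <-]; rewrite -mcompE copair_mpair mcompNl gE addrC subrr.
    exact: mhom0E.
  by exists h; rewrite mcompA hE copair_dr.
exists prs0 => X x y hX e.
have e' : c \m mpair x y = 0.
  have e1 v : pl _ _ (mpair x y v) = x v by rewrite -mcompE pl_mpair.
  have e2 v : pr _ _ (mpair x y v) = y v by rewrite -mcompE pr_mpair.
  apply: mhom_eq => v; rewrite mcompE cdec e1 e2.
  by have := congr1 (fun h : mhom _ _ => h v) e; rewrite mhomDE !mcompE.
have [t tE] : exists t, W \m t = mpair x y.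
  by apply: (@im_lift _ _ _ _ W c _ hX Vp1 VD _ e'); apply/limg_kerP.
exists (fun i => prs1 i \m t); split=> [i|].
  by rewrite -(pl_mpair x y) -tE (mcompA (pl _ _)) pl_mpair mcompA dm_prs mcompA.
rewrite -(pr_mpair x y) -tE mcompA pr_mpair mcomp_suml.
by apply: eq_bigr => i _; rewrite mcompA.
Qed.

(* If eta factored as in the last clause, R would split off P1 inside the kernel of
   the minimal map d. *)
Lemma bongartz_kill M R : rig M -> proj R -> indecomposable R ->
  exists E (eta : mhom R E), [/\ tor V M E, forall Z, tor V M Z -> ext1_zero E Z &
    forall A' (a : mhom R A') (f : mhom A' E), proj A' -> hom0 A' M -> ~ summand R A' ->
      f \m a <> eta].
Proof.
move=> rM hR iR; have VM := tor_V rM.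
have [P1 [P0 [d [p hd]]]] := min_pres_exists hV hG VM.
have [m [E [eta [pi [c0 [u [[VE _ _ tE eE] [_ cl [prs rel]]]]]]]]] := bongartz rM hR hd.
have [[hP1 hP0 ps dE] [_ /ess_elem ed]] := hd.
exists E, eta; split=> // A' a f hA hAM nR fE.
have [x [y xyE]] := cl _ f hA.
have [|t [t1 t2]] := rel R (- (x \m a)) (mid R - y \m a) hR.
  have E1 : eta = c0 \m (x \m a) + eta \m (y \m a) by rewrite -{1}fE xyE mcompDl -!mcompA.
  by rewrite mcompNr mcompBr mcomp1r {1}E1 addrK addNr.
have [|x' xE] := choice (fun i (z : mhom A' P1) => d \m z = prs i \m x).
  by move=> i; apply: (im_lift hA (proj_V hP1) (proj_V hP0) dE); apply: hAM.
pose t' i : mhom R P1 := t i + x' i \m a.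
have dt' i : d \m t' i = 0.
  by rewrite mcompDr -t1 mcompA xE mcompNr mcompA addrC subrr.
(* The identity of [R] is split into a map through [A'] and maps through the kernel of [d]. As End R
   is local and [R] is not a summand of [A'], some [u i \m t' i] is invertible. *)
have : surjm ((y - \sum_i (u i \m x' i)) \m a + \sum_i (u i \m t' i)).
  suff -> : (y - \sum_i (u i \m x' i)) \m a + \sum_i (u i \m t' i) = mid R by apply: surj_mid.
  have -> : \sum_i (u i \m t' i) = \sum_i (u i \m t i + u i \m x' i \m a).
    by apply: eq_bigr => i _; rewrite mcompDr mcompA.
  rewrite big_split /= -t2 mcompBl mcomp_suml.
  by rewrite addrACA addNr addr0 addrC subrK.
case/(indec_local iR) => [/endo_fact_summand //|].
case/(indec_local_sum iR) => i /surj_endo_inv [k [k1 k2]].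
pose r := k \m u i.
have rt : r \m t' i = mid R by rewrite -mcompA.
have [T [j [VT ji jE]]] := ker_V hV r (proj_V hP1) (proj_V hR).
have /surjmP js : surjm j.
  apply: ed => // z; have /jE [s sE] : r (z - t' i (r z)) = 0.
    by rewrite mhB -[r (t' i _)]mcompE rt midE subrr.
  by exists s; rewrite sE mhB -[d (t' i _)]mcompE dt' mhom0E subr0.
case: iR => R0 _; apply: R0; apply/is_zeroP => v.
by rewrite -[v]midE -rt mcompE; apply/jE; apply: js.
Qed.

(** * The torsion-free quotient modulo Gen M *)

(* q is the projection of X onto f_M X. *)
Definition fq M X Y (q : mhom X Y) := exists T (i : mhom T X),
  [/\ V T, short_exact i q, gen M T & hom0 M Y].

Lemma fq_surj M X Y (q : mhom X Y) : fq M q -> surjm q.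
Proof. by case=> T [i [_ [_ _ ?] _ _]]. Qed.

Lemma fq_hom0 M X Y (q : mhom X Y) : fq M q -> hom0 M Y.
Proof. by case=> T [i []]. Qed.

Lemma fq_V M X Y (q : mhom X Y) : fq M q -> V X -> V Y.
Proof. by case=> T [i [VT se _ _]] VX; apply: wide_quo hV _ _ _ _ _ se VT VX. Qed.

Lemma fq_exists M X : rig M -> V X -> exists Y (q : mhom X Y), V Y /\ fq M q.
Proof.
move=> rM VX; have VM := tor_V rM.
have [T [F [i [q [VT VF se gT h]]]]] := trace_V hV VM VX.
exists F, q; split=> //; exists T, i; split=> // f.
have [g <-] := ext_lift f (tor_ext1 (tor_gen aV VM rM gT VT)) se.
exact: h.
Qed.

Lemma fq_univ M X Y Z (q : mhom X Y) (f : mhom X Z) : fq M q -> hom0 M Z -> exists g, g \m q = f.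
Proof.
case=> T [i [VT /sexP [ii iE qs] gT _]] hZ; apply: factor_surj; first exact/surjmP.
by move=> x /iE [t <-]; rewrite -mcompE (gen_hom0 gT hZ (f \m i)) mhom0E.
Qed.

Lemma fq_hm M X Y Z (q : mhom X Y) : fq M q -> hom0 M Z -> hm Y Z = hm X Z.
Proof.
move=> hq hZ; apply: (@hm_bij _ _ _ _ _ _ (mcompr q)).
- exact: mcomp_linl.
- by move=> f e; apply: (surj_epi (fq_surj hq)); rewrite mcomp0l.
- by move=> f; have [g gE] := fq_univ f hq hZ; exists g.
Qed.

Lemma fq_hom0r M X Y Z (q : mhom X Y) : fq M q -> hom0 M Z -> (hom0 Y Z <-> hom0 X Z).
Proof. by move=> hq hZ; rewrite !hom0_dim (fq_hm hq hZ). Qed.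

Lemma fq_lift M X Y X' Y' (q : mhom X Y) (q' : mhom X' Y') (f : mhom Y Y') :
  fq M q' -> (forall Z, V Z -> gen M Z -> ext1_zero X Z) -> exists g, q' \m g = f \m q.
Proof. by case=> T [i [VT se gT _]] h; apply: (ext_lift _ (h T VT gT) se). Qed.

Lemma fq_tfp M X Y (q : mhom X Y) : fq M q -> is_torsionfree_part V M X Y.
Proof.
case=> T [i [VT se gT hY]]; exists T, i, q; split=> //.
  by split=> //; apply/genP.
move=> T' i' ii [VT' /genP gT']; have /sexP [_ iE _] := se.
apply/subvP => _ /memv_limgP [v <-]; apply/memv_limgP/iE.
by rewrite -mcompE (gen_hom0 gT' hY (q \m i')) mhom0E.
Qed.

Lemma fq_J M X Y (q : mhom X Y) : V M -> fq M q -> tor V M X -> J V M Y.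
Proof.
move=> VM hq tX; apply/(JP _ VM); split; last exact: fq_hom0 hq.
exact: tor_quo (fq_surj hq) (fq_V hq (tor_V tX)) tX.
Qed.

Lemma fq_zero M X Y (q : mhom X Y) : V M -> fq M q -> is_zero Y -> gen M X.
Proof.
move=> VM [T [i [VT /sexP [ii iE qs] gT _]]] /is_zeroP Y0; apply: gen_surj gT.
by apply/surjmP => x; apply/iE; rewrite (Y0 (q x)).
Qed.

Lemma fq_iso M X Y Y' (q : mhom X Y) (q' : mhom X Y') : fq M q -> fq M q' -> misom Y Y'.
Proof.
move=> h h'; have [f fE] := fq_univ q' h (fq_hom0 h'); have [g gE] := fq_univ q h' (fq_hom0 h).
apply/misomP; exists f, g; split.
  by apply: (surj_epi (fq_surj h)); rewrite -mcompA fE gE mcomp1l.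
by apply: (surj_epi (fq_surj h')); rewrite -mcompA gE fE mcomp1l.
Qed.

(** Ext-projectivity relative to the class [tor V M], kept apart from membership in it. *)
Definition extp M E := forall Z, tor V M Z -> ext1_zero E Z.

Lemma extp_summand M E E' : summand E E' -> extp M E' -> extp M E.
Proof. by move=> s h Z tZ; apply: (ext1_summand s); apply: h. Qed.

Lemma extp_gen M E Z : rig M -> extp M E -> V Z -> gen M Z -> ext1_zero E Z.
Proof. by move=> rM h VZ gZ; apply: h; apply: (tor_gen aV (tor_V rM) rM gZ VZ). Qed.

Lemma fq_proj M E Q (q : mhom E Q) : rig M -> tor V M E -> extp M E -> fq M q ->
  projective_in (J V M) Q.
Proof.
move=> rM tE eE hq; have VM := tor_V rM; split; first exact: fq_J hq tE.
move=> X Y g f JX JY gs.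
have [T [i [JT se]]] := quo_seV (wide_J VM) gs JX JY.
have [h hE] := ext_lift (f \m q) (eE T ((JP T VM).1 JT).1) se.
have [h' hE'] := fq_univ h hq ((JP X VM).1 JX).2.
exists h'; apply: (surj_epi (fq_surj hq)); by rewrite -mcompA hE'.
Qed.

(** With a progenerator for [R] in [bongartz], all maps [G -> Z] with [Z] in the class factor
    through [eta], so [E] generates whatever [G] generates there. *)
Lemma bongartz_gen M : rig M -> exists E, [/\ tor V M E, extp M E & forall Z, tor V M Z -> gen E Z].
Proof.
move=> rM; have VM := tor_V rM; have [G [hPG hgen]] := hG.
have [P1 [P0 [d [p hd]]]] := min_pres_exists hV hG VM.
have [m [E [eta [pi [c0 [u [[VE _ _ tE eE] [ap _ _]]]]]]]] := bongartz rM hPG hd.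
exists E; split=> // Z tZ; have VZ := tor_V tZ; have /genP [k [q qs]] := hgen _ VZ.
have [k' [q' q'u]] := univ_out E Z; exists k', q'.
have [|h hE] := @pw_lift_out _ _ G k _ _ q' _ q; last by move: qs; rewrite -hE => /surj_compl.
move=> f; have [g gE] := ap Z tZ f; have [h hE] := q'u g.
by exists (h \m eta); rewrite mcompA hE.
Qed.

Lemma abcat_J M : rig M -> abcat (J V M).
Proof.
move=> rM; have VM := tor_V rM; split; first exact: wide_J.
have [E [tE eE gE]] := bongartz_gen rM; have [Q [q [VQ hq]]] := fq_exists rM (tor_V tE).
exists Q; split; first exact: fq_proj hq.
move=> X /(JP _ VM) [tX hX]; apply/genP; have [k [r rs]] := gE X tX.
have [k' [q' q'u]] := univ_out Q X; exists k', q'.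
have [|h hE] := @pw_lift_out _ _ E k _ _ q' _ r; last by move: rs; rewrite -hE => /surj_compl.
move=> f; have [g gE'] := fq_univ f hq hX; have [h hE] := q'u g.
by exists (h \m q); rewrite mcompA hE.
Qed.

(** [Q] is a summand of f_M(E) for a power [E] of the Bongartz completion. As [E] has no extensions
    by Gen M, the idempotent [a \m b] lifts to an endomorphism [f] of [E], and the stable image of
    [f] lifts [Q]. *)
Lemma proj_J_lift M Q : rig M -> projective_in (J V M) Q ->
  exists E (q : mhom E Q), [/\ tor V M E, extp M E & fq M q].
Proof.
move=> rM hQ; have VM := tor_V rM; have JQ := proj_V hQ; have [tQ hMQ] := (JP Q VM).1 JQ.
have [E0 [tE0 eE0 gE0]] := bongartz_gen rM.
have [k [e es]] := gE0 Q tQ.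
have tE : tor V M (pw E0 k) by apply: tor_pw.
have eE : extp M (pw E0 k) by move=> Z tZ; apply: ext1_pw; apply: eE0.
move: (pw E0 k) e es tE eE => E e es tE eE.
have VE := tor_V tE; have [Q' [rho [VQ' hrho]]] := fq_exists rM VE.
have JQ' : J V M Q' := fq_J VM hrho tE.
have [b bE] := fq_univ e hrho hMQ.
have bs : surjm b by move: es; rewrite -bE => /surj_compl.
have [a ba] := proj_split hQ JQ' bs.
have [f fE] := fq_lift rho (a \m b) hrho (fun Z VZ gZ => extp_gen rM eE VZ gZ).
have [n [X [s [r [be [n0 sr b1 b2]]]]]] := fitting f.
have sX : summand X E by apply/summandP; exists s, (be \m r); rewrite -mcompA.
have rhof j : rho \m mexp f j.+1 = a \m b \m rho.
  elim: j => [|j IH]; first by rewrite mexpS -fE /mexp /= mcomp1r.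
  by rewrite mexpS mcompA fE -(mcompA _ rho) IH !mcompA -(mcompA a b a) ba mcomp1r.
have brhof : b \m rho \m mexp f n = b \m rho.
  case: n n0 {sr} => // n _; rewrite -mcompA rhof !mcompA ba mcomp1l.
  exact: erefl.
have rhofn : rho \m mexp f n = a \m b \m rho by case: n n0 {sr brhof}.
exists X, (b \m (rho \m s)); split.
- exact: tor_summandr sX tE.
- exact: extp_summand sX eE.
have srE v : s (r v) = mexp f n v by rewrite -mcompE sr.
have rsb y : r (s (be y)) = y.
  by have := congr1 (fun h : mhom _ _ => h y) b2; rewrite !mcompE midE.
have bsr y : be (r (s y)) = y.
  by have := congr1 (fun h : mhom _ _ => h y) b1; rewrite !mcompE midE.
have brf y : b (rho (mexp f n y)) = b (rho y).
  by have := congr1 (fun h : mhom _ _ => h y) brhof; rewrite !mcompE.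
have sx x : s x = mexp f n (s (be x)) by rewrite -srE rsb.
have key x : b (rho (s x)) = 0 -> rho (s x) = 0.
  rewrite {1}sx -[rho (mexp f n _)]mcompE rhofn !mcompE -[b (a _)]mcompE ba midE => e0.
  by rewrite sx -[rho _]mcompE rhofn !mcompE e0 mh0.
have qs : surjm (b \m (rho \m s)).
  apply/surjmP => y; have [v vE] := (surjmP e).1 es y; exists (r v).
  by rewrite !mcompE srE brf -[LHS]mcompE bE.
have [T [i [VT se]]] := quo_seV hV qs (wide_summand hV sX VE) (tor_V tQ).
exists T, i; split=> //.
have [T' [i' [VT' /sexP [ii' iE' rs] gT' _]]] := hrho.
have /sexP [ii iE _] := se.
(* the kernel is a quotient of the kernel T' of rho *)
have [|h hE] := @factor_inj _ _ _ _ _ i (be \m r \m i') ((injmP i).2 ii).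
  move=> x; apply/iE; rewrite !mcompE.
  have e0 : rho (i' x) = 0 by apply/iE'; exists x.
  rewrite -brf -srE rsb srE -[rho (mexp f n _)]mcompE rhofn !mcompE e0.
  by rewrite !mh0.
apply: (@gen_surj _ _ _ _ _ h _ gT'); apply/surjmP => t; have e0 : rho (s (i t)) = 0.
  by apply: key; have := (iE (i t)).2; rewrite !mcompE; apply; exists t.
have /iE' [x xE] := e0; exists x; apply: (injm_inj ((injmP i).2 ii)).
by rewrite -mcompE hE !mcompE xE bsr.
Qed.

End Reduction.

(** * Lifting rigid objects from a perpendicular category *)

Section Lifting.
Context {K : fieldType} {A : falgType K}.
Implicit Types (M N P Q S T X Y Z B C E R G : fdmod A).
Variable V : fdmod A -> Prop.
Hypothesis aV : abcat V.
Let hV := ab_w aV.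
Let hG := ab_g aV.
Notation proj := (projective_in V).
Notation rig M := (tor V M M).
Notation fq := (fq V).

(* Wakamatsu's lemma. *)
Lemma approx_ker N Y : rig N -> V Y -> gen N Y ->
  exists m T (k : mhom T (pw N m)) (q : mhom (pw N m) Y), [/\ V T, short_exact k q & tor V N T].
Proof.
move=> rN VY gY; have VN := tor_V rN.
have [m [q qu]] := univ_out N Y; have qs := gen_univ qu gY.
have [T [k [VT se]]] := quo_seV hV qs (wide_pw hV m VN) VY.
exists m, T, k, q; split=> //; have /sexP [ki kE _] := se.
have [P1 [P0 [d [p hd]]]] := min_pres_exists hV hG VN; have [[hP1 hP0 ps dE] _] := hd.
have pE := (limg_kerP _ _).1 dE; have qk : q \m k = 0.
  by apply: mhom_eq => v; rewrite mcompE mhom0E; apply/kE; exists v.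
apply/(torP aV _ hd VN); split=> // f.
have /(torP aV _ hd VN) [_ /(_ (k \m f)) [h hE]] := tor_pw aV m VN rN.
have [|h1 hE1] := @factor_surj _ _ _ _ _ p (q \m h) ps.
  by move=> x /pE [y <-]; rewrite mcompE -[h (d y)]mcompE hE -mcompE mcompA qk mcomp0l mhom0E.
have [h' hE'] := qu h1.
have [|g gE] := @factor_inj _ _ _ _ _ k (h - h' \m p) ((injmP k).2 ki).
  by move=> x; apply/kE; rewrite mhomBE mhB -!mcompE mcompA hE' hE1; apply: subrr.
exists g; apply: (inj_mono ((injmP k).2 ki)); rewrite mcompA gE mcompBl hE -mcompA.
have -> : p \m d = 0 by apply: mhom_eq => v; rewrite mcompE mhom0E; apply/pE; exists v.
by rewrite mcomp0r subr0.
Qed.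

Lemma extp_add N Y : rig N -> V Y -> gen N Y ->
  (forall T m (k : mhom T (pw N m)), V T -> injm k -> tor V N T -> ext1_zero Y T) ->
  exists m, summand Y (pw N m).
Proof.
move=> rN VY gY h; have [m [T [k [q [VT se tT]]]]] := approx_ker rN VY gY.
have ki : injm k by case: se.
have [s sE] := h T m k VT ki tT _ k q se.
by exists m; apply/summandP; exists s, q.
Qed.

(** Both directions of the isomorphism lift to maps between [X] and [X']. The composite on [X]
    induces the identity on [B], so it is not nilpotent and must be invertible. *)
Lemma lift_summand M X X' B B' (q : mhom X B) (q' : mhom X' B') : indecomposable X ->
  ~ is_zero B -> fq M q -> fq M q' -> misom B B' ->
  (forall Z, V Z -> gen M Z -> ext1_zero X Z) -> (forall Z, V Z -> gen M Z -> ext1_zero X' Z) ->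
  summand X X'.
Proof.
move=> iX B0 hq hq' /misomP [f [g [e1 e2]]] hX hX'.
have [e eE] := fq_lift q f hq' hX; have [e' eE'] := fq_lift q' g hq hX'.
have H : q \m (e' \m e) = q by rewrite mcompA eE' -mcompA eE mcompA e1 mcomp1l.
have Hn n : q \m mexp (e' \m e) n = q.
  by elim: n => [|n IH]; [exact: mcomp1r | rewrite mexpSr mcompA IH H].
case: (indec_fitting (e' \m e) iX) => [/endo_fact_summand //|[n nE]].
case: B0; apply/is_zero_mid/(surj_epi (fq_surj hq)).
by rewrite mcomp1l mcomp0l -(Hn n) nE mcomp0r.
Qed.

Lemma fq_compl M X Y Y' (q : mhom X Y) (f : mhom Y Y') : fq M q -> injm f -> surjm f ->
  fq M (f \m q).
Proof.
move=> [T [i [VT /sexP [ii iE qs] gT hY]]] /injmP fi fs; exists T, i; split=> //.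
  apply/sexP; split=> //; last by apply/surjmP/surjm_comp => //; apply/surjmP.
  move=> w; rewrite -iE mcompE; split=> [/fi //|->]; exact: mh0.
have [g [e1 e2]] := bijm_inv ((injmP f).2 fi) fs.
by apply: (inj_hom0 (retr_inj e2)).
Qed.

Lemma fq_compr M X X' Y (q : mhom X Y) (f : mhom X' X) : fq M q -> injm f -> surjm f ->
  fq M (q \m f).
Proof.
move=> [T [i [VT /sexP [ii iE qs] gT hY]]] fi fs.
have [g [e1 e2]] := bijm_inv fi fs.
exists T, (g \m i); split=> //; apply/sexP; split.
- move=> v; rewrite mcompE => h; apply: ii.
  by rewrite -[i v]midE -e2 mcompE h mh0.
- move=> w; rewrite mcompE iE; split=> -[v vE]; exists v.
    by rewrite mcompE vE -mcompE e1 midE.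
  by rewrite -vE -mcompE mcompA e2 mcomp1l.
- by apply/surjmP/surjm_comp => //; apply/surjmP.
Qed.

Lemma fq_dsum M X Y X' Y' (q : mhom X Y) (q' : mhom X' Y') : fq M q -> fq M q' ->
  fq M (mpair (q \m pl X X') (q' \m pr X X')).
Proof.
move=> [T [i [VT /sexP [ii iE qs] gT hY]]] [T' [i' [VT' /sexP [ii' iE' qs'] gT' hY']]].
exists (dsum T T'), (mpair (i \m pl T T') (i' \m pr T T')).
have dE (U W U' W' : fdmod A) (a : mhom U W) (b : mhom U' W') v :
    mpair (a \m pl U U') (b \m pr U U') v = dl _ _ (a (pl _ _ v)) + dr _ _ (b (pr _ _ v)).
  by rewrite mhomDE !mcompE.
have d0 (W W' : fdmod A) (a : W) (b : W') : dl W W' a + dr W W' b = 0 <-> a = 0 /\ b = 0.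
  split=> [h|[-> ->]]; last by rewrite !mh0 addr0.
  have := congr1 (pl _ _) h; have := congr1 (pr _ _) h.
  by rewrite !(mhD, dsE, mh0, addr0, add0r).
split; first exact: wide_dsum.
- apply/sexP; split.
  + by move=> v; rewrite dE => /d0 [/ii h /ii' h']; rewrite (dsumE v) h h' !mh0 addr0.
  + move=> w; rewrite dE; split=> [/d0 [/iE [x xE] /iE' [x' xE']]|[v]].
      exists (dl _ _ x + dr _ _ x').
      by rewrite dE !(mhD, dsE, mh0, addr0, add0r) xE xE' -dsumE.
    rewrite dE => <-; apply/d0; split.
      by rewrite !(mhD, dsE, mh0, addr0, add0r); apply/iE; exists (pl _ _ v).
    by rewrite !(mhD, dsE, mh0, addr0, add0r); apply/iE'; exists (pr _ _ v).
  + move=> z; have [x xE] := qs (pl _ _ z); have [x' xE'] := qs' (pr _ _ z).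
    exists (dl _ _ x + dr _ _ x').
    by rewrite dE !(mhD, dsE, mh0, addr0, add0r) xE xE' -dsumE.
- exact: gen_dsum.
- by move=> f; rewrite [f]mpair_eta (hY (pl _ _ \m f)) (hY' (pr _ _ \m f)) /mpair !mcomp0r addr0.
Qed.

Lemma fq_to_zero M Y Z : V Y -> gen M Y -> is_zero Z -> fq M (0 : mhom Y Z).
Proof.
move=> VY gY Z0; have z0 := (is_zeroP Z).1 Z0; exists Y, (mid Y); split=> //.
  apply/sexP; split=> [v|w|z]; first by rewrite midE.
    by rewrite mhom0E; split=> // _; exists w; rewrite midE.
  by exists 0; rewrite (z0 z) mh0.
by move=> f; apply: mhom_eq => v; rewrite mhom0E; apply: z0.
Qed.

Lemma fq_indec_part M N : rig M -> forall B (q : mhom N B), V N -> fq M q -> indecomposable B ->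
  exists N' (q' : mhom N' B), [/\ summand N' N, indecomposable N' & fq M q'].
Proof.
move=> rM; move: N; apply: indec_ind.
- move=> X Y h IH B q VN hq iB.
  have VX : V X by apply: (wide_iso hV (misom_sym h)).
  case: (h) => f [fi fs]; have [N' [q' [s i' hq']]] := IH B (q \m f) VX (fq_compr hq fi fs) iB.
  by exists N', q'; split=> //; apply: (summand_trans s); apply: summand_iso.
- move=> X X0 B q VN hq iB; case: iB => B0 _; case: B0; apply/is_zeroP => b; have [x <-] := (surjmP q).1 (fq_surj hq) b.
  by rewrite ((is_zeroP X).1 X0 x) mh0.
- by move=> X iX B q VN hq iB; exists X, q; split=> //; apply/summand_iso/misom_refl.
move=> X Y IHX IHY B q VN hq iB; have VX : V X := wide_summand hV (summand_dl X Y) VN.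
have VY : V Y := wide_summand hV (summand_dr X Y) VN.
have [BX [qX [VBX hX]]] := fq_exists aV rM VX; have [BY [qY [VBY hY]]] := fq_exists aV rM VY.
have h := fq_iso hq (fq_dsum hX hY).
have [_ iB'] := iB.
case: (iB' _ _ h) => B0.
  have hB : misom BY B := misom_sym (misom_trans h (misom_trans (dsumC _ _) (dsum0r _ B0))).
  case: hB => f [fi fs]; have [N' [q' [s i' hq']]] := IHY B (f \m qY) VY (fq_compl hY fi fs) iB.
  by exists N', q'; split=> //; apply: (summand_trans s); apply: summand_dr.
have hB : misom BX B := misom_sym (misom_trans h (dsum0r _ B0)).
case: hB => f [fi fs]; have [N' [q' [s i' hq']]] := IHX B (f \m qX) VX (fq_compl hX fi fs) iB.
by exists N', q'; split=> //; apply: (summand_trans s); apply: summand_dl.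
Qed.

(** Lift a minimal presentation of [B] in J(M) to [ep : E1 -> E0] between Ext-projectives of
    [tor V M]. The cokernel of [ep] alone need not have vanishing extensions; adding a left
    [add M]-approximation [al] of [E1] to the target absorbs the maps from [E1] into Gen M. *)
Lemma lift_rigid M B : rig M -> J V M B -> exists N (q : mhom N B), [/\ tor V M N, fq M q &
  forall Y Yb (qY : mhom Y Yb), tor V M Y -> fq M qY -> tor (J V M) B Yb -> ext1_zero N Y].
Proof.
move=> rM JB; have VM := tor_V rM; have aJ := abcat_J aV rM.
have [Q1 [Q0 [de [be hd]]]] := min_pres_exists (ab_w aJ) (ab_g aJ) JB.
have [[hQ1 hQ0 bs dE] _] := hd; have bE := (limg_kerP _ _).1 dE.
have [E1 [r1 [tE1 eE1 hr1]]] := proj_J_lift aV rM hQ1.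
have [E0 [r0 [tE0 eE0 hr0]]] := proj_J_lift aV rM hQ0.
have xE1 Z : V Z -> gen M Z -> ext1_zero E1 Z by apply: extp_gen.
have xE0 Z : V Z -> gen M Z -> ext1_zero E0 Z by apply: extp_gen.
have [ep epE] := fq_lift r1 de hr0 xE1.
have [k [al alu]] := univ_in M E1.
pose F := dsum E0 (pw M k); pose W : mhom E1 F := mpair ep al.
have WE y : W y = dl _ _ (ep y) + dr _ _ (al y) by rewrite mhomDE !mcompE.
have VF : V F by apply: wide_dsum; [exact: hV | exact: tor_V tE0 | exact: wide_pw].
have tF : tor V M F by apply: tor_dsumr => //; apply: tor_pw.
have [N [c [VN cs cE]]] := coker_V hV W (tor_V tE1) VF.
have bd v : be (de v) = 0 by apply/bE; exists v.
have epE' v : r0 (ep v) = de (r1 v) by have := congr1 (fun h : mhom _ _ => h v) epE; rewrite !mcompE.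
have [|q qE] := @factor_surj _ _ _ _ _ c (be \m (r0 \m pl _ _)) cs.
  by move=> x /cE [y <-]; rewrite !mcompE WE !(mhD, dsE, mh0, addr0, add0r) epE' bd.
have qc v : q (c v) = be (r0 (pl _ _ v)) by rewrite -mcompE qE !mcompE.
have [_ hMB] := (JP aV B VM).1 JB.
have qs : surjm q.
  by apply: (@surj_compl _ _ _ _ _ _ c); rewrite qE; apply: surjm_comp bs _;
    apply: surjm_comp (fq_surj hr0) (retr_surj (pldl _ _)).
exists N, q; split; first exact: tor_quo cs VN tF.
  have [T [i [VT se]]] := quo_seV hV qs VN (J_V aV VM JB); exists T, i; split=> //.
  have [T0 [i0 [VT0 /sexP [ii0 iE0 _] gT0 _]]] := hr0; have /sexP [ii iE _] := se.
  have [|h hE] := @factor_inj _ _ _ _ _ i (c \m mpair (i0 \m pl T0 (pw M k)) (pr _ _)) ((injmP i).2 ii).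
    move=> x; apply/iE; rewrite mcompE qc mhomDE !mcompE mhD !dsE addr0.
    by rewrite (iE0 _).2 ?mh0 //; exists (pl _ _ x).
  apply: (@gen_surj _ _ _ _ _ h); last by apply: gen_dsum => //; apply/gen_pw/gen_refl.
  apply/surjmP => t; have [v vE] := (surjmP c).1 cs (i t).
  have : be (r0 (pl _ _ v)) = 0 by rewrite -qc vE; apply/iE; exists t.
  move=> /bE [w wE]; have [e eE] := (surjmP r1).1 (fq_surj hr1) w.
  have /iE0 [x xE] : r0 (pl _ _ v - ep e) = 0 by rewrite mhB epE' eE wE subrr.
  exists (dl _ _ x + dr _ _ (pr _ _ v - al e)); apply: (injm_inj ((injmP i).2 ii)).
  rewrite -mcompE hE -vE mcompE; apply/eqP; rewrite -subr_eq0 -mhB; apply/eqP/cE.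
  exists (- e); rewrite WE mhomDE !mcompE !(mhD, dsE, mh0, addr0, add0r) xE.
  rewrite [X in _ = _ - X]dsumE !mhN !mhB opprD addrACA.
  by congr (_ + _); rewrite addrAC subrr sub0r.
move=> Y Yb qY tY hqY tb; have VY := tor_V tY.
apply: (ext1_crit cs).
- exact/limg_kerP.
- exact: (ext1_dsum (eE0 Y tY) (@ext1_pw _ _ _ k _ (tor_ext1 tY))).
move=> g; have hMYb := fq_hom0 hqY.
have [gb gbE] := fq_univ (qY \m g) hr1 hMYb.
have /(torP aJ _ hd JB) [_ /(_ gb) [hb hbE]] := tb.
have [g0 g0E] := fq_lift r0 hb hqY xE0.
have [TY [iY [VTY /sexP [iiY iEY _] gTY _]]] := hqY.
(* The remainder lands in the part of [Y] generated by [M]. It lifts to a power of [M], because the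
   kernel of that cover lies in [tor V M], and there it factors through [al]. *)
have [|g' gE'] := @factor_inj _ _ _ _ _ iY (g - g0 \m ep) ((injmP iY).2 iiY).
  move=> x; apply/iEY; rewrite mhomBE mhB -!mcompE mcompA g0E -(mcompA hb) epE mcompA hbE gbE.
  exact: subrr.
have [l [T' [kk [q' [VT' se' tT']]]]] := approx_ker rM VTY gTY.
have [h hE] := ext_lift g' (eE1 T' tT') se'.
have [h' hE'] := pw_lift_in alu h.
exists (copair g0 (iY \m q' \m h')); rewrite copair_mpair -!mcompA hE' hE gE'.
by rewrite addrC subrK.
Qed.

Lemma lift_indec M B : rig M -> indecomposable B -> tor (J V M) B B ->
  exists N (q : mhom N B), [/\ indecomposable N, tor V M N, fq M q, tor V N N &
  forall Y Yb (qY : mhom Y Yb), tor V M Y -> fq M qY -> tor (J V M) B Yb -> ext1_zero N Y].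
Proof.
move=> rM iB tB; have VM := tor_V rM; have JB := tor_V tB.
have [N [q [tN hq eN]]] := lift_rigid rM JB.
have [N' [q' [s iN hq']]] := fq_indec_part rM (tor_V tN) hq iB.
have tN' : tor V M N' by apply: tor_summandr s tN.
have eN' Y Yb (qY : mhom Y Yb) : tor V M Y -> fq M qY -> tor (J V M) B Yb -> ext1_zero N' Y.
  by move=> tY hY tb; apply: (ext1_summand s); apply: eN hY tb.
exists N', q'; split=> //; split; first exact: tor_V tN'.
move=> Y r VY rs; have tY := tor_quo rs VY tN'.
have [Yb [qY [VYb hY]]] := fq_exists aV rM VY.
apply: (eN' _ _ _ tY hY); have [g gE] := fq_univ (qY \m r) hq' (fq_hom0 hY).
have VM0 : V M := VM; have JYb := fq_J aV VM0 hY tY.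
apply: (@tor_quo _ _ _ _ _ _ g _ JYb tB).
by apply: (@surj_compl _ _ _ _ _ _ q'); rewrite gE; apply: surjm_comp (fq_surj hY) rs.
Qed.

Definition fin (U : fdmod A -> Prop) := exists p (L : 'I_p -> fdmod A),
  forall X, indecomposable X -> tor U X X -> exists i, misom X (L i).

Lemma fin_J M : rig M -> fin V -> fin (J V M).
Proof.
move=> rM [p [L hL]].
have H i : exists Y, V (L i) -> exists q : mhom (L i) Y, fq M q.
  have [Vi|nV] := classic (V (L i)); last by exists mod0.
  by have [Y [q [_ hq]]] := fq_exists aV rM Vi; exists Y => _; exists q.
have [L' hL'] := choice _ H; exists p, L' => B iB tB.
have [N [q [iN tN hq rN _]]] := lift_indec rM iB tB.
have [i h] := hL N iN rN; exists i.
have Vi := wide_iso hV h (tor_V tN); have [q' hq'] := hL' i Vi.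
case: (h) => f [fi fs]; exact: (fq_iso hq (fq_compr hq' fi fs)).
Qed.

(** * Reduction at a pair *)

Section Pair.
Variables (C X B : fdmod A) (q : mhom X B).
Hypotheses (rC : rig C) (rX : rig X) (tCX : tor V C X) (tXC : tor V X C).
Hypotheses (iX : indecomposable X) (nX : ~ gen C X) (hq : fq C q).

Let VC := tor_V rC.
Let VX := tor_V rX.

Let xX Z : V Z -> gen C Z -> ext1_zero X Z.
Proof. by move=> VZ gZ; apply: (@tor_ext1 _ _ V); apply: (tor_gen aV VX tXC gZ VZ). Qed.

Lemma pair_nz : ~ is_zero B.
Proof. by move=> B0; apply: nX; apply: (fq_zero VC hq B0). Qed.

Lemma pair_J : J V C B.
Proof. exact: fq_J hq tCX. Qed.

(** An idempotent of [B] lifts to an endomorphism of the indecomposable [X]. By Fitting's lemma this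
    is onto or nilpotent, hence so is the idempotent, which is then 1 or 0. *)
Lemma pair_indec : indecomposable B.
Proof.
split; first exact: pair_nz.
move=> B1 B2 /misomP [f [g [e1 e2]]].
pose e := (g \m dl B1 B2) \m (pl B1 B2 \m f).
have ee : e \m e = e.
  by rewrite /e -!mcompA (mcompA f) e2 mcomp1l (mcompA (pl _ _)) pldl mcomp1l.
have [h hE] := fq_lift q e hq xX.
case: (indec_fitting h iX) => [hs|[n nE]].
  right; have es : surjm e.
    by apply: (@surj_compl _ _ _ _ _ _ q); rewrite -hE; apply: surjm_comp (fq_surj hq) hs.
  have z : pr B1 B2 \m f \m e = 0.
    by rewrite /e -!mcompA (mcompA f) e2 mcomp1l (mcompA (pr _ _)) prdl mcomp0l.
  have f0 : pr B1 B2 \m f = 0 by apply: (surj_epi es); rewrite z mcomp0l.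
  apply/is_zero_mid; rewrite -(prdr B1 B2) -[pr _ _]mcomp1r -e2 mcompA f0 !mcomp0l.
  exact: erefl.
left; have H k : q \m mexp h k.+1 = e \m q.
  elim: k => [|k IH]; first by rewrite /mexp /= mcomp1r hE.
  by rewrite mexpS mcompA hE -mcompA IH mcompA ee.
have e0 : e = 0.
  by apply: (surj_epi (fq_surj hq)); rewrite -(H n) mexpS nE !mcomp0r mcomp0l.
apply/is_zero_mid; have -> : mid B1 = pl B1 B2 \m f \m e \m (g \m dl B1 B2).
  rewrite /e -!mcompA (mcompA f g) e2 mcomp1l (mcompA f g) e2 mcomp1l pldl mcomp1r.
  by rewrite pldl.
by rewrite e0 mcomp0r mcomp0l.
Qed.

Lemma fq_ext1 Y : J V C Y -> ext1_zero X Y -> ext1_zero B Y.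
Proof.
move=> JY hY E i r se; have [h hE] := ext_lift q hY se.
have JE : J V C E := wide_ext (wide_J aV VC) JY pair_J se.
have [s sE] := fq_univ h hq ((JP aV E VC).1 JE).2.
by exists s; apply: (surj_epi (fq_surj hq)); rewrite -mcompA sE hE mcomp1l.
Qed.

Lemma pair_tor Z : J V C Z -> tor V X Z -> tor (J V C) B Z.
Proof.
move=> JZ tZ; split=> // Y r JY rs; apply: fq_ext1 => //.
by apply: (@tor_ext1 _ _ V); exact: (tor_quo rs (J_V aV VC JY) tZ).
Qed.

Lemma pair_rigid : tor (J V C) B B.
Proof.
apply: (pair_tor pair_J).
exact: (tor_quo (fq_surj hq) (J_V aV VC pair_J) rX).
Qed.

(** The lift [N] of [B] built by [lift_rigid] has the same torsion-free quotient as [X], so [X] is a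
    summand of it and inherits its vanishing extensions. *)
Lemma pair_tor_inv Z : tor (J V C) B Z -> tor V X Z.
Proof.
move=> tZ; have JZ := tor_V tZ; have [N [p [tN hp eN]]] := lift_rigid rC pair_J.
have aJ := abcat_J aV rC.
have sXN : summand X N.
  apply: (lift_summand iX pair_nz hq hp (misom_refl B) xX) => Y VY gY.
  apply: (eN Y mod0 0 (tor_gen aV VC rC gY VY)).
    exact: fq_to_zero VY gY mod0_zero.
  exact/(tor_zero aJ)/mod0_zero.
split=> [|Y r VY rs]; first exact: (J_V aV VC JZ).
apply: (ext1_summand sXN).
have [tCZ _] := (JP aV Z VC).1 JZ; have tY := tor_quo rs VY tCZ.
have [Yb [qY [VYb hY]]] := fq_exists aV rC VY.
have JYb := fq_J aV VC hY tY; apply: (eN _ _ _ tY hY).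
exact: (tor_quo (surjm_comp (fq_surj hY) rs) JYb tZ).
Qed.

(** Reduction in two steps agrees with reduction at the sum: on objects orthogonal to [C] the maps
    from [X] and from [B] agree, and the torsion classes correspond by [pair_tor] and
    [pair_tor_inv]. *)
Lemma pair_JJ Z : J (J V C) B Z <-> J V (dsum C X) Z.
Proof.
have aJ := abcat_J aV rC; have VD : V (dsum C X) by apply: wide_dsum.
rewrite (JP aJ Z pair_J) (JP aV Z VD); split=> [[tZ hZ]|[tZ hZ]].
  have [tCZ hCZ] := (JP aV Z VC).1 (tor_V tZ).
  split; first by apply: tor_dsuml => //; apply: pair_tor_inv.
  have hXZ : hom0 X Z by apply: (fq_hom0r hq hCZ).1.
  by move=> f; rewrite [f]copair_eta (hCZ (f \m _)) (hXZ (f \m _)) /copair !mcomp0l addr0.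
have hCZ : hom0 C Z by apply: surj_injm_hom0 hZ; apply: retr_surj (pldl C X).
have hXZ : hom0 X Z by apply: surj_injm_hom0 hZ; apply: retr_surj (prdr C X).
have JZ : J V C Z.
  by apply/(JP aV Z VC); split=> //; apply: (tor_summandl (summand_dl C X) tZ).
split; last exact/(fq_hom0r hq hCZ).
exact: pair_tor JZ (tor_summandl (summand_dr C X) tZ).
Qed.

End Pair.
End Lifting.

Definition pb (P : Prop) : bool := if excluded_middle_informative P then true else false.

Lemma pbP P : reflect P (pb P).
Proof. by rewrite /pb; case: excluded_middle_informative => h; constructor. Qed.

(** * Support tau-tilting objects and the g-vector fan *)

Section Silting.
Context {K : fieldType} {A : falgType K}.
Implicit Types (M N P Q S T X Y Z B C E R G : fdmod A).

Definition rigid_list (V : fdmod A -> Prop) p (L : 'I_p -> fdmod A) :=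
  [/\ forall i, indecomposable (L i), forall i, tor V (L i) (L i),
      forall X, indecomposable X -> tor V X X -> exists i, misom X (L i)
    & forall i j, misom (L i) (L j) -> i = j].

Lemma rigid_list_exists V : abcat V -> fin V -> exists p (L : 'I_p -> fdmod A), rigid_list V L.
Proof.
move=> aV [p [L hL]].
pose S := [set i : 'I_p | pb (indecomposable (L i) /\ tor V (L i) (L i)) &
  [forall j : 'I_p, (j < i)%N ==> ~~ pb (misom (L j) (L i))]].
exists #|S|, (fun k => L (enum_val k)).
have inS (k : 'I_#|S|) : enum_val k \in S := enum_valP k.
split.
- by move=> k; have := inS k; rewrite inE => /andP [/pbP []].
- by move=> k; have := inS k; rewrite inE => /andP [/pbP []].
- move=> X iX tX; have [i0 h0] := hL X iX tX.
  have ex : exists i, pb (misom X (L i)) by exists i0; apply/pbP.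
  case: (arg_minnP (P := fun i => pb (misom X (L i))) (fun i : 'I_p => i : nat) (introT (pbP _) h0)) => i /pbP h hmin.
  have iS : i \in S.
    rewrite inE; apply/andP; split.
      apply/pbP; split; first exact: indec_iso h iX.
      exact: (tor_isol h (tor_iso aV h tX)).
    apply/forallP => j; apply/implyP => ji; apply/negP => /pbP hj.
    have := hmin j (introT (pbP _) (misom_trans h (misom_sym hj))).
    by rewrite leqNgt ji.
  by exists (enum_rank_in iS i); rewrite enum_rankK_in.
- move=> k l h; apply: enum_val_inj; apply: val_inj; apply/eqP.
  have key (a b : 'I_p) : a \in S -> b \in S -> misom (L a) (L b) -> (b <= a)%N.
    move=> _; rewrite inE => /andP [_ /forallP /(_ a)] /implyP hb hab.
    by rewrite leqNgt; apply/negP => /hb /negP; apply; apply/pbP.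
  by rewrite eqn_leq (key _ _ (inS k) (inS l) h) (key _ _ (inS l) (inS k) (misom_sym h)).
Qed.

Variable V : fdmod A -> Prop.
Hypothesis aV : abcat V.
Let hV := ab_w aV.
Let hG := ab_g aV.
Notation proj := (projective_in V).
Notation rig M := (tor V M M).
Notation fq := (fq V).

Variables (p : nat) (L : 'I_p -> fdmod A).
Hypothesis hL : rigid_list V L.

Let Li i : indecomposable (L i). Proof. by case: hL. Qed.
Let Lr i : rig (L i). Proof. by case: hL. Qed.
Let LV i : V (L i). Proof. exact: tor_V (Lr i). Qed.
Let Lx X : indecomposable X -> rig X -> exists i, misom X (L i). Proof. by case: hL => _ _ + _; apply. Qed.
Let Lu i j : misom (L i) (L j) -> i = j. Proof. by case: hL => _ _ _; apply. Qed.

Definition bs (S : pred 'I_p) := \big[dsum/mod0]_(j < p | S j) L j.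

Lemma bs_V (S : pred 'I_p) : V (bs S).
Proof.
by apply: big_ind => [|X Y|i _]; [apply: (wide_zero hV) | apply: (wide_dsum hV) | apply: LV].
Qed.

Lemma bs_summand (S : pred 'I_p) i : S i -> summand (L i) (bs S).
Proof.
move=> Si; rewrite /bs; have : i \in index_enum 'I_p by rewrite mem_index_enum.
elim: (index_enum 'I_p) => // j s IH; rewrite inE big_cons => /orP [/eqP <-|/IH h].
  by rewrite Si; apply: summand_dl.
by case: ifP => // _; apply: summand_trans h (summand_dr _ _).
Qed.

Lemma bs_indec (S : pred 'I_p) X : indecomposable X -> summand X (bs S) -> exists2 j, S j & misom X (L j).
Proof.
move=> iX; apply: (@big_ind _ (fun M => summand X M -> exists2 j, S j & misom X (L j))).
- move=> /summandP [s [r e]]; case: iX => X0 _; case: X0; apply/is_zero_mid.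
  by rewrite -e -[r]mcomp1r ((is_zero_mid mod0).1 mod0_zero) mcomp0r mcomp0l.
- by move=> U W hU hW /(indec_summand_dsum iX) [].
- by move=> j Sj s; exists j => //; apply: indec_summand s => //; case: iX.
Qed.

Lemma bs_torl (S : pred 'I_p) Z : V Z -> (forall i, S i -> tor V (L i) Z) -> tor V (bs S) Z.
Proof.
move=> VZ h; apply: (@big_ind _ (fun M => tor V M Z)) => //.
  exact: (tor_zerol mod0_zero).
by move=> X Y; apply: tor_dsuml.
Qed.

Lemma bs_torr (S : pred 'I_p) Y : V Y -> (forall i, S i -> tor V Y (L i)) -> tor V Y (bs S).
Proof.
move=> VY h; apply: (@big_ind _ (fun M => tor V Y M)) => //.
  exact/(tor_zero aV)/mod0_zero.
by move=> X Z; apply: tor_dsumr.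
Qed.

Lemma bs_hom0l (S : pred 'I_p) Z : (forall i, S i -> hom0 (L i) Z) -> hom0 (bs S) Z.
Proof.
move=> h; apply: (@big_ind _ (fun M => hom0 M Z)) => //.
  by apply/hom0_dim/hm_zerol/mod0_zero.
by move=> X Y /hom0_dim h1 /hom0_dim h2; apply/hom0_dim; rewrite hm_dsuml h1 h2.
Qed.

Lemma bs_gen (S : pred 'I_p) N : (forall i, S i -> gen N (L i)) -> gen N (bs S).
Proof.
move=> h; apply: (@big_ind _ (fun M => gen N M)) => //; first exact/gen_zero/mod0_zero.
by move=> X Y; apply: gen_dsum.
Qed.

Lemma bs_proj (S : pred 'I_p) : (forall i, S i -> proj (L i)) -> proj (bs S).
Proof.
move=> h; apply: big_ind => //; first exact/(proj_zero hV)/mod0_zero.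
by move=> X Y; apply: proj_dsum.
Qed.

Lemma bs_hom0 (S : pred 'I_p) Z i : S i -> hom0 (bs S) Z -> hom0 (L i) Z.
Proof.
move=> Si h; have /summandP [s [r e]] := bs_summand Si.
exact: surj_injm_hom0 (retr_surj e) h.
Qed.

Lemma hom0_gen P N Z : proj P -> V N -> hom0 P N -> gen N Z -> V Z -> hom0 P Z.
Proof.
move=> hP VN h [m [q qs]] VZ f; have [g <-] := proj_lift f hP (wide_pw hV m VN) VZ qs.
by rewrite (hom0_pwr (m := m) h g) mcomp0r.
Qed.

Definition th i := theta V (L i).

Lemma th_tor i Z : tor V (L i) Z -> th i Z = (hm (L i) Z)%:Z.
Proof. exact: theta_tor. Qed.

Lemma th_hom0 i Z : V Z -> hom0 (L i) Z -> th i Z <= 0.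
Proof. by move=> VZ h; have [] := theta_hom0 aV (LV i) VZ h. Qed.

Lemma th_tor0 i Z : tor V (L i) Z -> hom0 (L i) Z -> th i Z = 0.
Proof. by move=> t /hom0_dim h; rewrite th_tor // h. Qed.

(** The g-vector of a formal sum of modules [L i] and shifts [L i [1]]; the coefficients [b] are
    meant for projective [L i], whose shift has weight -[L i]. *)
Definition comb (a b : 'I_p -> int) Z := \sum_i a i * th i Z - \sum_i b i * (hm (L i) Z)%:Z.

Lemma gfun_sum (I : finType) (f : I -> fdmod A -> int) : (forall i, gfun V (f i)) ->
  gfun V (fun Z => \sum_i f i Z).
Proof.
move=> h; have main (s : seq I) : gfun V (fun Z => \sum_(i <- s) f i Z).
  elim: s => [|i s IH].
    by apply: (@gfun_ext _ _ V (fun=> 0)) => [Z|]; rewrite ?big_nil //; apply: gfun0.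
  by apply: (@gfun_ext _ _ V (fun Z => f i Z + \sum_(i <- s) f i Z)) => [Z|];
    rewrite ?big_cons //; apply: gfunD.
exact: main.
Qed.

Section TorsionClass.
Variable N : fdmod A.
Hypothesis rN : rig N.
Let VN := tor_V rN.

Definition extN M := forall Z, V Z -> gen N Z -> ext1_zero M Z.
(* For T' = Gen N, the indices in mS are the ext-projectives of T' and those in pS the
   projectives orthogonal to it: together, the support tau-tilting object of T'. *)
Definition mS i := pb (gen N (L i) /\ extN (L i)).
Definition pS i := pb (proj (L i) /\ hom0 (L i) N).

Lemma mSP i : mS i -> gen N (L i) /\ extN (L i). Proof. by move/pbP. Qed.
Lemma pSP i : pS i -> proj (L i) /\ hom0 (L i) N. Proof. by move/pbP. Qed.

Lemma mS_tor i Z : mS i -> gen N Z -> V Z -> tor V (L i) Z.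
Proof.
move=> /mSP [_ e] gZ VZ; split=> // Y q VY qs; apply: e => //; exact: gen_surj qs gZ.
Qed.

Lemma pS_hom0 i Z : pS i -> gen N Z -> V Z -> hom0 (L i) Z.
Proof. by move=> /pSP [hP h] gZ VZ; apply: hom0_gen gZ VZ. Qed.

Definition spanned (phi : fdmod A -> int) := exists a b : 'I_p -> int,
  [/\ forall i, a i != 0 -> mS i, forall i, b i != 0 -> pS i & forall Z, phi Z = comb a b Z].

Lemma spannedD f g : spanned f -> spanned g -> spanned (fun Z => f Z + g Z).
Proof.
move=> [a [b [ha hb e]]] [a' [b' [ha' hb' e']]].
exists (fun i => a i + a' i), (fun i => b i + b' i); split=> [i|i|Z].
- have [->|/ha //] := eqVneq (a i) 0; rewrite add0r; exact: ha'.
- have [->|/hb //] := eqVneq (b i) 0; rewrite add0r; exact: hb'.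
rewrite e e' /comb; under [X in _ = X - _]eq_bigr => i _ do rewrite mulrDl.
under [X in _ = _ - X]eq_bigr => i _ do rewrite mulrDl.
by rewrite !big_split opprD addrACA.
Qed.

Lemma spannedN f : spanned f -> spanned (fun Z => - f Z).
Proof.
move=> [a [b [ha hb e]]]; exists (fun i => - a i), (fun i => - b i); split=> [i|i|Z].
- by rewrite oppr_eq0; apply: ha.
- by rewrite oppr_eq0; apply: hb.
rewrite e /comb; under [X in _ = X - _]eq_bigr => i _ do rewrite mulNr.
under [X in _ = _ - X]eq_bigr => i _ do rewrite mulNr.
by rewrite !sumrN opprB opprK addrC.
Qed.

Lemma spanned0 f : (forall Z, f Z = 0) -> spanned f.
Proof.
move=> h; exists (fun=> 0), (fun=> 0); split=> [i|i|Z]; rewrite ?eqxx //.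
by rewrite h /comb !big1 ?subrr // => i _; rewrite mul0r.
Qed.

Lemma spanned_ext f g : (forall Z, f Z = g Z) -> spanned f -> spanned g.
Proof. by move=> h [a [b [ha hb e]]]; exists a, b; split=> // Z; rewrite -h. Qed.

Lemma sum_delta (i : 'I_p) (f : 'I_p -> int) : \sum_j (j == i)%:Z * f j = f i.
Proof.
by rewrite (bigD1 i) //= eqxx mul1r big1 ?addr0 // => j /negPf ->; rewrite mul0r.
Qed.

Lemma spanned_theta M : V M -> gen N M -> extN M -> spanned (theta V M).
Proof.
move: M; apply: indec_ind.
- move=> X Y h IH VY gY eY; have VX := wide_iso hV (misom_sym h) VY.
  apply: (spanned_ext (f := theta V X)); first by move=> Z; apply: theta_iso.
  apply: IH => //; first exact: gen_iso (misom_sym h) gY.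
  by move=> Z VZ gZ; apply: (ext1_isol h); apply: eY.
- by move=> X X0 VX _ _; apply: spanned0 => Z; apply: theta_zero.
- move=> X iX VX gX eX; have rX : rig X.
    by split=> // Y q VY qs; apply: eX => //; apply: gen_surj qs gX.
  have [i h] := Lx iX rX; exists (fun j => (j == i)%:Z), (fun=> 0); split=> [j|j|Z].
  + have [->|] := eqVneq j i => // _; apply/pbP; split; first exact: gen_iso h gX.
    by move=> Z VZ gZ; apply: (ext1_isol (misom_sym h)); apply: eX.
  + by rewrite eqxx.
  rewrite /comb sum_delta big1 => [|j _]; last by rewrite mul0r.
  by rewrite subr0; apply: theta_iso.
move=> X Y IHX IHY VXY gXY eXY.
have VX := wide_summand hV (summand_dl X Y) VXY; have VY := wide_summand hV (summand_dr X Y) VXY.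
apply: (spanned_ext (f := fun Z => theta V X Z + theta V Y Z)).
  by move=> Z; rewrite theta_dsum.
apply: spannedD; [apply: IHX | apply: IHY] => //.
- exact: gen_surj (retr_surj (pldl X Y)) gXY.
- by move=> Z VZ gZ; apply: (ext1_summand (summand_dl X Y)); apply: eXY.
- exact: gen_surj (retr_surj (prdr X Y)) gXY.
- by move=> Z VZ gZ; apply: (ext1_summand (summand_dr X Y)); apply: eXY.
Qed.

Lemma spanned_orth Q : proj Q -> hom0 Q N -> spanned (fun Z => (hm Q Z)%:Z).
Proof.
move: Q; apply: indec_ind.
- move=> X Y h IH hY hN; apply: (spanned_ext (f := fun Z => (hm X Z)%:Z)).
    by move=> Z; rewrite (hm_isol Z h).
  apply: IH; first exact: proj_iso hV _ _ (misom_sym h) hY.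
  by apply/hom0_dim; rewrite (hm_isol N h); apply/hom0_dim.
- by move=> X X0 _ _; apply: spanned0 => Z; rewrite hm_zerol.
- move=> X iX hX hN; have [i h] := Lx iX (tor_proj aV hX (proj_V hX)).
  exists (fun=> 0), (fun j => - (j == i)%:Z); split=> [j|j|Z].
  + by rewrite eqxx.
  + rewrite oppr_eq0; have [->|] := eqVneq j i => // _; apply/pbP.
    split; first exact: proj_iso hV _ _ h hX.
    by apply/hom0_dim; rewrite -(hm_isol N h); apply/hom0_dim.
  rewrite /comb big1 => [|j _]; last by rewrite mul0r.
  under eq_bigr => j _ do rewrite mulNr.
  by rewrite sumrN sum_delta opprK add0r (hm_isol Z h).
move=> X Y IHX IHY hXY /hom0_dim; rewrite hm_dsuml => /eqP; rewrite addn_eq0 => /andP [/eqP h1 /eqP h2].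
apply: (spanned_ext (f := fun Z => (hm X Z)%:Z + (hm Y Z)%:Z)).
  by move=> Z; rewrite hm_dsuml PoszD.
apply: spannedD; [apply: IHX | apply: IHY]; try exact/hom0_dim.
  exact: proj_summand hV _ _ (summand_dl X Y) hXY.
exact: proj_summand hV _ _ (summand_dr X Y) hXY.
Qed.

(** A left [add N]-approximation of [R] with cokernel [N1] expresses [R] through the g-vectors of
    the power of [N] and of [N1], both Ext-projective in Gen N. The presentation of [N1] obtained
    this way need not be minimal; its defect [Q] is a projective orthogonal to [N], which accounts
    for the shifted part. *)
Lemma spanned_proj R : proj R -> spanned (fun Z => (hm R Z)%:Z).
Proof.
move=> hR; have [k [al alu]] := univ_in N R.
have VNk := wide_pw hV k VN; have VR := proj_V hR.
have [N1 [c [VN1 cs cE]]] := coker_V hV al VR VNk.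
have gN1 : gen N N1 by apply: gen_surj cs (gen_pw k (gen_refl N)).
have eN1 : extN N1.
  move=> Z VZ gZ; have cE' : limg al = lker c by apply/limg_kerP.
  apply: (ext1_crit cs cE') => [|f].
    by apply/ext1_pw/(@tor_ext1 _ _ V)/(tor_gen aV VN rN gZ).
  have [m [q qs]] := gZ; have [f' <-] := proj_lift f hR (wide_pw hV m VN) VZ qs.
  have [h hE] := pw_lift_in alu f'; exists (q \m h).
  by rewrite -mcompA hE.
have [P1 [P0 [d [pp hd]]]] := min_pres_exists hV hG VNk.
have [[hP1 hP0 ps dE] _] := hd; have pE := (limg_kerP _ _).1 dE.
have [a aE] := proj_lift al hR (proj_V hP0) VNk ps.
have aE' v : pp (a v) = al v by rewrite -mcompE aE.
have pd v : pp (d v) = 0 by apply/pE; exists v.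
have DE : limg (copair a d) = lker (c \m pp).
  apply/limg_kerP => w; rewrite mcompE cE; split=> [[r rE]|[v <-]].
    have /pE [y yE] : pp (w - a r) = 0 by rewrite mhB aE' rE subrr.
    by exists (dl _ _ r + dr _ _ y); rewrite copairE !(mhD, dsE, mh0, addr0, add0r) yE addrC subrK.
  by exists (pl _ _ v); rewrite copairE mhD aE' pd addr0.
have [Q [hQ QE Q0 _]] := theta_nonmin aV VN1 (proj_dsum hV hR hP1) hP0 (surjm_comp cs ps) DE.
have QN : hom0 Q N.
  apply: Q0 => f.
  have /(torP aV _ hd VNk) [_ /(_ (f \m dr _ _)) [g gE]] := tor_pwl k rN.
  have [h hE] := alu (f \m dl _ _ - g \m a).
  exists (g + h \m pp); rewrite copair_comp [RHS]copair_eta; congr copair.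
    by rewrite mcompDl -mcompA aE hE addrC subrK.
  rewrite mcompDl -mcompA gE (_ : pp \m d = 0) ?mcomp0r ?addr0 //.
  by apply: mhom_eq => v; rewrite mcompE mhom0E.
apply: (spanned_ext (f := fun Z => theta V (pw N k) Z + - theta V N1 Z + (hm Q Z)%:Z)).
  move=> Z; have := QE Z; rewrite (theta_pres aV Z VNk hd) hm_dsuml PoszD => e.
  have -> : theta V N1 Z = (hm P0 Z)%:Z - ((hm R Z)%:Z + (hm P1 Z)%:Z) + (hm Q Z)%:Z by rewrite e; ring.
  by ring.
apply: spannedD; last exact: spanned_orth.
apply: spannedD; last by apply/spannedN/spanned_theta.
apply: spanned_theta => //; first exact/gen_pw/gen_refl.
by move=> Z VZ gZ; apply/ext1_pw/(@tor_ext1 _ _ V)/(tor_gen aV VN rN gZ).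
Qed.

Lemma spanned_gfun phi : gfun V phi -> spanned phi.
Proof.
move=> [P [Q [hP hQ e]]].
apply: (spanned_ext (f := fun Z => (hm P Z)%:Z + - (hm Q Z)%:Z)) => [Z|]; first by rewrite e.
by apply: spannedD; [|apply: spannedN]; apply: spanned_proj.
Qed.

Lemma span_zero Y : V Y -> (forall i, mS i -> th i Y = 0) ->
  (forall i, pS i -> hom0 (L i) Y) -> is_zero Y.
Proof.
move=> VY h1 h2; have [P [q [hP /surjmP qs]]] := enough_proj hV hG VY.
have [a [b [ha hb e]]] := spanned_proj hP.
have h0 : hom0 P Y.
  apply/hom0_dim; have := e Y; rewrite /comb !big1 ?subrr => [[]|i _|i _] //.
    by have [->|/hb /h2 /hom0_dim ->] := eqVneq (b i) 0; rewrite ?mul0r ?mulr0.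
  by have [->|/ha /h1 ->] := eqVneq (a i) 0; rewrite ?mul0r ?mulr0.
by apply/is_zeroP => y; have [x <-] := qs y; rewrite (h0 q) mhom0E.
Qed.

Definition rest i : pred 'I_p := fun j => mS j && (j != i).

Lemma rest_rig i : rig (bs (rest i)).
Proof.
apply: bs_torl; first exact: bs_V.
move=> j /andP [hj _]; apply: bs_torr => // l /andP [hl _].
by apply: mS_tor => //; case: (mSP hl).
Qed.

Lemma rest_gen i : gen N (bs (rest i)).
Proof. by apply: bs_gen => j /andP [/mSP []]. Qed.

(** Otherwise the kernels of approximations of [L i] by the other summands would lie in Gen N, and
    Ext-projectivity would make [L i] a summand of the others. So a summand generated by the others
    is one at which the torsion class can grow. *)
Lemma dich1 i : mS i -> gen (bs (rest i)) (L i) -> exists Z,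
  [/\ V Z, forall j, mS j -> j != i -> tor V (L j) Z, forall j, pS j -> hom0 (L j) Z & ~ gen N Z].
Proof.
move=> hi gi; apply: NNPP => H.
have [|m /(indec_summand_pw (Li i))/(bs_indec (Li i)) [j /andP [_ /eqP ji] /Lu e]] :=
  extp_add aV (rest_rig i) (LV i) gi; last by apply: ji.
move=> T m k VT ki tT; have [_ ei] := mSP hi; apply: ei => //.
apply: NNPP => nT; apply: H; exists T; split=> //.
  move=> j hj ji; apply: tor_summandl tT; apply: bs_summand; exact/andP.
move=> j hj; apply: (inj_hom0 ki); apply: hom0_pwr.
have [hP h] := pSP hj; exact: (hom0_gen hP VN h (rest_gen i) (bs_V _)).
Qed.

(** [Z] is the target of the map [eta] of [bongartz_kill] for [R] = [L i], divided by the trace of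
    the remaining shifted projectives [A']. If [Z] were in Gen N, [eta] would vanish in [Z] and so
    factor through a power of [A']. *)
Lemma dich2 i : pS i -> exists Z,
  [/\ V Z, forall j, mS j -> tor V (L j) Z, forall j, pS j -> j != i -> hom0 (L j) Z & ~ gen N Z].
Proof.
move=> hi; have [hP hN] := pSP hi.
pose M := bs mS; pose A' := bs (fun j => pS j && (j != i)).
have rM : rig M.
  apply: bs_torl; first exact: bs_V.
  move=> j hj; apply: bs_torr => // l hl; apply: mS_tor => //; by case: (mSP hl).
have pA : proj A' by apply: bs_proj => j /andP [/pSP []].
have gM : gen N M by apply: bs_gen => j /mSP [].
have hAM : hom0 A' M by apply: bs_hom0l => j /andP [hj _]; apply: pS_hom0 => //; apply: bs_V.
have nA : ~ summand (L i) A'.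
  by move=> /(bs_indec (Li i)) [j /andP [_ /eqP ji] /Lu e]; apply: ji.
have [E [eta [tE eE kill]]] := bongartz_kill aV rM hP (Li i).
have VA := proj_V pA; have [Z [q [VZ hq]]] := fq_exists aV (tor_proj aV pA VA) (tor_V tE).
have tZ := tor_quo (fq_surj hq) VZ tE.
exists Z; split=> //.
- by move=> j hj; apply: tor_summandl tZ; apply: bs_summand.
- move=> j hj ji; apply: (@bs_hom0 (fun j => pS j && (j != i))); first exact/andP.
  exact: fq_hom0 hq.
move=> gZ; have h0 := pS_hom0 hi gZ VZ.
have [T [u [VT /sexP [ui uE _] [m [r rs]] _]]] := hq.
have [|e eE'] := @factor_inj _ _ _ _ _ u eta ((injmP u).2 ui).
  by move=> x; apply/uE; rewrite -mcompE (h0 (q \m eta)) mhom0E.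
have [f fE] := proj_lift e hP (wide_pw hV m VA) VT rs.
apply: (kill (pw A' m) f (u \m r)).
- exact: proj_pw.
- exact: hom0_pwl.
- by move/(indec_summand_pw (Li i)).
- by rewrite -mcompA fE.
Qed.

Lemma comb_at1 a b i Y : (forall j, a j != 0 -> j != i -> th j Y = 0) ->
  (forall j, b j != 0 -> hom0 (L j) Y) -> comb a b Y = a i * th i Y.
Proof.
move=> h1 h2; rewrite /comb (bigD1 i) //= big1 => [|j ji]; last first.
  by have [->|/h1 ->] := eqVneq (a j) 0; rewrite ?mul0r ?mulr0.
rewrite addr0 big1 ?subr0 // => j _.
by have [->|/h2 /hom0_dim ->] := eqVneq (b j) 0; rewrite ?mul0r ?mulr0.
Qed.

Lemma comb_at2 a b i Y : (forall j, a j != 0 -> th j Y = 0) ->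
  (forall j, b j != 0 -> j != i -> hom0 (L j) Y) -> comb a b Y = - (b i * (hm (L i) Y)%:Z).
Proof.
move=> h1 h2; rewrite /comb big1 => [|j _]; last first.
  by have [->|/h1 ->] := eqVneq (a j) 0; rewrite ?mul0r ?mulr0.
rewrite sub0r (bigD1 i) //= big1 ?addr0 // => j ji.
by have [->|/h2 h] := eqVneq (b j) 0; rewrite ?mul0r // ((hom0_dim _ _).1 (h ji)) mulr0.
Qed.

End TorsionClass.

(** * Every integral weight lies in a cone of compatible objects *)

(** The larger of the two torsion classes attached to a weight by King stability: the
    [phi]-semistable objects are those of weight 0 in it. *)
Definition Tbar (phi : fdmod A -> int) Z :=
  V Z /\ forall Y (q : mhom Z Y), V Y -> surjm q -> 0 <= phi Y.

Lemma Tbar_quo phi Z Y (q : mhom Z Y) : surjm q -> V Y -> Tbar phi Z -> Tbar phi Y.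
Proof.
by move=> qs VY [VZ h]; split=> // W r VW rs; apply: (h W (r \m q)) => //; apply: surjm_comp.
Qed.

Lemma Tbar_val phi Z : Tbar phi Z -> 0 <= phi Z.
Proof. by move=> [VZ h]; apply: (h Z (mid Z)) => //; apply: surj_mid. Qed.

(** If the weight of [Z] is nonnegative and [Z] is not in the class, some quotient has negative
    weight; its kernel has positive weight and smaller dimension, and receives a nonzero map from
    the class by induction. *)
Lemma Tbar_orth phi Z : gfun V phi -> V Z -> ~ is_zero Z ->
  (forall T, Tbar phi T -> hom0 T Z) -> phi Z < 0.
Proof.
move=> /(gfun_additive aV) [phi_iso phi_add] VZ Z0 h; rewrite ltNge; apply/negP => pos.
suff [T [tT [f f0]]] : exists T, Tbar phi T /\ exists f : mhom T Z, f <> 0 by apply/f0/h.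
move: pos VZ Z0 {h}; have [k] := ubnP (dm Z); elim: k Z => // k IH Z; rewrite ltnS => lt pos VZ Z0.
have [t|nt] := classic (Tbar phi Z).
  exists Z; split=> //; exists (mid Z) => e; apply: Z0; exact/is_zero_mid.
have [Y [q [VY qs neg]]] : exists Y (q : mhom Z Y), [/\ V Y, surjm q & phi Y < 0].
  apply: NNPP => H; apply: nt; split=> // Y q VY qs.
  by rewrite leNgt; apply/negP => lt0; apply: H; exists Y, q.
have [S [i [VS se]]] := quo_seV hV qs VZ VY.
have e := phi_add _ _ _ _ _ VS VZ VY se.
have Spos : 0 < phi S by rewrite -(ltrD2r (phi Y)) add0r -e; apply: lt_le_trans neg pos.
have aphi : additive_on V phi by [].
have S0 : ~ is_zero S by move=> /(additive0 aV aphi) E; rewrite E ltxx in Spos.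
have Y0 : ~ is_zero Y by move=> /(additive0 aV aphi) E; rewrite E ltxx in neg.
have ltS : (dm S < k)%N.
  apply: leq_trans lt; rewrite (sex_dim se) -[X in (X < _)%N]addn0 ltn_add2l lt0n.
  by apply/eqP => /dm0.
have [T [tT [f f0]]] := IH S ltS (ltW Spos) VS S0.
exists T; split=> //; exists (i \m f) => e0; apply: f0.
by case: se => ii _ _; apply: (inj_mono ii); rewrite mcomp0r.
Qed.

Definition compatible (a b : 'I_p -> nat) :=
  [/\ forall i j, a i != 0%N -> a j != 0%N -> tor V (L i) (L j),
      forall i, b i != 0%N -> proj (L i)
    & forall i j, b i != 0%N -> a j != 0%N -> hom0 (L i) (L j)].

Definition cone (a b : 'I_p -> nat) := comb (fun i => (a i)%:Z) (fun i => (b i)%:Z).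

(** Start from a progenerator and shrink Gen N while it still contains [Tbar phi]. The coefficients
    of [phi] with respect to the support tau-tilting object of Gen N decide: a negative one at a
    summand not generated by the others allows that summand to be dropped. The number of [L i] in
    Gen N bounds the process, and once it stops all coefficients are nonnegative. *)
Theorem completeness phi : gfun V phi -> exists a b, compatible a b /\ forall Z, phi Z = cone a b Z.
Proof.
move=> hphi.
suff main k : forall N, rig N -> (forall Z, Tbar phi Z -> gen N Z) ->
    (#|[pred i | pb (gen N (L i))]| < k)%N ->
    exists a b, compatible a b /\ forall Z, phi Z = cone a b Z.
  have [G [hPG hgen]] := hG; have VG := proj_V hPG.
  apply: (main _ G (tor_proj aV hPG VG) _ (ltnSn _)) => Z [VZ _].
  by apply/genP/hgen.
elim: k => // k IH N rN hN lt; have VN := tor_V rN.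
have [a [b [ha hb e]]] := spanned_gfun rN hphi.
have [[i [hi ai ni]]|no] := classic (exists i, [/\ mS N i, a i < 0 & ~ gen (bs (rest N i)) (L i)]).
  have rR := rest_rig N i; have VR := tor_V rR.
  apply: (IH _ rR) => [Z tZ|].
    (* Modulo the trace of the other summands only the term at [i] survives: [phi Y] is [a i] times
       [hm (L i) Y], so it is at most 0, and membership in [Tbar] makes it 0. *)
    have VZ := proj1 tZ; have [Y [q [VY hq]]] := fq_exists aV rR VZ.
    have tY := Tbar_quo (fq_surj hq) VY tZ; have gY := hN Y tY.
    have hR j : mS N j -> j != i -> hom0 (L j) Y.
      move=> hj ji; apply: (@bs_hom0 (rest N i)); [exact/andP | exact: fq_hom0 hq].
    have z j : mS N j -> j != i -> th j Y = 0.
      by move=> hj ji; apply: th_tor0; [apply: (mS_tor hj gY VY) | apply: hR].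
    have z' j : pS N j -> hom0 (L j) Y by move=> hj; exact: (pS_hom0 rN hj gY VY).
    have := Tbar_val tY; rewrite e (@comb_at1 a b i Y); first last.
    - by move=> j /hb; apply: z'.
    - by move=> j /ha; apply: z.
    have ti := mS_tor hi gY VY; rewrite nmulr_rge0 // (th_tor ti) => le.
    apply: (fq_zero VR hq); apply: (span_zero rN VY) => // j hj.
    have [->|] := eqVneq j i; last exact: z.
    by rewrite (th_tor ti); apply/eqP; rewrite eq_le le lez_nat.
  rewrite ltnS in lt; apply: leq_trans lt; apply: proper_card; apply/properP; split.
    by apply/subsetP => j; rewrite !inE => /pbP g; apply/pbP; exact: (gen_trans (rest_gen N i) g).
  exists i; rewrite !inE; first by apply/pbP; case: (mSP hi).
  by apply/negP => /pbP.
have orth Y : V Y -> ~ is_zero Y -> hom0 N Y -> phi Y < 0.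
  move=> VY Y0 hY; apply: Tbar_orth => // T /hN gT; exact: gen_hom0 gT hY.
(* A negative coefficient now sits at a redundant summand. [dich1] gives an object whose quotient
   [Y] modulo Gen N is nonzero and has only the term at [i], a product of two nonpositive numbers,
   against [orth]. *)
have a0 i : 0 <= a i.
  rewrite leNgt; apply/negP => ai; have hi := ha i (ltr0_neq0 ai).
  have gi : gen (bs (rest N i)) (L i) by apply: NNPP => h; apply: no; exists i.
  have [Z [VZ h1 h2 nZ]] := dich1 rN hi gi.
  have [Y [q [VY hq]]] := fq_exists aV rN VZ; have hY := fq_hom0 hq.
  have Y0 : ~ is_zero Y by move=> Y0; apply: nZ; apply: fq_zero VN hq Y0.
  have hLY j : mS N j -> hom0 (L j) Y by move=> /mSP [gj _]; apply: gen_hom0 gj hY.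
  have := orth Y VY Y0 hY; rewrite e (@comb_at1 a b i Y).
  - by rewrite nmulr_rlt0 // ltNge th_hom0 //; apply: hLY.
  - move=> j /ha hj ji; apply: th_tor0; last exact: hLY.
    exact: tor_quo (fq_surj hq) VY (h1 j hj ji).
  - move=> j /hb hj f; have [hP _] := pSP hj.
    have [g <-] := proj_lift f hP VZ VY (fq_surj hq).
    by rewrite (h2 j hj g) mcomp0r.
have b0 i : 0 <= b i.
  rewrite leNgt; apply/negP => bi; have hi := hb i (ltr0_neq0 bi).
  have [Z [VZ h1 h2 nZ]] := dich2 rN hi.
  have [Y [q [VY hq]]] := fq_exists aV rN VZ; have hY := fq_hom0 hq.
  have Y0 : ~ is_zero Y by move=> Y0; apply: nZ; apply: fq_zero VN hq Y0.
  have hLY j : mS N j -> hom0 (L j) Y by move=> /mSP [gj _]; apply: gen_hom0 gj hY.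
  have := orth Y VY Y0 hY; rewrite e (@comb_at2 a b i Y).
  - by rewrite oppr_lt0 nmulr_rgt0 // ltNge lez_nat.
  - move=> j /ha hj; apply: th_tor0; last exact: hLY.
    exact: tor_quo (fq_surj hq) VY (h1 j hj).
  - move=> j /hb hj ji f; have [hP _] := pSP hj.
    have [g <-] := proj_lift f hP VZ VY (fq_surj hq).
    by rewrite (h2 j hj ji g) mcomp0r.
exists (fun i => `|a i|%N), (fun i => `|b i|%N); split=> [|Z]; last first.
  rewrite e /cone /comb; congr (_ - _); apply: eq_bigr => i _; by rewrite gez0_abs.
split=> [i j|i|i j]; rewrite !absz_eq0.
- by move=> /ha hi /ha hj; apply: (mS_tor hi _ (LV j)); case: (mSP hj).
- by move=> /hb /pSP [].
- by move=> /hb hi /ha hj; apply: (pS_hom0 rN hi _ (LV j)); case: (mSP hj).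
Qed.

(** On the quotient [Y] of [Z] modulo Gen N, with [N] the sum of the unshifted objects, every term
    of the cone is at most 0 while the total is at least 0. So all terms vanish, which puts [Y] in
    the classes in question; the part generated by [N] is there by compatibility. *)
Lemma cone_torsion a b phi Z : compatible a b -> (forall Z, phi Z = cone a b Z) -> Tbar phi Z ->
  (forall i, a i != 0%N -> tor V (L i) Z) /\ (forall i, b i != 0%N -> hom0 (L i) Z).
Proof.
move=> [hab hb hba] e tZ; have VZ := proj1 tZ.
pose S : pred 'I_p := fun i => a i != 0%N; pose N := bs S.
have rN : rig N.
  apply: bs_torl => [|i hi]; first exact: bs_V.
  by apply: bs_torr => // j hj; apply: hab.
have VN := tor_V rN.
have [Y [q [VY hq]]] := fq_exists aV rN VZ; have hY := fq_hom0 hq.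
have hLY i : a i != 0%N -> hom0 (L i) Y by move=> hi; apply: (@bs_hom0 S).
have t1 i : (a i)%:Z * th i Y <= 0.
  have [->|hi] := eqVneq (a i) 0%N; first by rewrite mul0r.
  rewrite pmulr_rle0; first exact: th_hom0 VY (hLY i hi).
  by rewrite ltz_nat lt0n.
have t2 i : 0 <= (b i)%:Z * (hm (L i) Y)%:Z by rewrite mulr_ge0 ?lez_nat.
have := Tbar_val (Tbar_quo (fq_surj hq) VY tZ); rewrite e /cone /comb => ge0.
have s1 : \sum_i (a i)%:Z * th i Y = 0.
  apply/eqP; rewrite eq_le sumr_le0 //= (le_trans ge0) // gerDl oppr_le0.
  by apply: sumr_ge0.
have s2 : \sum_i (b i)%:Z * (hm (L i) Y)%:Z = 0.
  apply/eqP; rewrite eq_le sumr_ge0 // andbT; move: ge0.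
  by rewrite s1 sub0r oppr_ge0.
have z1 i : a i != 0%N -> tor V (L i) Y.
  move=> hi; have [_ h] := theta_hom0 aV (LV i) VY (hLY i hi); apply: h.
  have : \sum_i - ((a i)%:Z * th i Y) == 0 by rewrite sumrN s1 oppr0.
  rewrite psumr_eq0 => [|j _]; last by rewrite oppr_ge0.
  move=> /allP /(_ i (mem_index_enum i)) /=; rewrite oppr_eq0 mulf_eq0 => /orP [|/eqP //].
  by rewrite eqz_nat (negPf hi).
have z2 i : b i != 0%N -> hom0 (L i) Y.
  move=> hi; apply/hom0_dim; move/eqP: s2; rewrite psumr_eq0 // => /allP /(_ i (mem_index_enum i)) /=.
  by rewrite mulf_eq0 !eqz_nat (negPf hi) /= => /eqP.
have [T [u [VT se gT _]]] := hq.
split=> i hi.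
  apply: (tor_ext aV (LV i) se _ (z1 i hi)).
  by apply: (tor_gen aV (LV i) _ gT VT); apply: bs_torr => // j hj; apply: hab.
have hN : hom0 (L i) N.
  apply: (@big_ind _ (fun M => hom0 (L i) M)) => [f|X X' hX hX' f|j hj]; last exact: hba.
    by apply: mhom_eq => v; rewrite mhom0E; apply: (is_zeroP mod0).1 mod0_zero _.
  by rewrite [f]mpair_eta (hX (pl _ _ \m f)) (hX' (pr _ _ \m f)) /mpair !mcomp0r addr0.
have hT := hom0_gen (hb i hi) VN hN gT VT.
move=> f; have /sexP [ui uE _] := se.
have [|g <-] := @factor_inj _ _ _ _ _ u f ((injmP u).2 ui).
  by move=> x; apply/uE; rewrite -mcompE (z2 i hi (q \m f)) mhom0E.
by rewrite (hT g) mcomp0r.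
Qed.

(** Compatibility puts the quotients of powers of [L i] in all the torsion classes and makes them
    orthogonal to the shifted projectives, so only dimensions of Hom spaces remain. Together with
    [cone_torsion] this turns compatibility of two cones into a condition on signs. *)
Lemma cone_gen a b phi i Z : compatible a b -> (forall Z, phi Z = cone a b Z) -> a i != 0%N ->
  V Z -> gen (L i) Z -> ~ is_zero Z -> 0 < phi Z.
Proof.
move=> [hab hb hba] e hi VZ gZ Z0; rewrite e /cone /comb.
have t j : a j != 0%N -> tor V (L j) Z.
  by move=> hj; apply: (tor_gen aV (LV j) (hab j i hj hi) gZ VZ).
rewrite [X in _ - X]big1 => [|j _]; last first.
  have [->|hj] := eqVneq (b j) 0%N; first by rewrite mul0r.
  by rewrite ((hom0_dim _ _).1 (hom0_gen (hb j hj) (LV i) (hba j i hj hi) gZ VZ)) mulr0.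
rewrite subr0 (bigD1 i) //= ltr_pwDl //.
  rewrite (th_tor (t i hi)) mulr_gt0 // ltz_nat lt0n //.
  apply/eqP => /hom0_dim h; apply: Z0; apply/is_zero_mid; exact: gen_hom0 gZ h _.
apply: sumr_ge0 => j _; have [->|hj] := eqVneq (a j) 0%N; first by rewrite mul0r.
by rewrite (th_tor (t j hj)) mulr_ge0 ?lez_nat.
Qed.

(** * Weights vanishing on a perpendicular category *)

Section Perp.
Variable x : 'I_p.

Lemma bongartz_rigid : exists E, [/\ rig E, mS E x, forall Z, tor V (L x) Z <-> (V Z /\ gen E Z) &
  forall i, mS E i -> tor V (L x) (L i) /\ extp V (L x) (L i)].
Proof.
have [E [tE eE gE]] := bongartz_gen aV (Lr x).
have tg Z : tor V (L x) Z <-> (V Z /\ gen E Z).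
  split=> [t|[VZ g]]; first by split; [apply: tor_V t | apply: gE].
  exact: (tor_gen aV (LV x) tE g VZ).
exists E; split=> //.
- split=> [|Y q VY qs]; first exact: tor_V tE.
  by apply: eE; apply: tor_quo qs VY tE.
- apply/pbP; split; first exact: gE (Lr x).
  by move=> Z VZ gZ; apply: (@tor_ext1 _ _ V); apply/tg.
- move=> i /mSP [gi ei]; split; first exact/tg.
  by move=> Z /tg [VZ gZ]; apply: ei.
Qed.

Lemma add_of_gen i : tor V (L x) (L i) -> extp V (L x) (L i) -> gen (L x) (L i) -> i = x.
Proof.
move=> ti ei gi.
have [|m /(indec_summand_pw (Li i)) s] := extp_add aV (Lr x) (LV i) gi.
  by move=> T m k VT ki tT; apply: ei.
by apply: Lu; apply: (indec_summand (Li x) _ s); case: (Li i).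
Qed.

(** Expand [phi] along the Bongartz completion of [L x]. There are no shifted terms, as [dich2]
    would enlarge the class. For [i != x] the torsion-free quotients of the [L i] are pairwise
    non-isomorphic indecomposable projectives of J, and evaluating at the simple top of each
    isolates its coefficient. Integrality of [c] comes from the expansion. *)
Lemma ker_J phi : gfun V phi -> (forall Z, J V (L x) Z -> phi Z = 0) ->
  exists c : int, forall Z, phi Z = c * th x Z.
Proof.
move=> hphi h0; have [E [rE mx tg mE]] := bongartz_rigid.
have [a [b [ha hb e]]] := spanned_gfun rE hphi.
have np i : ~~ pS E i.
  apply/negP => hi; have [Z [VZ h1 _ nZ]] := dich2 rE hi.
  by apply: nZ; case: ((tg Z).1 (h1 x mx)).
have b0 i : b i = 0.
  by apply/eqP; apply: contraTT isT => /hb hi; rewrite (negPf (np i)) in hi.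
have rx := Lr x; have Vx := LV x; have wJ := ab_w (abcat_J aV rx).
have part i : mS E i -> i != x -> exists Q (q : mhom (L i) Q),
    [/\ fq (L x) q, projective_in (J V (L x)) Q, indecomposable Q & ~ is_zero Q].
  move=> hi ix; have [ti ei] := mE i hi.
  have [Q [q [VQ hq]]] := fq_exists aV rx (LV i).
  have ng : ~ gen (L x) (L i) by move=> /(add_of_gen ti ei) e0; rewrite e0 eqxx in ix.
  have tix : tor V (L i) (L x) by apply: mS_tor hi _ Vx; case: (mSP mx).
  exists Q, q; split=> //; first exact: (fq_proj aV rx ti ei hq).
    exact: (pair_indec aV rx (Lr i) tix (Li i) ng hq).
  by move=> Q0; apply: ng; apply: fq_zero Vx hq Q0.
have a0 i : i != x -> a i = 0.
  move=> ix; apply/eqP; apply: contraTT isT => ai; have hi := ha i ai.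
  have [Q [q [hq hQ iQ Q0]]] := part i hi ix.
  have [S [s [hS ss]]] := simple_quotient wJ (proj_V hQ) Q0.
  have [JS S0 _] := hS; have [tS hxS] := (JP aV S Vx).1 JS.
  have := h0 S JS; rewrite e (@comb_at1 a b i S).
  - move/eqP; rewrite mulf_eq0 (negPf ai) /=.
    have tiS : tor V (L i) S.
      by apply: (mS_tor hi _ (tor_V tS)); case: ((tg S).1 tS).
    rewrite th_tor // -(fq_hm hq hxS) eqz_nat => /eqP /hom0_dim hQS.
    by case: S0; apply/is_zeroP => y; have [z <-] := (surjmP s).1 ss y; rewrite (hQS s) mhom0E.
  - move=> j /ha hj ji; have tjS : tor V (L j) S.
      by apply: (mS_tor hj _ (tor_V tS)); case: ((tg S).1 tS).
    apply: th_tor0 => //.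
    have [->|jx] := eqVneq j x; first by [].
    have [Q' [q' [hq' hQ' iQ' Q0']]] := part j hj jx.
    apply/(fq_hom0r hq' hxS) => f; apply: NNPP => f0.
    have fs := simple_surj wJ (proj_V hQ') hS f0.
    have iso := indec_proj_simple hQ hQ' iQ iQ' hS ss fs.
    have [ti ei] := mE i hi; have [tj ej] := mE j hj.
    have sij : summand (L i) (L j).
      by apply: (lift_summand (Li i) Q0 hq hq' iso) => Z VZ gZ; apply: (extp_gen aV rx _ VZ gZ).
    have eij : i = j by apply: Lu; apply: (indec_summand (Li j) _ sij); case: (Li i).
    by rewrite eij eqxx in ji.
  - by move=> j; rewrite b0 eqxx.
exists (a x) => Z; rewrite e /comb (bigD1 x) //= !big1 ?subr0 ?addr0 // => i.
  by rewrite b0 mul0r.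
by move=> ix; rewrite a0 // mul0r.
Qed.

(** No summand of the common Bongartz completion is generated by the others: [dich1] would enlarge
    the class, but [L x] or [L c] remains and bounds it. Hence [G] has nonnegative coefficients, a
    torsion-free quotient receives no map from [G], and the class is all of [V]. *)
Lemma two_max c : c != x -> (forall Z, tor V (L x) Z <-> tor V (L c) Z) -> proj (L x).
Proof.
move=> cx tt; have [E [rE mx tg mE]] := bongartz_rigid.
have VE := tor_V rE.
have mc : mS E c.
  apply/pbP; have tc : tor V (L x) (L c) by apply/tt.
  split; first by case: ((tg _).1 tc).
  by move=> Z VZ gZ; apply: (@tor_ext1 _ _ V); apply/tt/tg.
have np i : ~~ pS E i.
  apply/negP => hi; have [Z [VZ h1 _ nZ]] := dich2 rE hi.
  by apply: nZ; case: ((tg Z).1 (h1 x mx)).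
have [G [hPG hgen]] := hG.
have [a [b [ha hb e]]] := spanned_proj rE hPG.
have b0 i : b i = 0.
  by apply/eqP; apply: contraTT isT => /hb hi; rewrite (negPf (np i)) in hi.
have Gz Y : V Y -> hom0 G Y -> is_zero Y.
  move=> VY h; have /genP gY := hgen Y VY; apply/is_zero_mid; exact: gen_hom0 gY h _.
have a0 i : 0 <= a i.
  have [->//|/ha hi] := eqVneq (a i) 0.
  have ng : ~ gen (bs (rest E i)) (L i).
    move=> gi; have [Z [VZ h1 _ nZ]] := dich1 rE hi gi; apply: nZ.
    have [ix|ix] := eqVneq x i; last by case: ((tg Z).1 (h1 x mx ix)).
    have ci : c != i by rewrite -ix.
    by case: ((tg Z).1 ((tt Z).2 (h1 c mc ci))).
  have rR := rest_rig E i; have VR := tor_V rR.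
  have [Y [q [VY hq]]] := fq_exists aV rR (LV i).
  have Y0 : ~ is_zero Y by move=> Y0; apply: ng; apply: fq_zero VR hq Y0.
  have gY : gen E Y by apply: gen_surj (fq_surj hq) _; case: (mSP hi).
  have : 0 < (hm G Y)%:Z.
    by rewrite ltz_nat lt0n; apply/eqP => /hom0_dim /(Gz Y VY).
  rewrite e (@comb_at1 a b i Y).
  - rewrite (th_tor (mS_tor hi gY VY)) => pos; rewrite leNgt; apply/negP => neg.
    have : a i * (hm (L i) Y)%:Z <= 0 by rewrite nmulr_rle0 // lez_nat.
    by rewrite leNgt pos.
  - move=> j /ha hj ji; apply: th_tor0; first exact: mS_tor hj gY VY.
    by apply: (@bs_hom0 (rest E i)); [apply/andP | apply: fq_hom0 hq].
  - by move=> j; rewrite b0 eqxx.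
apply: ext_proj => // Z VZ; apply: (@tor_ext1 _ _ V); apply/tg; split=> //.
have [Y [q [VY hq]]] := fq_exists aV rE VZ; apply: (fq_zero VE hq); apply: Gz => //.
apply/hom0_dim/eqP; rewrite -eqz_nat eq_le [X in _ && X]lez_nat andbT e /comb [X in _ - X]big1 => [|i _].
  rewrite subr0; apply: sumr_le0 => i _.
  have [->|/ha hi] := eqVneq (a i) 0; first by rewrite mul0r.
  apply: mulr_ge0_le0 => //; apply: th_hom0 => //.
  by have [gi _] := mSP hi; apply: gen_hom0 gi (fq_hom0 hq).
by rewrite b0 mul0r.
Qed.

End Perp.
End Silting.

(** * Simple objects and the drop of the rank *)

Section Rank.
Context {K : fieldType} {A : falgType K}.
Implicit Types (M N P Q S T X Y Z B C E R G : fdmod A).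

Section Simples.
Variable U : fdmod A -> Prop.
Hypothesis aU : abcat U.
Let hU := ab_w aU.
Let gU := ab_g aU.

Lemma filt_ind (F : fdmod A -> Prop) : (forall Z, is_zero Z -> F Z) ->
  (forall X S Z (i : mhom X Z) (q : mhom Z S), U X -> simple_in U S -> U Z ->
     short_exact i q -> F X -> F Z) ->
  forall Z, U Z -> F Z.
Proof.
move=> h0 hs Z; have [k] := ubnP (dm Z); elim: k Z => // k IH Z; rewrite ltnS => lt UZ.
have [|Z0] := classic (is_zero Z); first exact: h0.
have [S [q [hS qs]]] := simple_quotient hU UZ Z0; have [US S0 _] := hS.
have [X [i [UX se]]] := quo_seV hU qs UZ US.
apply: (hs X S Z i q) => //; apply: IH => //.
apply: leq_trans lt; rewrite (sex_dim se) -[X in (X < _)%N]addn0 ltn_add2l lt0n.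
by apply/eqP => /dm0.
Qed.

Lemma additive_simples f : additive_on U f -> (forall S, simple_in U S -> f S = 0) ->
  forall Z, U Z -> f Z = 0.
Proof.
move=> af h; apply: filt_ind => [Z Z0|X S Z i q UX hS UZ se fX].
  exact: (additive0 aU af Z0).
by have [US _ _] := hS; rewrite (af.2 _ _ _ _ _ UX UZ US se) fX h // addr0.
Qed.

Lemma additive_theta M : U M -> additive_on U (theta U M).
Proof. by move=> UM; apply: (gfun_additive aU); apply: gfun_theta. Qed.

Lemma top_pos Q S (q : mhom Q S) : ~ is_zero S -> surjm q -> (0 < hm Q S)%N.
Proof. by move=> S0 qs; rewrite lt0n; apply/eqP => /hom0_dim h; apply: (surj_ne0 qs S0); apply: h. Qed.

Lemma comp_factor Q S (q : mhom Q S) Z : projective_in U Q -> indecomposable Q -> simple_in U S ->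
  surjm q -> U Z -> ~ hom0 Q Z ->
  exists I (i : mhom I Z) (r : mhom I S), [/\ U I, injm i & surjm r].
Proof.
move=> hQ iQ hS qs UZ nh.
have [f f0] : exists f : mhom Q Z, f <> 0.
  by apply: NNPP => H; apply: nh => f; apply: NNPP => f0; apply: H; exists f.
have [I [r [i [UI rs ii e]]]] := img_V hU f (proj_V hQ) UZ.
have I0 : ~ is_zero I.
  move=> I0; apply: f0; rewrite -e; apply: mhom_eq => v.
  by rewrite mcompE ((is_zeroP I).1 I0 (r v)) mh0 mhom0E.
have [S' [r' [hS' rs']]] := simple_quotient hU UI I0.
have [g [gi gs]] := indec_proj_top hU hQ iQ hS' hS (surjm_comp rs' rs) qs.
by exists I, i, (g \m r'); split=> //; apply: surjm_comp.
Qed.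

Lemma additive_cover Q S (q : mhom Q S) phi Z : projective_in U Q -> surjm q -> simple_in U S ->
  additive_on U phi -> (forall S', simple_in U S' -> ~ misom S S' -> phi S' = 0) ->
  U Z -> hom0 Q Z -> phi Z = 0.
Proof.
move=> hQ qs hS aphi h; move: Z; apply: filt_ind => [Z Z0 _|X S' Z i r UX hS' UZ se IH /hom0_dim].
  exact: (additive0 aU aphi Z0).
have [US' _ _] := hS'.
rewrite (proj_hm hU hQ UX UZ se) => /eqP; rewrite addn_eq0 => /andP [/eqP h1 /eqP h2].
rewrite (aphi.2 _ _ _ _ _ UX UZ US' se) IH ?add0r; last exact/hom0_dim.
apply: h => // iso; have [_ S0 _] := hS; have := top_pos S0 qs.
by rewrite (hm_isor Q iso) h2.
Qed.

Definition fam k (f : nat -> fdmod A) := (forall i, (i < k)%N -> simple_in U (f i)) /\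
  forall i j, (i < k)%N -> (j < k)%N -> misom (f i) (f j) -> i = j.

Definition covers k (f : nat -> fdmod A) :=
  forall S, simple_in U S -> exists2 i, (i < k)%N & misom S (f i).

(** Rank at most [n]: the list may contain repetitions and objects that are not simple, so the bound
    survives passing to smaller categories without counting. *)
Definition rkle n := exists f, covers n f.

Lemma fam_max n : (forall k f, fam k f -> (k <= n)%N) ->
  exists k f, [/\ (k <= n)%N, fam k f & covers k f].
Proof.
move=> bd; suff main m : (exists k f, [/\ (k <= n)%N, fam k f & covers k f]) \/ exists f, fam m f.
  by case: (main n.+1) => // -[f /bd]; rewrite ltnn.
elim: m => [|m [h|[f ff]]]; [by right; exists (fun=> mod0); split | by left |].
have [c|nc] := classic (covers m f); first by left; exists m, f; split=> //; apply: bd ff.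
right; have [S [hS nS]] : exists S, simple_in U S /\ forall i, (i < m)%N -> ~ misom S (f i).
  apply: NNPP => H; apply: nc => S hS; apply: NNPP => H'; apply: H; exists S; split=> // i im e.
  by apply: H'; exists i.
have [f1 f2] := ff.
exists (fun i => if i == m then S else f i); split=> [i|i j]; rewrite !ltnS.
  by rewrite leq_eqVlt; case: eqP => //= _; apply: f1.
rewrite leq_eqVlt [(j <= m)%N]leq_eqVlt; case: eqP => [->|_] /=; case: eqP => [->|_] //= hi hj e.
- by case: (nS j hj).
- by case: (nS i hi); apply: misom_sym.
- exact: f2.
Qed.

Lemma fam_le n k g f : covers n g -> fam k f -> (k <= n)%N.
Proof.
move=> c [f1 f2].
have h (i : 'I_k) : exists j : 'I_n, misom (f i) (g j).
  by have [j jn e] := c _ (f1 i (ltn_ord i)); exists (Ordinal jn).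
have [s sE] := fin_all_exists h.
rewrite -[k]card_ord -[n]card_ord; apply: (leq_card s) => i j e; apply: val_inj => /=.
by apply: f2 => //; apply: misom_trans (sE i) _; rewrite e; apply: misom_sym.
Qed.

Lemma simple_functional k f (i : 'I_k) : fam k f -> exists Q,
  [/\ projective_in U Q, indecomposable Q, (0 < hm Q (f i))%N &
    forall j : 'I_k, j != i -> hom0 Q (f j)].
Proof.
move=> [f1 f2]; have hS := f1 i (ltn_ord i).
have [Q [q [hQ iQ qs]]] := simple_cover hU gU hS; exists Q; split=> //.
  by have [_ S0 _] := hS; apply: top_pos qs.
move=> j ji; apply: NNPP => nh.
have /f2 := simple_proj_hom hU hQ iQ hS (f1 j (ltn_ord j)) qs nh.
by move=> /(_ (ltn_ord i) (ltn_ord j)) /val_inj e; rewrite e eqxx in ji.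
Qed.

(** The projective covers of the simples are dual to them only up to the dimensions [d i], which
    exceed 1 when the endomorphism field of a simple is larger than [K]. The factor [D] is the
    product of all [d i], each coefficient using the product of the others. *)
Lemma additive_scale n phi : rkle n -> additive_on U phi ->
  exists (D : int) g, [/\ 0 < D, gfun U g & forall Z, U Z -> g Z = D * phi Z].
Proof.
move=> [c hc] aphi; have [k [f [_ ff cf]]] := fam_max (fun k f => fam_le hc).
have [Q hQ] := fin_all_exists (fun i : 'I_k => simple_functional i ff).
pose d (i : 'I_k) := (hm (Q i) (f i))%:Z.
have d0 i : 0 < d i by have [_ _ + _] := hQ i; rewrite ltz_nat.
pose D := \prod_i d i; pose a (i : 'I_k) := phi (f i) * \prod_(j < k | j != i) d j.
pose g Z := \sum_i a i * (hm (Q i) Z)%:Z.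
have gg : gfun U g.
  by apply: (gfun_sum aU) => i; apply: (gfunMz aU); apply: (gfun_proj aU); case: (hQ i).
have [g1 g2] := gfun_additive aU gg; have [p1 p2] := aphi.
exists D, g; split=> //; first exact: prodr_gt0.
have ah : additive_on U (fun Z => g Z - D * phi Z).
  split=> [X Y h|X Y Z i q UX UY UZ se]; first by rewrite (g1 _ _ h) (p1 _ _ h).
  by rewrite (g2 _ _ _ _ _ UX UY UZ se) (p2 _ _ _ _ _ UX UY UZ se); ring.
move=> Z UZ; apply/eqP; rewrite -subr_eq0; apply/eqP; move: Z UZ; apply: (additive_simples ah).
move=> S hS; have [i ik iso] := cf S hS; pose o := Ordinal ik.
rewrite (ah.1 _ _ iso) /g (bigD1 o) //= big1 ?addr0 => [|j jo].
  rewrite -/(d o) /a /= /D [\prod_i d i](bigD1 o) //=; ring.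
have [_ _ _ h] := hQ j; have oj : o != j by rewrite eq_sym.
by rewrite ((hom0_dim _ _).1 (h o oj)) mulr0.
Qed.

End Simples.

Section RankJ.
Variable V : fdmod A -> Prop.
Hypothesis aV : abcat V.
Let hV := ab_w aV.

Lemma theta_lift X E Q (q : mhom E Q) Z : tor V X X -> V E -> extp V X E -> fq V X q ->
  J V X Z -> theta V E Z = (hm Q Z)%:Z.
Proof.
move=> rX VE eE hq /(JP aV Z (tor_V rX)) [tZ hZ].
rewrite (fq_hm hq hZ); apply: (theta_tor aV VE); split; first exact: tor_V tZ.
by move=> Y r VY rs; apply: eE; apply: tor_quo rs VY tZ.
Qed.

Lemma theta_J X Z : V X -> J V X Z -> theta V X Z = 0.
Proof.
by move=> VX /(JP aV Z VX) [tZ /hom0_dim hZ]; rewrite theta_tor // hZ.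
Qed.

Lemma theta_self X : indecomposable X -> tor V X X -> 0 < theta V X X.
Proof.
move=> [X0 _] rX; rewrite (theta_tor aV (tor_V rX) rX) ltz_nat lt0n.
by apply/eqP => /hom0_dim h; apply: X0; apply/is_zero_mid.
Qed.

(** The composition multiplicities in [V] of [X] and of the simples of J(X) form a matrix with
    [k.+1] independent rows. Independence is triangular: theta_X vanishes on J(X) but not at [X],
    and the lifts to [V] of the projective covers in J(X) give functions [psi] dual to the [f j]. *)
Lemma rank_J n k X f : rkle V n -> indecomposable X -> tor V X X -> fam (J V X) k f -> (k < n)%N.
Proof.
move=> [g cov] iX rX ff; have VX := tor_V rX; have [f1 f2] := ff.
have aJ := abcat_J aV rX.
have hpsi (j : 'I_k) : exists psi, [/\ additive_on V psi, 0 < psi (f j) &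
    forall i : 'I_k, i != j -> psi (f i) = 0].
  have [Q [hQ iQ pos h0]] := simple_functional aJ j ff.
  have [E [q [tE eE hq]]] := proj_J_lift aV rX hQ.
  have JS (i : 'I_k) : J V X (f i) by case: (f1 i (ltn_ord i)).
  have th (i : 'I_k) : theta V E (f i) = (hm Q (f i))%:Z.
    exact: (theta_lift rX (tor_V tE) eE hq (JS i)).
  exists (theta V E); split; first exact: (additive_theta aV (tor_V tE)).
    by rewrite th ltz_nat.
  by move=> i /h0 /hom0_dim h; rewrite th h.
have [psi psiP] := fin_all_exists hpsi.
pose F (i : 'I_k.+1) := if unlift ord0 i is Some j then psi j else theta V X.
pose O (i : 'I_k.+1) := if unlift ord0 i is Some j then f j else X.
have VO i : V (O i).
  rewrite /O; case: (unlift ord0 i) => // j; apply: (J_V aV VX); by case: (f1 j (ltn_ord j)).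
have aF i : additive_on V (F i).
  by rewrite /F; case: (unlift ord0 i) => [j|]; [case: (psiP j) | exact: (additive_theta aV VX)].
have cov' S : simple_in V S -> exists i : 'I_n, misom S (g i).
  by move=> /cov [i lt e]; exists (Ordinal lt).
have [m mE] := fin_all_exists (fun i => comp_mult aV cov' (VO i)).
rewrite ltnNge; apply/negP => le.
pose MA : 'M[rat]_(k.+1, n) := \matrix_(i, l) (m i l)%:R.
have : kermx MA != 0.
  rewrite kermx_eq0 /row_free neq_ltn; apply/orP; left; rewrite ltnS.
  exact: leq_trans (rank_leq_col _) le.
move=> /rowV0Pn [r /sub_kermxP rA]; apply/negP; rewrite negbK.
have col l : \sum_i r 0 i * (m i l)%:R = 0.
  have := congr1 (fun B : 'M[rat]_(1, n) => B 0 l) rA; rewrite !mxE => e; rewrite -[RHS]e.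
  by apply: eq_bigr => i _; rewrite mxE.
have key j : \sum_i r 0 i * (F j (O i))%:~R = 0.
  under eq_bigr => i _ do rewrite (mE i _ (aF j)) rmorph_sum mulr_sumr.
  rewrite exchange_big big1 // => l _ /=.
  under eq_bigr => i _ do rewrite rmorphMn /= -mulr_natr mulrCA.
  by rewrite -mulr_sumr col mulr0.
have E0 : O ord0 = X by rewrite /O unlift_none.
have EO i : O (lift ord0 i) = f i by rewrite /O liftK.
have F0 : F ord0 = theta V X by rewrite /F unlift_none.
have EF i : F (lift ord0 i) = psi i by rewrite /F liftK.
have r0 : r 0 ord0 = 0.
  have := key ord0; rewrite big_ord_recl E0 F0 big1 ?addr0 => [|i _].
    move/eqP; rewrite mulf_eq0 intr_eq0 => /orP [/eqP //|/eqP e].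
    by have := theta_self iX rX; rewrite e ltxx.
  rewrite EO theta_J ?mulr0 //; by case: (f1 i (ltn_ord i)).
apply/eqP/rowP => i; rewrite mxE; case: (unliftP ord0 i) => [j ->|-> //].
have := key (lift ord0 j); rewrite big_ord_recl r0 mul0r add0r EF (bigD1 j) //= EO.
have [_ pos h0] := psiP j.
rewrite big1 ?addr0 => [|l lj]; last by rewrite EO h0 ?mulr0.
move/eqP; rewrite mulf_eq0 intr_eq0 => /orP [/eqP //|/eqP e].
by rewrite e ltxx in pos.
Qed.

Lemma rkle_J n X : rkle V n -> indecomposable X -> tor V X X -> (0 < n)%N /\ rkle (J V X) n.-1.
Proof.
move=> hn iX rX; have b k f : fam (J V X) k f -> (k < n)%N by apply: rank_J hn iX rX.
have n0 : (0 < n)%N by apply: (b 0%N (fun=> mod0)).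
split=> //; have [|k [f [le _ c]]] := @fam_max (J V X) n.-1.
  by move=> k f /b; rewrite -[X in (_ < X)%N](prednK n0) ltnS.
exists f => S hS; have [i ik e] := c S hS; exists i => //; exact: leq_trans ik le.
Qed.

End RankJ.
End Rank.

(** * Sequences inside a subcategory and shifted values of E *)

Section Seq.
Context {K : fieldType} {A : falgType K}.
Implicit Types (M N P Q S T X Y Z B C E R G : fdmod A).

Record good (V : fdmod A -> Prop) : Prop := Good { good_ab : abcat V; good_fin : fin V }.

Lemma good_J V X : good V -> tor V X X -> good (J V X).
Proof. by move=> [aV fV] rX; split; [apply: abcat_J | apply: fin_J]. Qed.

Lemma pred_eq (U V : fdmod A -> Prop) : (forall Z, U Z <-> V Z) -> U = V.
Proof. by move=> h; apply: functional_extensionality => Z; apply: propositional_extensionality. Qed.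

Lemma Jseq_rcons V (s : seq (fdmod A)) X : Jseq V (rcons s X) = Jseq (J V X) s.
Proof. by elim: s => //= Y s ->. Qed.

Lemma Jseq_sub V (s : seq (fdmod A)) Z : tau_exceptional V s -> abcat V -> Jseq V s Z -> V Z.
Proof.
elim=> {V s} // V s X _ /[swap] te /[swap] IH rX aV; rewrite Jseq_rcons.
move/(tau_rigidP aV): rX => rX h; apply: (J_V aV (tor_V rX)).
by apply: IH h; apply: abcat_J.
Qed.

Lemma J_iso V X Y : abcat V -> V X -> misom X Y -> J V X = J V Y.
Proof.
move=> aV VX h; have VY := wide_iso (ab_w aV) h VX; apply: pred_eq => Z.
rewrite (JP aV Z VX) (JP aV Z VY); split=> -[t /hom0_dim h0]; split.
- exact: tor_isol h t.
- by apply/hom0_dim; rewrite -(hm_isol Z h).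
- exact: tor_isol (misom_sym h) t.
- by apply/hom0_dim; rewrite (hm_isol Z h).
Qed.

Lemma J_nself V X : abcat V -> indecomposable X -> tor V X X -> ~ J V X X.
Proof.
move=> aV [X0 _] rX /(JP aV X (tor_V rX)) [_ h]; apply: X0; exact/is_zero_mid.
Qed.

Section OneCat.
Variable V : fdmod A -> Prop.
Hypothesis gV : good V.
Let aV := good_ab gV.
Let hV := ab_w aV.

(** By [cone_torsion] the shifted terms of [phi Z] vanish and the others are [a j] times dim Hom(L
    j, Z). The sum of these nonnegative numbers is 0, which kills Hom(L i, Z). *)
Lemma semistable_J p (L : 'I_p -> fdmod A) a b phi Z i : rigid_list V L -> compatible V L a b ->
  (forall Z, phi Z = cone V L a b Z) -> Tbar V phi Z -> phi Z = 0 ->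
  (a i != 0%N) || (b i != 0%N) -> J V (L i) Z.
Proof.
move=> hL cab e tZ z h; have [t h0] := cone_torsion aV hL cab e tZ.
have [_ rL _ _] := hL; have VL j := tor_V (rL j); have VZ := proj1 tZ.
have [_ pL _] := cab; apply/(JP aV Z (VL i)).
have [bi|bi] := eqVneq (b i) 0%N; last first.
  by split; [apply: tor_proj (pL i bi) VZ | apply: h0].
have ai : a i != 0%N by move: h; rewrite bi eqxx orbF.
split; first exact: t.
move: z; rewrite e /cone /comb [X in _ - X]big1 ?subr0 => [/eqP|j _]; last first.
  by have [->|/h0 /hom0_dim ->] := eqVneq (b j) 0%N; rewrite ?mul0r ?mulr0.
have tE j : (a j)%:Z * th V L j Z = (a j)%:Z * (hm (L j) Z)%:Z.
  by have [->|/t tj] := eqVneq (a j) 0%N; rewrite ?mul0r // (th_tor aV hL tj).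
under eq_bigr => j _ do rewrite tE.
rewrite psumr_eq0 // => /allP /(_ i (mem_index_enum i)) /=.
by rewrite mulf_eq0 !eqz_nat (negPf ai) /= => /eqP /hom0_dim.
Qed.

Lemma ker_perp X phi : indecomposable X -> tor V X X -> gfun V phi ->
  (forall Z, J V X Z -> phi Z = 0) -> exists c : int, forall Z, phi Z = c * theta V X Z.
Proof.
move=> iX rX hphi h; have [p [L hL]] := rigid_list_exists aV (good_fin gV).
have [_ rL Lx _] := hL; have [i e] := Lx X iX rX.
have [|c hc] := ker_J aV hL (x := i) hphi; first by move=> Z; rewrite -(J_iso aV (tor_V rX) e); apply: h.
by exists c => Z; rewrite hc (theta_iso aV Z e (tor_V rX)).
Qed.

Lemma J_Tbar X Z : tor V X X -> J V X Z -> Tbar V (theta V X) Z.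
Proof.
move=> rX /(JP aV Z (tor_V rX)) [tZ _]; split=> [|Y q VY qs]; first exact: tor_V tZ.
by rewrite (theta_tor aV (tor_V rX) (tor_quo qs VY tZ)).
Qed.

End OneCat.

Lemma additive_sub (U V : fdmod A -> Prop) phi : (forall Z, U Z -> V Z) -> additive_on V phi ->
  additive_on U phi.
Proof. by move=> h [h1 h2]; split=> // X Y Z i q UX UY UZ; apply: h2; apply: h. Qed.

Lemma zero_cone V p (L : 'I_p -> fdmod A) a b Z : cone V L a b Z != 0 ->
  exists i, (a i != 0%N) || (b i != 0%N).
Proof.
move=> nz; apply: NNPP => H; case/eqP: nz.
have h i : a i = 0%N /\ b i = 0%N.
  have [ai|ai] := eqVneq (a i) 0%N; last by case: H; exists i; rewrite ai.
  by have [bi|bi] := eqVneq (b i) 0%N; last by case: H; exists i; rewrite bi orbT.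
rewrite /cone /comb !big1 ?subr0 // => i _; have [ai bi] := h i; by rewrite ?ai ?bi mul0r.
Qed.

(* The sequence realising [Jseq V s] may leave U; it is rebuilt inside U from a
   weight of its last term, restricted to U. *)
Lemma Jseq_relative n : forall U, good U -> rkle U n -> forall V s, tau_exceptional V s -> good V ->
  (forall Z, U Z -> V Z) -> (forall Z, Jseq V s Z -> U Z) ->
  exists s', tau_exceptional U s' /\ Jseq U s' = Jseq V s.
Proof.
elim/ltn_ind: n => n IHn U gU rU V s te.
have aU := good_ab gU; have hU := ab_w aU; elim: te => {V s} [V|V s X iX].
  move=> gV UV VU; exists [::]; split; first exact: TauExcNil.
  by apply: pred_eq => Z; split; [apply: UV | apply: VU].
move=> trX te IH gV UV WU; have aV := good_ab gV.
have /(tau_rigidP aV) rX := trX; have VX := tor_V rX.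
have aJ := abcat_J aV rX; rewrite Jseq_rcons in WU *.
have WJ Z : Jseq (J V X) s Z -> J V X Z by apply: Jseq_sub te aJ.
have step Y : indecomposable Y -> tor U Y Y -> (forall Z, Jseq (J V X) s Z -> J U Y Z) ->
    exists s', tau_exceptional U s' /\ Jseq U s' = Jseq (J V X) s.
  move=> iY rY WY; have [n0 rJ] := rkle_J aU rU iY rY.
  have lt : (n.-1 < n)%N by rewrite prednK.
  have gJ := good_J gU rY.
  have te' := TauExcRcons iX trX te.
  have [||s' [ts' e]] := IHn _ lt _ gJ rJ V (rcons s X) te' gV.
  - by move=> Z /(J_V aU (tor_V rY)); apply: UV.
  - by rewrite Jseq_rcons.
  exists (rcons s' Y); rewrite Jseq_rcons e Jseq_rcons; split=> //.
  by apply: TauExcRcons => //; apply/(tau_rigidP aU).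
have aX := additive_sub UV (additive_theta aV VX).
have [[Z0 [UZ0 nz]]|no] := classic (exists Z, U Z /\ theta V X Z <> 0).
  (* A positive multiple of the restricted weight belongs to [U] and lies in a cone there; the
     restriction is not zero, so the cone has a summand, and W is semistable for it. *)
  have [D [g [D0 gg gE]]] := additive_scale aU rU aX.
  have [p [L hL]] := rigid_list_exists aU (good_fin gU).
  have [a [b [cab e]]] := completeness aU hL gg.
  have [|i hi] := @zero_cone U p L a b Z0.
    by rewrite -e gE // mulf_neq0 ?(gt_eqF D0) //; apply/eqP.
  have [iL rL _ _] := hL; apply: (step (L i)) => // Z WZ.
  have UZ := WU Z WZ; have JZ := WJ Z WZ.
  apply: (semistable_J gU hL cab e) => //; last by rewrite gE // (theta_J aV VX JZ) mulr0.
  split=> // Y q UY qs; rewrite gE //; apply: mulr_ge0; first exact: ltW.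
  by have [_ h] := J_Tbar gV rX JZ; apply: (h Y q) => //; apply: UV.
have th0 Z : U Z -> theta V X Z = 0 by move=> UZ; apply: NNPP => nz; apply: no; exists Z.
have [UJ|nUJ] := classic (forall Z, U Z -> J V X Z).
  by apply: IH => //; apply: good_J.
have [S [hS nS]] : exists S, simple_in U S /\ ~ J V X S.
  apply: NNPP => H; apply: nUJ; apply: (filt_ind aU) => [Z Z0|Y S Z i q UY hS UZ se JY].
    exact: (wide_iszero (ab_w aJ) Z0).
  apply: (wide_ext (ab_w aJ) JY _ se); apply: NNPP => nS; apply: H; by exists S.
(* Now the weight vanishes on [U]. The projective cover [Q] of [S] can be the last term: a map from
   [Q] to an object of W would give a subobject [I] with quotient [S], and Hom(X, I) = 0 with weight
   0 would put [I], hence [S], into the class of [X] and so [S] into J(X). *)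
have [Q [q [hQ iQ qs]]] := simple_cover hU (ab_g aU) hS.
have UQ := proj_V hQ; have [US _ _] := hS.
apply: (step Q) => // [|Z WZ]; first exact: (tor_proj aU hQ UQ).
have UZ := WU Z WZ; apply/(JP aU Z UQ); split; first exact: (tor_proj aU hQ UZ).
apply: NNPP => nh; have [I [i [r [UI ii rs]]]] := comp_factor aU hQ iQ hS qs UZ nh.
have /(JP aV Z VX) [_ hXZ] := WJ Z WZ.
have hXI := inj_hom0 ii hXZ.
have [_ /(_ (th0 I UI)) tI] := theta_hom0 aV VX (UV _ UI) hXI.
have tS := tor_quo rs (UV _ US) tI; apply: nS; apply/(JP aV S VX); split=> //.
by apply/hom0_dim/eqP; rewrite -eqz_nat -(theta_tor aV VX tS) th0.
Qed.

(** * Existence of the shifted values of the maps E *)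

Section Shift.
Variable V : fdmod A -> Prop.
Hypothesis gV : good V.
Variable n : nat.
Hypothesis rV : rkle V n.
Let aV := good_ab gV.
Let hV := ab_w aV.
Notation proj := (projective_in V).
Notation rig M := (tor V M M).

Lemma cover_avoid (U : fdmod A -> Prop) phi Q S (q : mhom Q S) Z : abcat U -> additive_on U phi ->
  (forall Z, U Z -> phi Z <= 0) -> projective_in U Q -> indecomposable Q -> simple_in U S ->
  surjm q -> phi S <> 0 -> U Z -> phi Z = 0 -> hom0 Q Z.
Proof.
move=> aU [_ add] le0 hQ iQ hS qs nS UZ z; apply: NNPP => nh.
have [I [i [r [UI ii rs]]]] := comp_factor aU hQ iQ hS qs UZ nh.
have [US _ _] := hS.
have [C [c [UC se]]] := sub_seV (ab_w aU) ii UI UZ.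
have [D [d [UD se']]] := quo_seV (ab_w aU) rs UI US.
have e1 := add _ _ _ _ _ UI UZ UC se; have e2 := add _ _ _ _ _ UD UI US se'.
have lI := le0 I UI; have lC := le0 C UC; have lD := le0 D UD; have lS := le0 S US.
have I0 : phi I = 0.
  by apply/eqP; rewrite eq_le lI -(lerD2r (phi C)) add0r -e1 z lC.
by apply: nS; apply/eqP; rewrite eq_le lS -(lerD2l (phi D)) addr0 -e2 I0 lD.
Qed.

Section Data.
Variables (X C B : fdmod A) (phi : fdmod A -> int).
Hypotheses (iX : indecomposable X) (rX : rig X) (iC : indecomposable C) (rC : rig C).
Hypotheses (iB : indecomposable B) (rB : tor (J V C) B B).
Let VX := tor_V rX.
Let VC := tor_V rC.
Let aJ := abcat_J aV rX.
Hypotheses (aphi : additive_on (J V X) phi) (phi_le : forall Z, J V X Z -> phi Z <= 0).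
Hypothesis phi0 : forall Z, J (J V C) B Z <-> J V X Z /\ phi Z = 0.
Hypothesis phiC : forall Z, J V X Z -> phi Z <> 0 -> theta V C Z <> 0.

(** Otherwise take [psi] dual to [S1] and zero at [S2]. Both [psi] and theta_X vanish on the
    category J_J(C)(B), so inside J(C) they are multiples of one weight, up to scaling; in [V] this
    becomes a linear relation of [psi], theta_X and theta_C. Its coefficients die one after the
    other at [S2], [S1] and [X]. *)
Lemma unique_outside S1 S2 : simple_in (J V X) S1 -> simple_in (J V X) S2 ->
  phi S1 <> 0 -> phi S2 <> 0 -> misom S1 S2.
Proof.
move=> hS1 hS2 n1 n2; apply: NNPP => niso.
have [J1 S10 _] := hS1; have [J2 _ _] := hS2.
have [Q [q [hQ iQ qs]]] := simple_cover (ab_w aJ) (ab_g aJ) hS1.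
have [E [eq [tE eE hq]]] := proj_J_lift aV rX hQ.
have VE := tor_V tE; pose psi := theta V E.
have psiE Z : J V X Z -> psi Z = (hm Q Z)%:Z by move=> JZ; apply: (theta_lift aV rX VE eE hq JZ).
have psi1 : psi S1 <> 0.
  by rewrite psiE // => -[e]; have := top_pos S10 qs; rewrite e.
have psi2 : psi S2 = 0.
  rewrite psiE //; congr Posz; apply/hom0_dim; apply: NNPP => nh.
  by apply: niso; apply: (simple_proj_hom (ab_w aJ) hQ iQ hS1 hS2 qs nh).
have psiW Z : J (J V C) B Z -> psi Z = 0.
  move=> /phi0 [JZ z]; rewrite psiE //; congr Posz; apply/hom0_dim.
  exact: (cover_avoid aJ aphi phi_le hQ iQ hS1 qs n1 JZ z).
have thW Z : J (J V C) B Z -> theta V X Z = 0 by move=> /phi0 [JZ _]; apply: (theta_J aV VX JZ).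
have gC := good_J gV rC; have aC := good_ab gC; have [_ rkC] := rkle_J aV rV iC rC.
have VJ Z : J V C Z -> V Z by apply: (J_V aV VC).
have WC Z : J (J V C) B Z -> J V C Z by apply: (J_V aC (tor_V rB)).
have [D1 [g1 [D10 gg1 g1E]]] := additive_scale aC rkC (additive_sub VJ (additive_theta aV VE)).
have [D3 [g3 [D30 gg3 g3E]]] := additive_scale aC rkC (additive_sub VJ (additive_theta aV VX)).
have [|c1 c1E] := ker_perp gC iB rB gg1.
  move=> Z WZ; have JC := WC Z WZ; by rewrite (g1E Z JC) -/(psi Z) (psiW Z WZ) mulr0.
have [|c3 c3E] := ker_perp gC iB rB gg3.
  move=> Z WZ; have JC := WC Z WZ; by rewrite (g3E Z JC) (thW Z WZ) mulr0.
have t2 := phiC J2 n2.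
have [||m mE] := @ker_perp V gV C (fun Z => c3 * D1 * psi Z + - (c1 * D3 * theta V X Z)) iC rC.
- by apply: (gfunD aV); [|apply: gfunN]; apply: (gfunMz aV); apply: (gfun_theta aV).
- move=> Z JZ; rewrite -!mulrA -(g1E Z JZ) -(g3E Z JZ) c1E c3E; ring.
have m0 : m = 0.
  have := mE S2; rewrite psi2 (theta_J aV VX J2) !mulr0 subr0 => /esym/eqP.
  by rewrite mulf_eq0 => /orP [/eqP //|/eqP].
have c30 : c3 = 0.
  have := mE S1; rewrite m0 mul0r (theta_J aV VX J1) mulr0 subr0 => /eqP.
  by rewrite !mulf_eq0 (gt_eqF D10) orbF => /orP [/eqP //|/eqP].
have c10 : c1 = 0.
  have := mE X; rewrite m0 c30 !mul0r add0r => /eqP.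
  by rewrite oppr_eq0 !mulf_eq0 (gt_eqF D30) (gt_eqF (theta_self aV iX rX)) !orbF => /eqP.
(* With [c1] zero, [psi] vanishes on J(C), so it is a multiple of theta_C; its zero at [S2] makes it
   vanish, against [psi1]. *)
have [||m' m'E] := @ker_perp V gV C psi iC rC; first exact: gfun_theta.
  move=> Z JZ; have := g1E Z JZ; rewrite c1E c10 mul0r => /esym/eqP.
  by rewrite mulf_eq0 (gt_eqF D10) => /eqP.
have m'0 : m' = 0.
  by have := m'E S2; rewrite psi2 => /esym/eqP; rewrite mulf_eq0 => /orP [/eqP //|/eqP].
by apply: psi1; rewrite m'E m'0 mul0r.
Qed.

Lemma shift_exists Z0 : J V X Z0 -> phi Z0 <> 0 -> exists Q,
  [/\ indecomposable Q, projective_in (J V X) Q &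
    forall Z, (J V X Z /\ hom0 Q Z) <-> J (J V C) B Z].
Proof.
move=> JZ0 nz.
have [S [hS nS]] : exists S, simple_in (J V X) S /\ phi S <> 0.
  apply: NNPP => H; apply: nz; apply: (additive_simples aJ aphi) JZ0 => S hS.
  by apply: NNPP => nS; apply: H; exists S.
have [Q [q [hQ iQ qs]]] := simple_cover (ab_w aJ) (ab_g aJ) hS.
exists Q; split=> // Z; rewrite phi0; split=> -[JZ h]; split=> //.
  apply: (additive_cover aJ hQ qs hS aphi _ JZ h) => S' hS' ni.
  by apply: NNPP => n'; apply: ni; apply: unique_outside.
exact: (cover_avoid aJ aphi phi_le hQ iQ hS qs nS JZ h).
Qed.

End Data.

Lemma J_dsum C X Z : V C -> V X -> J V (dsum C X) Z <-> J V C Z /\ J V X Z.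
Proof.
move=> VC VX; rewrite (JP aV Z (wide_dsum hV VC VX)) (JP aV Z VC) (JP aV Z VX).
split=> [[t /hom0_dim]|[[t1 /hom0_dim h1] [t2 /hom0_dim h2]]].
  rewrite hm_dsuml => /eqP; rewrite addn_eq0 => /andP [/eqP h1 /eqP h2].
  split; split; try exact/hom0_dim.
    exact: tor_summandl (summand_dl C X) t.
  exact: tor_summandl (summand_dr C X) t.
by split; [apply: tor_dsuml | apply/hom0_dim; rewrite hm_dsuml h1 h2].
Qed.

Lemma shift_mod C X : indecomposable X -> rig X -> indecomposable C -> rig C ->
  tor V C X -> tor V X C -> ~ misom C X -> gen X C -> exists Q,
  [/\ indecomposable Q, projective_in (J V X) Q &
    forall Z, (J V X Z /\ hom0 Q Z) <-> J V (dsum C X) Z].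
Proof.
move=> iX rX iC rC tCX tXC ni gXC; have VC := tor_V rC; have VX := tor_V rX.
have nCX : ~ gen C X by move=> g; apply: ni; apply: gen_antisym.
have [B [q [VB hq]]] := fq_exists aV rC VX.
have iB := pair_indec aV rC rX tXC iX nCX hq.
have rB := pair_rigid aV rC rX tCX hq.
have JJ := pair_JJ aV rC rX tCX tXC iX nCX hq.
have VJ Z : J V X Z -> V Z by apply: (J_V aV VX).
have hC Z : J V X Z -> hom0 C Z by move=> /(JP aV Z VX) [_]; apply: gen_hom0.
have le0 Z : J V X Z -> theta V C Z <= 0.
  by move=> JZ; have [] := theta_hom0 aV VC (VJ Z JZ) (hC Z JZ).
have [Z0 [JZ0 nz]] : exists Z, J V X Z /\ theta V C Z <> 0.
  (* If theta_C vanished on J(X), it would be [c] times theta_X, with [c] positive by the values at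
     [C]. At [B] the first is at most 0 and the second is dim Hom(X, B), which is positive. *)
  apply: NNPP => H; have [||c cE] := @ker_perp V gV X (theta V C) iX rX; first exact: gfun_theta.
    by move=> Z JZ; apply: NNPP => nz; apply: H; exists Z.
  have c0 : 0 < c.
    have := theta_self aV iC rC; rewrite cE (theta_tor aV VX tXC) => pos.
    rewrite ltNge; apply/negP => c0; move: pos; apply/negP; rewrite -leNgt.
    exact: mulr_le0_ge0.
  have hCB := fq_hom0 hq.
  have [le _] := theta_hom0 aV VC VB hCB.
  move: le; rewrite cE (theta_tor aV VX (tor_quo (fq_surj hq) VB rX)) pmulr_rle0 // lez_nat leqn0.
  move=> /eqP /hom0_dim h; apply: (pair_nz rC nCX hq); apply/is_zeroP => y.
  by have [x <-] := (surjmP _).1 (fq_surj hq) y; rewrite (h q) mhom0E.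
have [|||Q [iQ hQ QE]] := @shift_exists X C B (theta V C) iX rX iC rC iB rB _ le0 _ _ Z0 JZ0 nz.
- exact: additive_sub VJ (additive_theta aV VC).
- move=> Z; rewrite JJ J_dsum //; split=> -[].
    by move=> JC JX; split=> //; apply: (theta_J aV VC JC).
  move=> JX e; split=> //; apply/(JP aV Z VC); split; last exact: hC.
  by have [_ h] := theta_hom0 aV VC (VJ Z JX) (hC Z JX); apply: h.
- by [].
by exists Q; split=> // Z; rewrite QE JJ.
Qed.

Lemma tor_Jproj P M Z : proj P -> J V P Z -> tor (J V P) M Z <-> tor V M Z.
Proof.
move=> hP JZ; have VP := proj_V hP; have := JZ; rewrite (JP aV Z VP) => -[tZ hZ].
have VZ := tor_V tZ.
split=> -[h1 h2]; split=> // Y q.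
  move=> VY qs; apply: (h2 Y q) => //; apply/(JP aV Y VP); split; first exact: tor_proj.
  by move=> f; have [g <-] := proj_lift f hP VZ VY qs; rewrite (hZ g) mcomp0r.
by move=> /(J_V aV VP) VY; apply: h2.
Qed.

Lemma J_proj P Z : proj P -> J V P Z <-> V Z /\ hom0 P Z.
Proof.
move=> hP; rewrite (JP aV Z (proj_V hP)); split=> -[h1 h2]; split=> //; first exact: tor_V h1.
exact: tor_proj.
Qed.

Lemma JJ_proj P X Z : proj P -> V X -> hom0 P X -> J (J V P) X Z <-> Jpair V X P Z.
Proof.
move=> hP VX hPX; have JX : J V P X by apply/(J_proj X hP).
have aP := abcat_J aV (tor_proj aV hP (proj_V hP)).
rewrite (JP aP Z JX) (JpairP aV P Z VX); split=> [[t h]|[t h1 h2]].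
  have JZ := tor_V t; have /(J_proj Z hP) [_ h2] := JZ.
  by split=> //; apply/(tor_Jproj X hP JZ).
have JZ : J V P Z by apply/(J_proj Z hP); split=> //; apply: tor_V t.
by split=> //; apply/(tor_Jproj X hP JZ).
Qed.

(** The argument of [shift_mod] with the weight -[P], which is never positive and vanishes exactly
    on the objects orthogonal to [P]. *)
Lemma shift_proj P X : indecomposable X -> rig X -> indecomposable P -> proj P -> hom0 P X ->
  exists Q, [/\ indecomposable Q, projective_in (J V X) Q &
    forall Z, (J V X Z /\ hom0 Q Z) <-> Jpair V X P Z].
Proof.
move=> iX rX iP hP hPX; have VP := proj_V hP; have VX := tor_V rX.
have rP := tor_proj aV hP VP.
have VJ Z : J V X Z -> V Z by apply: (J_V aV VX).
have JX : J V P X by apply/(J_proj X hP).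
have rB : tor (J V P) X X by apply/(tor_Jproj X hP JX).
pose phi Z := - theta V P Z.
have phiE Z : phi Z = - (hm P Z)%:Z by rewrite /phi (theta_proj aV Z hP).
have le0 Z : J V X Z -> phi Z <= 0 by rewrite phiE oppr_le0.
have phi0 Z : phi Z = 0 <-> hom0 P Z.
  rewrite phiE hom0_dim; split=> [/eqP|->]; last by rewrite oppr0.
  by rewrite oppr_eq0 eqz_nat => /eqP.
have [Z0 [JZ0 nz]] : exists Z, J V X Z /\ phi Z <> 0.
  apply: NNPP => H; have [||c cE] := @ker_perp V gV X phi iX rX.
  - by apply: gfunN; apply: gfun_theta.
  - by move=> Z JZ; apply: NNPP => nz; apply: H; exists Z.
  have c0 : c = 0.
    have := cE X; rewrite (phi0 X).2 // => /esym/eqP; rewrite mulf_eq0 => /orP [/eqP //|/eqP e].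
    by have := theta_self aV iX rX; rewrite e ltxx.
  by have := theta_self aV iP rP; rewrite -[theta _ _ _]opprK -/(phi P) cE c0 mul0r oppr0 ltxx.
have [|||Q [iQ hQ QE]] := @shift_exists X P X phi iX rX iP rP iX rB _ le0 _ _ Z0 JZ0 nz.
- have [h1 h2] := additive_sub VJ (additive_theta aV VP).
  split=> [Y Y' h|Y Y' Z i q UY UY' UZ se]; first by rewrite /phi (h1 _ _ h).
  by rewrite /phi (h2 _ _ _ _ _ UY UY' UZ se) opprD.
- move=> Z; rewrite JJ_proj // (JpairP aV P Z VX) (JP aV Z VX) phi0.
  by split=> [[]|[[]]].
- by move=> Z _ nz' e; apply: nz'; rewrite /phi e oppr0.
by exists Q; split=> // Z; rewrite QE JJ_proj.
Qed.

End Shift.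
End Seq.

(** * Compatible last terms linked by one left mutation *)

Section Links.
Context {K : fieldType} {A : falgType K}.
Implicit Types (M N P Q S T X Y Z B C E R G : fdmod A).

Section OneCat.
Variable V : fdmod A -> Prop.
Hypothesis gV : good V.
Variable n : nat.
Hypothesis rV : rkle V n.
Let aV := good_ab gV.
Let hV := ab_w aV.
Notation proj := (projective_in V).
Notation rig M := (tor V M M).

Lemma tau_exc2 B C : indecomposable C -> rig C -> indecomposable B -> tor (J V C) B B ->
  tau_exceptional V [:: B; C].
Proof.
move=> iC rC iB rB; apply: (@TauExcRcons _ _ V [:: B] C) => //; first exact/(tau_rigidP aV).
apply: (@TauExcRcons _ _ (J V C) [::] B) => //; last exact: TauExcNil.
by apply/(tau_rigidP (abcat_J aV rC)).
Qed.

Lemma E_domain_mod C X : indecomposable X -> rig X -> indecomposable C -> rig C ->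
  tor V C X -> tor V X C -> ~ misom C X -> E_domain V C (Mod X).
Proof.
move=> iX rX iC rC tCX tXC ni; have VC := tor_V rC; have VX := tor_V rX.
split=> //=; first exact/(tau_rigidP aV).
  split; [apply/(tau_rigidP aV) | exact/(proj_zero hV)/mod0_zero |].
    by apply: tor_dsuml; apply: (tor_dsumr aV).
  by apply/hom0_dim/hm_zerol/mod0_zero.
by case: iX => X0 _ s; apply: ni; apply: misom_sym; apply: indec_summand.
Qed.

Lemma is_E_mod C X B (q : mhom X B) : indecomposable X -> rig X -> indecomposable C -> rig C ->
  tor V C X -> tor V X C -> ~ misom C X -> ~ gen C X -> fq V C q -> is_E V C (Mod X) (Mod B).
Proof.
move=> iX rX iC rC tCX tXC ni ng hq; split; first exact: E_domain_mod.
by exists X => //; split; [move/genP | exact: fq_tfp hq].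
Qed.

Definition linked C X := exists B X',
  [/\ left_mutation V B C X' X,
      indecomposable B /\ tor (J V C) B B, indecomposable X' /\ tor (J V X) X' X',
      forall Z, J (J V C) B Z <-> J V C Z /\ J V X Z
    & forall Z, J (J V X) X' Z <-> J V C Z /\ J V X Z].

(** [nCX] makes E_C(X) the module [B], and [nE] expresses left regularity, since [X] is the preimage
    of [B]. The value of E_X at [C] is a shifted projective or a module according to whether
    [gen X C] holds. *)
Lemma linked_mod C X : indecomposable X -> rig X -> indecomposable C -> rig C ->
  tor V C X -> tor V X C -> ~ misom C X -> ~ proj C -> ~ gen C X -> ~ extp V X C -> linked C X.
Proof.
move=> iX rX iC rC tCX tXC ni nC nCX nE; have VC := tor_V rC; have VX := tor_V rX.
have ni' : ~ misom X C by move/misom_sym.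
have [B [q [VB hq]]] := fq_exists aV rC VX.
have iB := pair_indec aV rC rX tXC iX nCX hq.
have rB := pair_rigid aV rC rX tCX hq.
have JJ := pair_JJ aV rC rX tCX tXC iX nCX hq.
have EB := is_E_mod iX rX iC rC tCX tXC ni nCX hq.
have dom := E_domain_mod iC rC iX rX tXC tCX ni'.
suff [X' [O [OE iX' rX' JX' EX']]] : exists X' O, [/\ unshift O = X', indecomposable X',
    tor (J V X) X' X', forall Z, J (J V X) X' Z <-> J V C Z /\ J V X Z & is_E V X (Mod C) O].
  exists B, X'; split=> // [|Z]; last by rewrite JJ (J_dsum gV).
  split; [exact: tau_exc2 | exact: tau_exc2 | left; split].
    right; exists X; split=> // -[_ h]; apply: nE => Z tZ; apply: h; exact/(perp_tauP aV).
  exists (Mod C), X, O; split=> //; [by right | by rewrite OE; apply: misom_refl | exact: misom_refl].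
have [gXC|nXC] := classic (gen X C).
  have [Q [iQ hQ QE]] := shift_mod gV rV iX rX iC rC tCX tXC ni gXC.
  have aJ := abcat_J aV rX; exists Q, (Shift Q); split=> //.
  - exact: (tor_proj aJ hQ (proj_V hQ)).
  - by move=> Z; rewrite (J_proj (good_J gV rX)) // QE (J_dsum gV).
  - split=> //; split=> //; first exact/genP.
    move=> Z; apply: iff_trans (QE Z) _; rewrite -[Jpair V _ _ Z]/(J V (dsum X C) Z).
    by rewrite (J_dsum gV Z VC VX) (J_dsum gV Z VX VC); split=> -[].
have [B' [q' [VB' hq']]] := fq_exists aV rX VC.
have iB' := pair_indec aV rX rC tCX iC nXC hq'.
have rB' := pair_rigid aV rX rC tXC hq'.
have JJ' := pair_JJ aV rX rC tXC tCX iC nXC hq'.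
exists B', (Mod B'); split=> // [Z|]; first by rewrite JJ' (J_dsum gV) //; split=> -[].
exact: (is_E_mod iC rC iX rX tXC tCX ni' nXC hq').
Qed.

Lemma linked_proj P X : indecomposable X -> rig X -> indecomposable P -> proj P -> hom0 P X ->
  linked P X.
Proof.
move=> iX rX iP hP hPX; have VP := proj_V hP; have VX := tor_V rX.
have rP := tor_proj aV hP VP; have aJ := abcat_J aV rX.
have JX : J V P X by apply/(J_proj gV X hP).
have rB : tor (J V P) X X by apply/(tor_Jproj gV X hP JX).
have [Q [iQ hQ QE]] := shift_proj gV rV iX rX iP hP hPX.
have rQ := tor_proj aJ hQ (proj_V hQ).
have JE Z : Jpair V X P Z <-> J V P Z /\ J V X Z.
  rewrite (JpairP aV P Z VX) (J_proj gV Z hP) (JP aV Z VX).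
  by split=> [[t]|[[VZ h] []]] //; split=> //; split=> //; apply: tor_V t.
exists X, Q; split=> // [|Z|Z]; first last.
- by rewrite (J_proj (good_J gV rX)) // QE.
- by rewrite (JJ_proj gV Z hP VX hPX).
split; [exact: tau_exc2 | exact: tau_exc2 | left; split; first by left].
exists (Shift P), X, (Shift Q); split; [by left | | exact: misom_refl | exact: misom_refl].
by split; split=> //=; [apply/(tau_rigidP aV) | split=> //; apply/(tau_rigidP aV)].
Qed.

Lemma gen_proj_iso P X : indecomposable X -> V X -> indecomposable P -> proj P -> gen X P -> misom P X.
Proof.
move=> iX VX iP hP [m [q qs]]; have [s e] := proj_split hP (wide_pw hV m VX) qs.
apply: indec_summand iX _ _; first by case: iP.
by apply: (indec_summand_pw (m := m) iP); apply/summandP; exists s, q.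
Qed.

(** Away from projectives, an orientation fails by a [gen] or by an [extp] condition. If both fail,
    two [gen] conditions give an isomorphism; one of each makes an Ext-projective object generated
    by the other, hence equal to it; two [extp] conditions make the torsion classes equal, and
    [two_max] gives a projective. *)
Lemma linked_compat p (L : 'I_p -> fdmod A) i j : rigid_list V L -> i != j ->
  tor V (L i) (L j) -> tor V (L j) (L i) -> ~ (proj (L i) /\ proj (L j)) ->
  linked (L i) (L j) \/ linked (L j) (L i).
Proof.
move=> hL ij tij tji np; have [iL rL _ Lu] := hL; have VL k := tor_V (rL k).
have ji : j != i by rewrite eq_sym.
have nij : ~ misom (L i) (L j) by move=> /Lu e; rewrite e eqxx in ij.
have nji : ~ misom (L j) (L i) by move/misom_sym.
have ng k l : k != l -> proj (L l) -> ~ gen (L k) (L l).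
  move=> kl hl /(gen_proj_iso (iL k) (VL k) (iL l) hl) /Lu e; by rewrite e eqxx in kl.
have ne k l : proj (L l) -> ~ proj (L k) -> ~ extp V (L l) (L k).
  move=> hl nk e; apply: nk; apply: (ext_proj hV (VL k)) => Y VY.
  by apply: e; apply: tor_proj.
have [hi|hi] := classic (proj (L i)).
  have hj : ~ proj (L j) by move=> hj; apply: np.
  by right; apply: linked_mod => //; [apply: ng | apply: ne].
have [hj|hj] := classic (proj (L j)).
  by left; apply: linked_mod => //; [apply: ng | apply: ne].
have [[g1 g2]|no] := classic (~ gen (L i) (L j) /\ ~ extp V (L j) (L i)).
  by left; apply: linked_mod.
have [[g1 g2]|no'] := classic (~ gen (L j) (L i) /\ ~ extp V (L i) (L j)).
  by right; apply: linked_mod.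
have c1 : gen (L i) (L j) \/ extp V (L j) (L i).
  have [|h1] := classic (gen (L i) (L j)); first by left.
  by right; apply: NNPP => h2; apply: no.
have c2 : gen (L j) (L i) \/ extp V (L i) (L j).
  have [|h1] := classic (gen (L j) (L i)); first by left.
  by right; apply: NNPP => h2; apply: no'.
exfalso; case: c1 c2 => [g1|e1] [g2|e2].
- by apply: nij; apply: gen_antisym.
- by have := add_of_gen aV hL tij e2 g1 => e; rewrite e eqxx in ij.
- by have := add_of_gen aV hL tji e1 g2 => e; rewrite e eqxx in ij.
apply: hi; apply: (two_max aV hL ji) => Z; split=> t; split; try exact: tor_V t.
  by move=> Y q VY qs; apply: e2; apply: tor_quo qs VY t.
by move=> Y q VY qs; apply: e1; apply: tor_quo qs VY t.
Qed.

End OneCat.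

(** * Paths in the cone of two weights *)

Section Path.
Variable V : fdmod A -> Prop.
Hypothesis gV : good V.
Let aV := good_ab gV.
Let hV := ab_w aV.
Variables (m : nat) (L : 'I_m -> fdmod A).
Hypothesis hL : rigid_list V L.
Let iL i : indecomposable (L i). Proof. by case: hL. Qed.
Let rL i : tor V (L i) (L i). Proof. by case: hL. Qed.
Let VL i : V (L i). Proof. exact: tor_V (rL i). Qed.

Definition supp (a b : 'I_m -> nat) i := (a i != 0%N) || (b i != 0%N).

Section Weights.
Variables u v : fdmod A -> int.
Hypotheses (gu : gfun V u) (gv : gfun V v).

Definition wt (c : nat * nat) Z := c.1%:Z * u Z + c.2%:Z * v Z.

Definition rep c a b := compatible V L a b /\ forall Z, wt c Z = cone V L a b Z.

Definition nz (c : nat * nat) := (c.1 != 0%N) || (c.2 != 0%N).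

Hypothesis wt_neq0 : forall c, nz c -> exists Z, wt c Z != 0.

Lemma gfun_wt c : gfun V (wt c).
Proof. by apply: (gfunD aV); apply: (gfunMz aV). Qed.

Lemma count_lt (T : eqType) (a b : pred T) (s : seq T) z : {subset a <= b} ->
  z \in s -> ~~ a z -> b z -> (count a s < count b s)%N.
Proof.
move=> ab; elim: s => // x s IH; rewrite inE => /orP [/eqP <-|zs] na bz /=.
  by rewrite (negPf na) bz add0n add1n ltnS sub_count.
have le : (a x <= b x)%N by by case ax: (a x) => //; have := ab x; rewrite !unfold_in ax => /(_ isT) ->.
by rewrite -addnS leq_add // IH.
Qed.

(** A weight [P] - [Q] takes on a quotient of [L j] values bounded by the dimensions of Hom(P, L j)
    and Hom(Q, L j), so all pairs of values lie in a finite box. *)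
Lemma box_exists : exists F : seq (int * int), forall j Z (q : mhom (L j) Z), V Z -> surjm q ->
  (u Z, v Z) \in F.
Proof.
have bound phi : gfun V phi -> exists B : nat, forall j Z (q : mhom (L j) Z), V Z -> surjm q ->
    `|phi Z| <= B%:Z.
  move=> [P [Q [hP hQ e]]]; exists (\sum_j (hm P (L j) + hm Q (L j)))%N => j Z q VZ qs.
  have le R : projective_in V R -> (hm R Z <= hm R (L j))%N.
    move=> hR; have [T [i [VT se]]] := quo_seV hV qs (VL j) VZ.
    by rewrite (proj_hm hV hR VT (VL j) se) leq_addl.
  rewrite e; apply: le_trans (ler_normB _ _) _; rewrite -PoszD lez_nat (bigD1 j) //=.
  by apply: leq_trans (leq_addr _ _); apply: leq_add; apply: le.
have [B1 h1] := bound u gu; have [B2 h2] := bound v gv.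
pose rng (B : nat) := [seq k%:Z - B%:Z | k <- iota 0 (B + B).+1].
have inr (B : nat) (x : int) : `|x| <= B%:Z -> x \in rng B.
  rewrite ler_norml => /andP [l1 l2]; apply/mapP; exists (absz (x + B%:Z)).
    rewrite mem_iota add0n leq0n /= ltnS -lez_nat gez0_abs; last by rewrite -lerBlDr sub0r.
    by rewrite PoszD lerD2r.
  by rewrite gez0_abs ?addrK // -lerBlDr sub0r.
exists [seq (x, y) | x <- rng B1, y <- rng B2] => j Z q VZ qs; apply/allpairsP.
by exists (u Z, v Z); split=> //; apply: inr; [apply: (h1 j Z q) | apply: (h2 j Z q)].
Qed.

Definition ev (c : nat * nat) (z : int * int) := c.1%:Z * z.1 + c.2%:Z * z.2.
Definition sep c d z := ((ev c z < 0) && (0 < ev d z)) || ((0 < ev c z) && (ev d z < 0)).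

Definition mix (x y : nat) (c d : nat * nat) := (x * c.1 + y * d.1, x * c.2 + y * d.2)%N.

Lemma ev_mix x y c d z : ev (mix x y c d) z = x%:Z * ev c z + y%:Z * ev d z.
Proof. by rewrite /ev /= !PoszD !PoszM; ring. Qed.

Lemma sep_mixr x y c d z : (0 < x)%N -> (0 < y)%N -> sep c (mix x y c d) z -> sep c d z.
Proof.
rewrite /sep ev_mix => x0 y0; have X : 0 < x%:Z by []; have Y : 0 < y%:Z by [].
case/orP => /andP [h1 h2]; rewrite h1 /=; apply/orP; [left|right].
  rewrite ltNge; apply/negP => le; move: h2; rewrite ltNge => /negP; apply.
  by rewrite -[0]addr0 lerD // pmulr_rle0 // ltW.
rewrite ltNge; apply/negP => le; move: h2; rewrite ltNge => /negP; apply.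
by apply: addr_ge0; rewrite pmulr_rge0 // ltW.
Qed.

Lemma sepC c d z : sep c d z = sep d c z.
Proof. by rewrite /sep orbC ![(0 < _) && _]andbC. Qed.

Lemma mixC x y c d : mix x y c d = mix y x d c.
Proof. by rewrite /mix addnC [(x * c.2 + _)%N]addnC. Qed.

Definition adm i := exists c a b, [/\ nz c, rep c a b & supp a b i].

(** Induction on the number of pairs in [F] at which the two weights have strictly opposite signs:
    an intermediate weight vanishing at one such pair is separated from either end at fewer
    pairs. *)
Theorem path_rel (E : 'I_m -> 'I_m -> Prop) :
  (forall i j k, adm i -> adm j -> adm k -> E i j -> E j k -> E i k) ->
  (forall c a b d a' b' i j, nz c -> nz d -> rep c a b -> rep d a' b' ->
     compatible V L (fun i => a i + a' i)%N (fun i => b i + b' i)%N ->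
     supp a b i -> supp a' b' j -> E i j) ->
  forall c a b d a' b' i j, nz c -> nz d -> rep c a b -> rep d a' b' ->
     supp a b i -> supp a' b' j -> E i j.
Proof.
move=> Etr Eco; have [F hF] := box_exists.
suff main k : forall c a b d a' b' i j, (count (sep c d) F < k)%N -> nz c -> nz d -> rep c a b ->
    rep d a' b' -> supp a b i -> supp a' b' j -> E i j.
  move=> c a b d a' b' i j; exact: (main _ c a b d a' b' i j (ltnSn _)).
elim: k => // k IH c a b d a' b' i j; rewrite ltnS => lt nc nd rc rd si sj.
have [/hasP [z zF sz]|/hasPn no] := boolP (has (sep c d) F).
  (* The crossed absolute values are the coefficients for which the positive and negative
     contributions at [z] cancel. *)
  pose x := `|ev d z|%N; pose y := `|ev c z|%N; pose w := mix x y c d.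
  have [x0 y0] : (0 < x)%N /\ (0 < y)%N.
    by rewrite !absz_gt0; case/orP: sz => /andP [h1 h2]; rewrite ?(lt_eqF h1, gt_eqF h1) ?(lt_eqF h2, gt_eqF h2).
  have w0 : ev w z = 0.
    rewrite ev_mix /x /y; case/orP: sz => /andP [h1 h2].
      by rewrite !abszE (gtr0_norm h2) (ltr0_norm h1); ring.
    by rewrite !abszE (gtr0_norm h1) (ltr0_norm h2); ring.
  have nw : nz w.
    move: nc; rewrite /nz /= !addn_eq0 !muln_eq0 !(gtn_eqF x0) /=.
    by case: (c.1 == 0%N) => //; case: (c.2 == 0%N) => //=; rewrite orbT.
  have [a2 [b2 rw]] := completeness aV hL (gfun_wt w).
  (* Here [wt_neq0] enters: for opposite weights [w] could be zero and its cone would have no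
     summand. *)
  have [l sl] : exists l, supp a2 b2 l.
    by have [Z] := wt_neq0 nw; rewrite (proj2 rw) => /zero_cone.
  have s1 : (count (sep c w) F < k)%N.
    apply: leq_trans lt; apply: count_lt zF _ sz; last by rewrite /sep w0 !ltxx !andbF.
    by move=> z'; apply: sep_mixr.
  have s2 : (count (sep w d) F < k)%N.
    apply: leq_trans lt; apply: count_lt zF _ sz; last by rewrite /sep w0 !ltxx !andFb.
    have h z' : sep w d z' -> sep c d z' by rewrite sepC [sep c d z']sepC /w mixC; apply: sep_mixr.
    by move=> z'; apply: h.
  apply: (Etr i l j).
  - by exists c, a, b.
  - by exists w, a2, b2.
  - by exists d, a', b'.
  - exact: IH s1 nc nw rc rw si sl.
  - exact: IH s2 nw nd rw rd sl sj.
(* By [cone_gen] the second weight is positive on every nonzero quotient of [L l]. Without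
   separation the first is nonnegative there, so [L l] lies in its [Tbar] and [cone_torsion]
   applies. *)
have half c1 a1 b1 c2 a2 b2 l : (forall z, z \in F -> ~~ sep c1 c2 z) -> rep c1 a1 b1 -> rep c2 a2 b2 ->
    a2 l != 0%N -> (forall i, a1 i != 0%N -> tor V (L i) (L l)) /\
                  (forall i, b1 i != 0%N -> hom0 (L i) (L l)).
  move=> ns [cab1 e1] [cab2 e2] hl; apply: (cone_torsion aV hL cab1 e1).
  split=> [|Z q VZ qs]; first exact: VL.
  have [Z0|Z0] := classic (is_zero Z).
    by rewrite (additive0 aV (gfun_additive aV (gfun_wt c1)) Z0).
  have pos := cone_gen aV hL cab2 e2 hl VZ (gen_surj qs (gen_refl _)) Z0.
  rewrite leNgt; apply/negP => neg.
  have /negP := ns _ (hF l Z q VZ qs); apply.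
  by rewrite /sep -[ev c1 _]/(wt c1 Z) -[ev c2 _]/(wt c2 Z) neg pos.
have no' z : z \in F -> ~~ sep d c z by move=> zF; rewrite sepC; apply: no.
apply: (Eco c a b d a' b') => //.
have [[t1 p1 h1] _] := rc; have [[t2 p2 h2] _] := rd.
have or2 x y : (x + y != 0)%N -> x != 0%N \/ y != 0%N.
  by have [->|] := eqVneq x 0%N; [rewrite add0n; right | left].
split=> [i1 j1 /or2 hi /or2 hj|i1 /or2 []|i1 j1 /or2 hi /or2 hj]; [|exact: p1|exact: p2|].
  case: hi hj => hi [] hj; [exact: t1 | | | exact: t2].
    by have [h _] := half _ _ _ _ _ _ _ no rc rd hj; apply: h.
  by have [h _] := half _ _ _ _ _ _ _ no' rd rc hj; apply: h.
case: hi hj => hi [] hj; [exact: h1 | | | exact: h2].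
  by have [_ h] := half _ _ _ _ _ _ _ no rc rd hj; apply: h.
by have [_ h] := half _ _ _ _ _ _ _ no' rd rc hj; apply: h.
Qed.

End Weights.
End Path.
End Links.

(** * The orbit statement by induction on the rank *)

Section Main.
Context {K : fieldType} {A : falgType K}.
Implicit Types (M N P Q S T X Y Z B C E R G : fdmod A).
Implicit Types (V U W : fdmod A -> Prop).
Implicit Types (s t : seq (fdmod A)).

Lemma seq_isom_refl s : seq_isom s s.
Proof. by elim: s => [|X s IH]; constructor; [apply: misom_refl|]. Qed.

Lemma seq_isom_sym s t : seq_isom s t -> seq_isom t s.
Proof. by elim=> *; constructor; [apply: misom_sym|]. Qed.

Lemma seq_isom_size s t : seq_isom s t -> size s = size t.
Proof. by elim=> //= X Y s' t' _ _ ->. Qed.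

Lemma seq_isom_rcons s t X Y : seq_isom s t -> misom X Y -> seq_isom (rcons s X) (rcons t Y).
Proof.
move=> h e; elim: h => [|X' Y' s' t' e' _ IH] /=; first by constructor => //; constructor.
by constructor.
Qed.

(** [left_mut] with the position left free, so that it is stable under appending a last term;
    [conn_orbit] recovers the index from the length. *)
Definition mutates V s t := exists s1 B C s2 t1 X Y t2,
  [/\ s = s1 ++ [:: B, C & s2], t = t1 ++ [:: X, Y & t2], seq_isom s1 t1, seq_isom s2 t2
    & left_mutation (Jseq V s2) B C X Y].

Definition step V s t := seq_isom s t \/ mutates V s t \/ mutates V t s.

Definition conn V := clos_refl_trans (seq (fdmod A)) (step V).

Lemma step_sym V s t : step V s t -> step V t s.
Proof. by case=> [/seq_isom_sym|[]]; [left | right; right | right; left]. Qed.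

Lemma conn_sym V s t : conn V s t -> conn V t s.
Proof.
elim=> {s t} [s t /step_sym|s|s t r _ h1 _ h2]; [exact: rt_step | exact: rt_refl |].
exact: rt_trans h2 h1.
Qed.

Lemma mutates_rcons V s t X : mutates (J V X) s t -> mutates V (rcons s X) (rcons t X).
Proof.
move=> [s1 [B [C [s2 [t1 [X1 [Y1 [t2 [-> -> i1 i2 lm]]]]]]]]].
exists s1, B, C, (rcons s2 X), t1, X1, Y1, (rcons t2 X); rewrite !rcons_cat /= Jseq_rcons.
by split=> //; apply: seq_isom_rcons => //; apply: misom_refl.
Qed.

Lemma conn_rcons V s t X : conn (J V X) s t -> conn V (rcons s X) (rcons t X).
Proof.
elim=> {s t} [s t h|s|s t r _ h1 _ h2]; [apply: rt_step | exact: rt_refl | exact: rt_trans h1 h2].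
case: h => [h|[h|h]]; first by left; apply: seq_isom_rcons => //; apply: misom_refl.
  by right; left; apply: mutates_rcons.
by right; right; apply: mutates_rcons.
Qed.

Lemma mutates_size V s t : mutates V s t -> size s = size t.
Proof.
move=> [s1 [B [C [s2 [t1 [X [Y [t2 [-> -> /seq_isom_size i1 /seq_isom_size i2 _]]]]]]]]].
by rewrite !size_cat /= i1 i2.
Qed.

Lemma conn_size V s t : conn V s t -> size s = size t.
Proof.
elim=> {s t} [s t [/seq_isom_size //|[/mutates_size //|/mutates_size //]]|//|s t r _ -> _ //].
Qed.

Lemma conn_orbit n r s t : (size s + r <= n)%N -> conn modA s t -> same_orbit n r s t.
Proof.
move=> le c; elim: c le => {s t} [s t h le|s _|s t u c1 IH1 c2 IH2 le]; first last.
- by apply: rt_trans (IH1 le) (IH2 _); rewrite -(conn_size c1).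
- exact: rt_refl.
have pos s' t' : (size s' + r <= n)%N -> mutates modA s' t' ->
    exists i, (r < i < n)%N /\ left_mut n i s' t'.
  move=> le' [s1 [B [C [s2 [t1 [X [Y [t2 [es et i1 i2 lm]]]]]]]]]; move: le'.
  (* This solves [size s2 = n - i.+1] for [i]; the bound [r < i] holds because [B] and [C] are
     counted in the size besides [s2]. *)
  rewrite es et size_cat /= => le'; exists (n - (size s2).+1)%N.
  split; first by lia.
  exists s1, B, C, s2, t1, X, Y, t2; split=> //; lia.
apply: rt_step; case: h => [h|[h|h]]; [by left | right | right].
  by have [i [hi hm]] := pos _ _ le h; exists i; split=> //; left.
have [|i [hi hm]] := pos _ _ _ h; first by rewrite (mutates_size h).
by exists i; split=> //; right.
Qed.

Section Induction.
Variable n : nat.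
Variable V : fdmod A -> Prop.
Hypothesis gV : good V.
Hypothesis rV : rkle V n.
Let aV := good_ab gV.
Let hV := ab_w aV.
Notation proj := (projective_in V).
Notation rig M := (tor V M M).
Hypothesis IH : forall U, good U -> rkle U n.-1 -> forall s t,
  tau_exceptional U s -> tau_exceptional U t -> Jseq U s = Jseq U t -> conn U s t.
Variable s0 : seq (fdmod A).
Hypothesis te0 : tau_exceptional V s0.
Let W := Jseq V s0.

Definition valid X := [/\ indecomposable X, rig X & forall Z, W Z -> J V X Z].

(** All sequences realising W with the given last terms are compared. The relation is vacuous when
    one side has none, so transitivity takes a middle term that is [valid] and hence, by
    [valid_seq], completes to a sequence. *)
Definition sim X Y := forall s t, tau_exceptional (J V X) s -> Jseq (J V X) s = W ->
  tau_exceptional (J V Y) t -> Jseq (J V Y) t = W -> conn V (rcons s X) (rcons t Y).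

Lemma valid_seq X : valid X -> exists s, tau_exceptional (J V X) s /\ Jseq (J V X) s = W.
Proof.
move=> [iX rX WX]; have [_ rJ] := rkle_J aV rV iX rX.
by apply: (Jseq_relative (good_J gV rX) rJ te0 gV) => // Z; apply: (J_V aV (tor_V rX)).
Qed.

Lemma sim_iso X Y : indecomposable X -> rig X -> misom X Y -> sim X Y.
Proof.
move=> iX rX e s t; rewrite -(J_iso aV (tor_V rX) e) => ts es tt et.
have [_ rJ] := rkle_J aV rV iX rX.
apply: rt_trans (conn_rcons (IH (good_J gV rX) rJ ts tt _)) _; first by rewrite es et.
by apply: rt_step; left; apply: seq_isom_rcons => //; apply: seq_isom_refl.
Qed.

Lemma sim_sym X Y : sim X Y -> sim Y X.
Proof. by move=> h s t ts es tt et; apply: conn_sym; apply: h. Qed.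

Lemma sim_trans X Y Z : valid Y -> sim X Y -> sim Y Z -> sim X Z.
Proof.
move=> /valid_seq [r [tr er]] h1 h2 s t ts es tt et.
exact: rt_trans (h1 _ _ ts es tr er) (h2 _ _ tr er tt et).
Qed.

(** A sequence [u] realising W in the common category extends by [B] in J(C) and by [X'] in J(X).
    The induction hypothesis connects these with [s] and [t], and one left mutation joins them. *)
Lemma sim_linked C X : valid C -> valid X -> linked V C X -> sim C X.
Proof.
move=> [iC rC WC] [iX rX WX] [B [X' [lm [iB rB] [iX' rX'] JE JE']]] s t ts es tt et.
have [_ rkC] := rkle_J aV rV iC rC; have [_ rkX] := rkle_J aV rV iX rX.
have gC := good_J gV rC; have gX := good_J gV rX.
have [_ rkB] := rkle_J (good_ab gC) rkC iB rB; have gB := good_J gC rB.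
have JJ : J (J V X) X' = J (J V C) B by apply: pred_eq => Z; rewrite JE JE'.
have [||u [tu eu]] := Jseq_relative gB rkB te0 gV.
- by move=> Z /JE [] /(J_V aV (tor_V rC)).
- by move=> Z WZ; apply/JE; split; [apply: WC | apply: WX].
have c1 : conn (J V C) s (rcons u B).
  apply: (IH gC rkC) => //; last by rewrite Jseq_rcons eu.
  by apply: TauExcRcons => //; apply/(tau_rigidP (good_ab gC)).
have c2 : conn (J V X) (rcons u X') t.
  apply: (IH gX rkX) => //; last by rewrite Jseq_rcons JJ eu.
  by apply: TauExcRcons; rewrite ?JJ //; apply/(tau_rigidP (good_ab gX)).
apply: rt_trans (conn_rcons c1) _; apply: rt_trans _ (conn_rcons c2).
apply: rt_step; right; left; exists u, B, C, [::], u, X', X, [::].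
by split=> //; rewrite -?cats1 -?catA //; apply: seq_isom_refl.
Qed.

Section Indexed.
Variables (p : nat) (L : 'I_p -> fdmod A).
Hypothesis hL : rigid_list V L.
Let iL i : indecomposable (L i). Proof. by case: hL. Qed.
Let rL i : rig (L i). Proof. by case: hL. Qed.
Let VL i : V (L i). Proof. exact: tor_V (rL i). Qed.
Let Lu i j : misom (L i) (L j) -> i = j. Proof. by case: hL => _ _ _; apply. Qed.

(** A shifted and an unshifted summand are always linked by [linked_proj], and two unshifted ones by
    [linked_compat] unless both are projective. What is left, two projectives on the same side, is
    delegated to the last hypothesis. *)
Lemma sim_compat a b i j : compatible V L a b -> supp a b i -> supp a b j ->
  valid (L i) -> valid (L j) ->
  (i != j -> proj (L i) -> proj (L j) -> (a i != 0%N) && (a j != 0%N) || (b i != 0%N) && (b j != 0%N) ->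
    sim (L i) (L j)) ->
  sim (L i) (L j).
Proof.
move=> [tab pb hab] si sj vi vj hp; have [<-|ij] := eqVneq i j.
  by apply: sim_iso => //; apply: misom_refl.
have mixed k l : a k != 0%N -> b l != 0%N -> valid (L k) -> valid (L l) -> sim (L l) (L k).
  move=> hk hl vk vl; apply: sim_linked => //.
  by apply: (linked_proj gV rV) => //; [apply: pb | apply: hab].
case/orP: si => hi; case/orP: sj => hj.
- have [[pi pj]|np] := classic (proj (L i) /\ proj (L j)); first by apply: hp; rewrite ?hi ?hj.
  have [h|h] := linked_compat gV rV hL ij (tab i j hi hj) (tab j i hj hi) np.
    exact: sim_linked.
  by apply: sim_sym; apply: sim_linked.
- by apply: sim_sym; apply: mixed.
- exact: mixed.
- by apply: hp; rewrite ?hi ?hj ?orbT //; apply: pb.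
Qed.

Definition semistable (u : fdmod A -> int) := forall Z, W Z -> Tbar V u Z /\ u Z = 0.

Lemma adm_valid u v i : semistable u -> semistable v -> adm V L u v i -> valid (L i).
Proof.
move=> su sv [c [a [b [nc [cab e] si]]]]; split=> // Z WZ.
have [[VZ tu] zu] := su Z WZ; have [[_ tv] zv] := sv Z WZ.
apply: (semistable_J gV hL cab e _ _ si); last by rewrite /wt zu zv !mulr0 addr0.
split=> // Y q VY qs; rewrite /wt addr_ge0 // mulr_ge0 //.
  exact: (tu Y q).
exact: (tv Y q).
Qed.

Lemma sim_path u v : gfun V u -> gfun V v -> semistable u -> semistable v ->
  (forall c, nz c -> exists Z, wt u v c Z != 0) ->
  (forall c a b d a' b' i j, nz c -> nz d -> rep V L u v c a b -> rep V L u v d a' b' ->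
     valid (L i) -> valid (L j) -> i != j -> proj (L i) -> proj (L j) ->
     (a i + a' i != 0)%N && (a j + a' j != 0)%N || (b i + b' i != 0)%N && (b j + b' j != 0)%N ->
     sim (L i) (L j)) ->
  forall c a b d a' b' i j, nz c -> nz d -> rep V L u v c a b -> rep V L u v d a' b' ->
     supp a b i -> supp a' b' j -> sim (L i) (L j).
Proof.
move=> gu gv su sv nopp hp.
apply: (path_rel gV hL gu gv nopp (E := fun i j => sim (L i) (L j))).
  by move=> i j k _ /(adm_valid su sv) vj _; apply: sim_trans.
move=> c a b d a' b' i j nc nd rc rd cab si sj.
have vi : valid (L i) by apply: (adm_valid su sv); exists c, a, b.
have vj : valid (L j) by apply: (adm_valid su sv); exists d, a', b'.
apply: (sim_compat cab) => //.
- by move: si; rewrite /supp -!lt0n !addn_gt0 => /orP [->|->]; rewrite ?orbT.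
- by move: sj; rewrite /supp -!lt0n !addn_gt0 => /orP [->|->]; rewrite ?orbT.
by move=> ij pi pj; apply: (hp c a b d a' b').
Qed.

Definition delta (x : 'I_p) (i : 'I_p) : nat := (i == x).

Lemma cone_delta x Z : cone V L (delta x) (fun=> 0%N) Z = th V L x Z.
Proof.
rewrite /cone /comb [X in _ - X]big1 ?subr0 => [|i _]; last by rewrite mul0r.
rewrite (bigD1 x) //= /delta eqxx mul1r big1 ?addr0 // => i /negPf ->; exact: mul0r.
Qed.

Lemma cone_deltaN x Z : cone V L (fun=> 0%N) (delta x) Z = - (hm (L x) Z)%:Z.
Proof.
rewrite /cone /comb big1 ?sub0r => [|i _]; last by rewrite mul0r.
by rewrite (bigD1 x) //= /delta eqxx mul1r big1 ?addr0 // => i /negPf ->; exact: mul0r.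
Qed.

Lemma compatible_delta x : compatible V L (delta x) (fun=> 0%N).
Proof.
split=> // i j; rewrite /delta !eqb0 !negbK => /eqP -> /eqP ->; exact: rL.
Qed.

Lemma compatible_deltaN x : proj (L x) -> compatible V L (fun=> 0%N) (delta x).
Proof. by move=> hx; split=> // i; rewrite /delta eqb0 negbK => /eqP ->. Qed.

Lemma valid_semistable x : valid (L x) -> semistable (th V L x).
Proof.
move=> [_ _ h] Z /h JZ; split; first exact: (J_Tbar gV (rL x) JZ).
exact: (theta_J aV (VL x) JZ).
Qed.

Lemma valid_semistableN x : proj (L x) -> valid (L x) -> semistable (fun Z => - (hm (L x) Z)%:Z).
Proof.
move=> hx [_ _ h] Z /h /(J_proj gV Z hx) [VZ h0].
split; last by rewrite ((hom0_dim _ _).1 h0) oppr0.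
split=> // Y q VY qs; rewrite (_ : hm _ _ = 0%N) ?oppr0 //; apply/hom0_dim => f.
by have [g <-] := proj_lift f hx VZ VY qs; rewrite (h0 g) mcomp0r.
Qed.

Lemma top_hom i j S (q : mhom (L i) S) : proj (L i) -> proj (L j) -> simple_in V S -> surjm q ->
  (0 < hm (L j) S)%N -> i = j.
Proof.
move=> hi hj hS qs pos.
have [f f0] : exists f : mhom (L j) S, f <> 0.
  apply: NNPP => H; move: pos; rewrite lt0n => /eqP; apply; apply/hom0_dim => f.
  by apply: NNPP => f0; apply: H; exists f.
have fs := simple_surj hV (VL j) hS f0.
exact: Lu (indec_proj_simple hi hj (iL i) (iL j) hS qs fs).
Qed.

(* Along the segment from [P] to -[P'] the only projective module that can
   occur unshifted is P, and the only one that can occur shifted is P'. *)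
Lemma sim_proj x y : proj (L x) -> proj (L y) -> valid (L x) -> valid (L y) -> sim (L x) (L y).
Proof.
move=> hx hy vx vy; have [<-|xy] := eqVneq x y; first by apply: sim_iso => //; apply: misom_refl.
pose u := th V L x; pose v Z : int := - (hm (L y) Z)%:Z.
have uE Z : u Z = (hm (L x) Z)%:Z by rewrite /u /th (theta_proj aV).
have gu : gfun V u by apply: gfun_theta.
have gv : gfun V v by apply: gfunN; apply: gfun_proj.
have topS i : exists S (q : mhom (L i) S), simple_in V S /\ surjm q.
  by apply: (simple_quotient hV (VL i)); case: (iL i).
(* At the simple top of [L i] the weight is positive by [cone_gen], and only the contribution of
   [L x] can be positive. *)
have fa c a b i : rep V L u v c a b -> a i != 0%N -> proj (L i) -> i = x.
  move=> [cab e] ai hi; have [S [q [hS qs]]] := topS i; have [VS S0 _] := hS.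
  have := cone_gen aV hL cab e ai VS (gen_surj qs (gen_refl _)) S0.
  rewrite /wt uE /v => pos; apply: (top_hom hi hx hS qs); rewrite lt0n; apply/eqP => h0.
  by move: pos; rewrite h0 mulr0 add0r mulrN oppr_gt0 ltNge mulr_ge0.
have fb c a b i : rep V L u v c a b -> b i != 0%N -> i = y.
  move=> [[cab pb hab] e] bi; have hi := pb i bi.
  have [S [q [hS qs]]] := topS i; have [VS S0 _] := hS.
  (* Unshifted summands contribute at most 0 at [S]: a nonzero map [L j -> S] would be onto, and
     [L i -> S] would lift to a nonzero map [L i -> L j], against compatibility. A negative value at
     [S] can only come from [L y]. *)
  have neg : wt u v c S < 0.
    rewrite e /cone /comb subr_lt0; apply: (@le_lt_trans _ _ 0).
      apply: sumr_le0 => j _; have [->|aj] := eqVneq (a j) 0%N; first by rewrite mul0r.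
      apply: mulr_ge0_le0 => //; apply: (th_hom0 aV hL VS) => f; apply: NNPP => f0.
      have fs := simple_surj hV (VL j) hS f0.
      have [g gE] := proj_lift q hi (VL j) VS fs; apply: (surj_ne0 qs S0).
      by rewrite -gE (hab i j bi aj g) mcomp0r.
    rewrite (bigD1 i) //= ltr_pwDl //; last by apply: sumr_ge0.
    by rewrite mulr_gt0 // ltz_nat ?lt0n // -lt0n; apply: top_pos qs.
  apply: (top_hom hi hy hS qs); rewrite lt0n; apply/eqP => h0.
  by move: neg; rewrite /wt uE /v h0 oppr0 mulr0 addr0 ltNge mulr_ge0.
have orx c a d a' i : (a i + a' i != 0)%N -> (a i != 0%N -> i = c) -> (a' i != 0%N -> i = d :> 'I_p) ->
    c = d -> i = c.
  move=> h h1 h2 e; have [ai|/h1 //] := eqVneq (a i) 0%N.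
  by rewrite e; apply: h2; move: h; rewrite ai add0n.
apply: (@sim_path u v gu gv _ _ _ _ (1, 0)%N (delta x) (fun=> 0%N) (0, 1)%N (fun=> 0%N) (delta y)) => //.
- exact: valid_semistable.
- exact: valid_semistableN.
(* The tops of [L x] and [L y] are different simples, and each weight vanishes at the top of the
   other; a zero combination would have both coefficients zero. *)
- move=> c nc; apply: NNPP => H.
  have z Z : wt u v c Z = 0 by apply/eqP; rewrite -[_ == _]negbK; apply/negP => h; apply: H; exists Z.
  have [S [q [hS qs]]] := topS x; have [VS S0 _] := hS.
  have [S' [q' [hS' qs']]] := topS y; have [VS' S0' _] := hS'.
  have y0 : hm (L y) S = 0%N.
    by apply/eqP; rewrite -leqn0 leqNgt; apply/negP => /(top_hom hx hy hS qs) e; rewrite e eqxx in xy.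
  have x0 : hm (L x) S' = 0%N.
    by apply/eqP; rewrite -leqn0 leqNgt; apply/negP => /(top_hom hy hx hS' qs') e; rewrite e eqxx in xy.
  have := z S; have := z S'; rewrite /wt !uE /v x0 y0 oppr0 !mulr0 addr0 add0r mulrN.
  move=> /eqP; rewrite oppr_eq0 mulf_eq0 !eqz_nat => h2 /eqP; rewrite mulf_eq0 !eqz_nat => h1.
  move: nc h1 h2; rewrite /nz; have := top_pos S0 qs; have := top_pos S0' qs'.
  by rewrite !lt0n => /negPf -> /negPf ->; rewrite !orbF => nc' /eqP e1 /eqP e2; move: nc'; rewrite e1 e2.
- move=> c a b d a' b' i j nc nd rc rd vi vj ij pi pj h.
  suff e : i = j by rewrite e eqxx in ij.
  have [h1|h1] := orP h; have /andP [ii jj] := h1.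
    have ei := orx x a x a' i ii (fun k => fa c a b i rc k pi) (fun k => fa d a' b' i rd k pi) erefl.
    have ej := orx x a x a' j jj (fun k => fa c a b j rc k pj) (fun k => fa d a' b' j rd k pj) erefl.
    by rewrite ei ej.
  have ei := orx y b y b' i ii (fun k => fb c a b i rc k) (fun k => fb d a' b' i rd k) erefl.
  have ej := orx y b y b' j jj (fun k => fb c a b j rc k) (fun k => fb d a' b' j rd k) erefl.
  by rewrite ei ej.
- split=> [|Z]; first exact: compatible_delta.
  by rewrite cone_delta /wt /= mul1r mul0r addr0.
- split=> [|Z]; first exact: compatible_deltaN.
  by rewrite cone_deltaN /wt /= mul1r mul0r add0r.
- by rewrite /supp /delta !eqxx.
- by rewrite /supp /delta !eqxx.
Qed.

Lemma sim_nonopp x y : valid (L x) -> valid (L y) ->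
  (forall c, nz c -> exists Z, wt (th V L x) (th V L y) c Z != 0) -> sim (L x) (L y).
Proof.
move=> vx vy nopp.
apply: (@sim_path (th V L x) (th V L y) _ _ _ _ nopp _ (1, 0)%N (delta x) (fun=> 0%N) (0, 1)%N
  (delta y) (fun=> 0%N)) => //.
- exact: gfun_theta.
- exact: gfun_theta.
- exact: valid_semistable.
- exact: valid_semistable.
- by move=> c a b d a' b' i j nc nd rc rd vi vj ij pi pj _; apply: sim_proj.
- split=> [|Z]; first exact: compatible_delta.
  by rewrite cone_delta /wt /= mul1r mul0r addr0.
- split=> [|Z]; first exact: compatible_delta.
  by rewrite cone_delta /wt /= mul1r mul0r add0r.
- by rewrite /supp /delta !eqxx.
- by rewrite /supp /delta !eqxx.
Qed.

(** The weight of a projective is nowhere negative, whereas theta_x is positive at [L x], so the two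
    weights cannot be opposite. *)
Lemma sim_any_proj x y : proj (L y) -> valid (L x) -> valid (L y) -> sim (L x) (L y).
Proof.
move=> hy vx vy; apply: sim_nonopp => // c nc; apply: NNPP => H.
have z Z : wt (th V L x) (th V L y) c Z = 0.
  by apply/eqP; rewrite -[_ == _]negbK; apply/negP => h; apply: H; exists Z.
have px := theta_self aV (iL x) (rL x); have py := theta_self aV (iL y) (rL y).
have yE Z : th V L y Z = (hm (L y) Z)%:Z by rewrite /th (theta_proj aV).
have c1 : c.1 = 0%N.
  apply/eqP; move: (z (L x)); rewrite /wt yE; apply: contra_eqT => c0.
  by rewrite gt_eqF // ltr_pwDl ?mulr_ge0 // mulr_gt0 // ltz_nat lt0n.
have := z (L y); rewrite /wt c1 mul0r add0r => /eqP.
rewrite mulf_eq0 (gt_eqF py) orbF eqz_nat => c2.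
by move: nc; rewrite /nz c1 c2.
Qed.

(** In the opposite case both weights are nonnegative, hence zero, on all quotients of an object of
    W. So theta_x vanishes on every composition factor of it, and the projective cover of a simple
    with nonzero theta_x is orthogonal to W. *)
Lemma sim_all x y : valid (L x) -> valid (L y) -> sim (L x) (L y).
Proof.
move=> vx vy.
have [nopp|opp] := classic (forall c, nz c -> exists Z, wt (th V L x) (th V L y) c Z != 0).
  exact: sim_nonopp.
have [c [nc z]] : exists c, nz c /\ forall Z, wt (th V L x) (th V L y) c Z = 0.
  apply: NNPP => H; apply: opp => c nc; apply: NNPP => H'; apply: H; exists c; split=> // Z.
  by apply/eqP; rewrite -[_ == _]negbK; apply/negP => h; apply: H'; exists Z.
have px := theta_self aV (iL x) (rL x); have py := theta_self aV (iL y) (rL y).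
have ax := additive_theta aV (VL x).
have c1 : c.1 != 0%N.
  apply/eqP => c1; have := z (L y); rewrite /wt c1 mul0r add0r => /eqP.
  rewrite mulf_eq0 (gt_eqF py) orbF eqz_nat => c2.
  by move: nc; rewrite /nz c1 c2.
have [S [hS nS]] : exists S, simple_in V S /\ theta V (L x) S <> 0.
  apply: NNPP => H; have := theta_self aV (iL x) (rL x).
  rewrite (additive_simples aV ax _ (VL x)) ?ltxx // => S hS.
  by apply: NNPP => nS; apply: H; exists S.
have [Q [q [hQ iQ qs]]] := simple_cover hV (ab_g aV) hS; have VQ := proj_V hQ.
have [_ _ Lx _] := hL; have [k ek] := Lx Q iQ (tor_proj aV hQ VQ).
have hk := proj_iso hV ek hQ.
suff vk : valid (L k).
  by apply: (sim_trans vk); [apply: sim_any_proj | apply: sim_sym; apply: sim_any_proj].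
split=> // Z WZ; rewrite -(J_iso aV VQ ek); apply/(J_proj gV Z hQ).
have [[VZ tx] _] := valid_semistable vx WZ; have [[_ ty] _] := valid_semistable vy WZ.
split=> //; apply: NNPP => nh.
have [I [i [r [VI ii rs]]]] := comp_factor aV hQ iQ hS qs VZ nh.
have z0 Y (f : mhom Z Y) : V Y -> surjm f -> theta V (L x) Y = 0.
  move=> VY fs; have h1 := tx Y f VY fs; have h2 := ty Y f VY fs.
  apply/eqP; rewrite eq_le h1 andbT; have := z Y; rewrite /wt => e.
  have : c.1%:Z * th V L x Y <= 0 by rewrite -e lerDl mulr_ge0.
  by rewrite pmulr_rle0 // ltz_nat lt0n.
have [C [g [VC se]]] := sub_seV hV ii VI VZ; have [_ _ gs] := se.
have [VS _ _] := hS; have [D [d [VD se']]] := quo_seV hV rs VI VS.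
have [_ add] := ax; have [di _ _] := se'; apply: nS.
(* Z, Z/I and Z/D all have weight zero, hence so does S = I/D. *)
have [F [h [VF se2]]] := sub_seV hV (injm_comp ii di) VD VZ.
have [_ _ hs] := se2.
have e1 := add _ _ _ _ _ VI VZ VC se; have e2 := add _ _ _ _ _ VD VI VS se'.
have e3 := add _ _ _ _ _ VD VZ VF se2.
have zZ := z0 Z (mid Z) VZ (surj_mid Z); have zC := z0 C g VC gs; have zF := z0 F h VF hs.
move: e3; rewrite zZ zF addr0 => e3; by move: e1; rewrite zZ zC addr0 e2 -e3 add0r => <-.
Qed.

End Indexed.

Lemma valid_sim X Y : valid X -> valid Y -> sim X Y.
Proof.
move=> vX vY; have [p [L hL]] := rigid_list_exists aV (good_fin gV); have [iL rL Lx _] := hL.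
have [iX rX WX] := vX; have [iY rY WY] := vY.
have [x ex] := Lx X iX rX; have [y ey] := Lx Y iY rY.
have vx : valid (L x) by split=> // Z WZ; rewrite -(J_iso aV (tor_V rX) ex); apply: WX.
have vy : valid (L y) by split=> // Z WZ; rewrite -(J_iso aV (tor_V rY) ey); apply: WY.
apply: (sim_trans vx); first exact: sim_iso.
apply: (sim_trans vy); first exact: (sim_all hL vx vy).
by apply: sim_iso => //; apply: misom_sym.
Qed.

End Induction.

(** The induction runs over a bound for the rank, so that the hypothesis applies to all categories
    J(X) at [n.-1]. If one sequence is empty, W is [V], and a last term of the other would lie in
    its own perpendicular category. *)
Theorem conn_all n : forall V, good V -> rkle V n -> forall s t,
  tau_exceptional V s -> tau_exceptional V t -> Jseq V s = Jseq V t -> conn V s t.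
Proof.
elim/ltn_ind: n => n IHn V gV rV s t ts tt; have aV := good_ab gV.
have last_valid V' s' : tau_exceptional V' s' -> good V' ->
    s' = [::] \/ exists r X, [/\ s' = rcons r X, indecomposable X, tor V' X X,
      tau_exceptional (J V' X) r & forall Z, Jseq V' s' Z -> J V' X Z].
  case=> [U _|U r X iX trX te gU]; first by left.
  have aU := good_ab gU; have /(tau_rigidP aU) rX := trX.
  right; exists r, X; split=> // Z; rewrite Jseq_rcons; exact: Jseq_sub te (abcat_J aU rX).
have nself X : indecomposable X -> tor V X X -> (forall Z, V Z -> J V X Z) -> False.
  by move=> iX rX h; apply: (J_nself aV iX rX); apply: h; apply: tor_V rX.
case: (last_valid V s ts gV) => [->|[s' [X [es iX rX ts' WX]]]].
  case: (last_valid V t tt gV) => [-> _|[t' [Y [-> iY rY tt' WY]]] e]; first exact: rt_refl.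
  by case: (nself Y iY rY) => Z VZ; apply: WY; rewrite -e.
case: (last_valid V t tt gV) => [->|[t' [Y [et iY rY tt' WY]]] e].
  by move=> e; case: (nself X iX rX) => Z VZ; apply: WX; rewrite e.
have [n0 _] := rkle_J aV rV iX rX.
have lt : (n.-1 < n)%N by rewrite prednK.
have vX : valid V s X by split.
have vY : valid V s Y by split=> // Z WZ; apply: WY; rewrite -e.
have sm := valid_sim gV rV (IHn _ lt) ts vX vY.
by rewrite {1}es et; apply: sm => //; rewrite -Jseq_rcons -?es // -et.
Qed.

(** Each term lowers the rank bound by at least one, by [rkle_J]. This puts all mutation indices
    above [r]. *)
Lemma size_rank r f : forall V s, tau_exceptional V s -> forall n, abcat V -> rkle V n ->
  fam (Jseq V s) r f -> (size s + r <= n)%N.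
Proof.
move=> V s; elim=> {V s} [V n aV [g hg] ff|V s X iX trX te IH n aV rV].
  by rewrite add0n; apply: fam_le hg ff.
have /(tau_rigidP aV) rX := trX; rewrite Jseq_rcons size_rcons => ff.
have [n0 rJ] := rkle_J aV rV iX rX.
by rewrite addSn -(prednK n0) ltnS; apply: IH rJ ff; apply: abcat_J.
Qed.

Lemma abcat_Jseq V s : tau_exceptional V s -> abcat V -> abcat (Jseq V s).
Proof.
elim=> {V s} // V s X _ trX te IH aV; rewrite Jseq_rcons; apply: IH.
by apply: abcat_J => //; apply/(tau_rigidP aV).
Qed.

Definition act_at M (x : M) (a : A) : M := mact M a x.

Fact act_at_is_linear M (x : M) : linear (@act_at M x).
Proof. by move=> k a b; rewrite /act_at linearP add_lfunE scale_lfunE. Qed.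

HB.instance Definition _ M (x : M) :=
  GRing.isLinear.Build K A M _ (@act_at M x) (@act_at_is_linear M x).

Fact act_at_hom M (x : M) (a : A) (v : @regular K A) :
  linfun (act_at x) (mact (@regular K A) a v) = mact M a (linfun (act_at x) v).
Proof. by rewrite !lfunE /= /act_at mactM comp_lfunE. Qed.

Definition reg_hom M (x : M) : mhom (@regular K A) M := mkhom (@act_at_hom M x).

Lemma reg_homE M (x : M) (a : A) : reg_hom x a = mact M a x.
Proof. exact: lfunE. Qed.

Lemma reg_hom_eq M (f : mhom (@regular K A) M) : f = reg_hom (f (1 : A)).
Proof.
apply: mhom_eq => a; rewrite reg_homE.
have /homvP /(_ a) /lfunP /(_ (1 : A)) := valP f.
by rewrite !comp_lfunE /= lfunE /= mulr1.
Qed.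

Lemma abcat_modA : abcat (@modA K A).
Proof.
split; first by split.
exists (@regular K A); split.
  split=> // X Y g f _ _ /surjmP gs; have [x xE] := gs (f (1 : A)).
  exists (reg_hom x); rewrite [RHS]reg_hom_eq [LHS]reg_hom_eq; congr reg_hom.
  by rewrite mcompE reg_homE mact1 lfunE.
move=> X _; apply/genP; have [m [q qu]] := univ_out (@regular K A) X.
exists m, q; apply/surjmP => x; have [h hE] := qu (reg_hom x).
by exists (h (1 : A)); rewrite -mcompE hE reg_homE mact1 lfunE.
Qed.

Lemma fin_modA : tau_tilting_finite (@modA K A) -> fin (@modA K A).
Proof.
move=> [m [L hL]]; exists m, L => X iX rX; apply: hL; last exact/(tau_rigidP abcat_modA).
exists 1%N, (fun=> X); split=> // [i j _|]; first by rewrite !ord1.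
by rewrite big_ord_recl big_ord0; apply: misom_sym; apply: dsum0r; apply: mod0_zero.
Qed.

Definition ext_ord r (L : 'I_r -> fdmod A) (i : nat) := if insub i is Some o then L o else mod0.

Lemma ext_ordE r (L : 'I_r -> fdmod A) (i : 'I_r) : ext_ord L i = L i.
Proof. by rewrite /ext_ord valK. Qed.

Lemma covers_has_rank W r : has_rank W r -> rkle W r.
Proof. by move=> [L [_ _ h]]; exists (ext_ord L) => S /h [i e]; exists i; rewrite ?ext_ordE. Qed.

Lemma fam_has_rank W r : has_rank W r -> exists f, fam W r f.
Proof.
move=> [L [h1 h2 _]]; exists (ext_ord L); split=> [i lt|i j li lj].
  by rewrite (ext_ordE L (Ordinal lt)).
by rewrite (ext_ordE L (Ordinal li)) (ext_ordE L (Ordinal lj)) => /h2 [].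
Qed.

End Main.

Theorem theorem2p6 (K : fieldType) (A : falgType K) (n : nat)
    (Abasic : basic_algebra A)
    (Afin : tau_tilting_finite (@modA K A))
    (An : has_rank (@modA K A) n) :
  (forall (W : fdmod A -> Prop) (r : nat), wide W -> has_rank W r ->
     forall s t : seq (fdmod A), tau_es W s -> tau_es W t -> same_orbit n r s t)
  /\
  (forall s t : seq (fdmod A),
     tau_exceptional modA s -> size s = n ->
     tau_exceptional modA t -> size t = n -> same_orbit n 0 s t).
Proof.
have aA := @abcat_modA K A; have gA : good (@modA K A) by split; [|apply: fin_modA].
have rA := covers_has_rank An; split=> [W r _ Wr s t [ts es] [tt et]|s t ts ss tt st].
  have es' := pred_eq es; have et' := pred_eq et.
  have [f ff] := fam_has_rank Wr; rewrite -es' in ff.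
  apply: conn_orbit; first exact: (size_rank ts aA rA ff).
  by apply: (conn_all gA rA ts tt); rewrite es' et'.
(* A complete sequence uses up the rank: a simple object in its perpendicular category would give a
   length of at most [n] minus 1. *)
have zero (u : seq (fdmod A)) : tau_exceptional modA u -> size u = n -> forall Z, Jseq modA u Z <-> is_zero Z.
  move=> tu su Z; have aJ := abcat_Jseq tu aA; split=> [JZ|]; last exact: (wide_iszero (ab_w aJ)).
  apply: NNPP => Z0; have [S [_ [hS _]]] := simple_quotient (ab_w aJ) JZ Z0.
  have ff : fam (Jseq modA u) 1 (fun=> S) by split=> // -[|i] [|j].
  by have := size_rank tu aA rA ff; rewrite su addn1 ltnn.
apply: conn_orbit; first by rewrite ss addn0.
apply: (conn_all gA rA ts tt); apply: pred_eq => Z.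
by rewrite (zero s ts ss) (zero t tt st).
Qed.
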